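(* Let $d_n\to\infty$ and let $(G_n,d_n)$ be an admissible sequence with matching measures $\rho_n=\rho_{G_n,d_n}$. (a) If $t(F,G_n,d_n)$ is convergent for every tree $F$, then the sequence of matching measures $\rho_n$ converges weakly to a probability measure $\rho$ on $[-2,2]$. Moreover, $$\limsup_{n\to\infty}\log\frac{\mathbb{M}(G_n)^{2/\mathrm{v}(G_n)}}{d_n}\le 2\int_{-2}^2\log|x|\,d\rho(x).$$ (b) If the sequence $(G_n,d_n)$ is $\alpha$-regular (for some $0\le\alpha\le1$), then the weak limit $\rho$ of the measures $\rho_n$ is the semicircle distribution on the interval $[-2\sqrt\alpha,2\sqrt\alpha]$, and $$\limsup_{n\to\infty}\frac{\mathbb{M}(G_n)^{2/\mathrm{v}(G_n)}}{d_n}\le\frac{\alpha}{e}.$$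
   Context: Graphs are finite, simple and undirected; $\mathrm{v}(F)$ and $\mathrm{c}(F)$ are the numbers of nodes and of connected components of $F$; $\hom(F,G)$ is the number of homomorphisms from $F$ to $G$. An admissible pair is a pair $(G,d)$ where $d\ge 1$ and $G$ is a graph with all degrees $\le d$; an admissible sequence is a sequence of admissible pairs. The homomorphism density is $t(F,G,d)=\hom(F,G)/\big(\mathrm{v}(G)^{\mathrm{c}(F)}d^{\,\mathrm{v}(F)-\mathrm{c}(F)}\big)\in[0,1]$. For $0\le\alpha\le1$, the admissible sequence $(G_n,d_n)$ is $\alpha$-regular if the degree of a uniform random vertex of $G_n$, divided by $d_n$, tends to $\alpha$ in probability as $n\to\infty$. Let $m_k(G)$ be the number of matchings in $G$ consisting of $k$ edges ($m_0(G)=1$). $\mathbb{M}(G)=\sum_{k}m_k(G)$ is the number of all matchings. The matching polynomial is $\mu(G,x)=\sum_{k=0}^{\lfloor \mathrm{v}(G)/2\rfloor}(-1)^km_k(G)x^{\mathrm{v}(G)-2k}$; all its roots are real. The matching measure $\rho_{G,d}$ is the uniform probability distribution on the points $\lambda/\sqrt d$, where $\lambda$ runs over the roots of $\mu(G,x)$ with multiplicity. The semicircle distribution on $[-2\beta,2\beta]$ is the distribution of $\beta X$, where $X$ is a random variable with density $w(x)=\sqrt{4-x^2}/(2\pi)$ on $[-2,2]$. *)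

(* Defs.v *)
From HB Require Import structures.
From mathcomp Require Import all_boot all_order all_algebra.
From mathcomp Require Import all_classical all_reals all_analysis.
From mathcomp Require Import measurable_realfun polyrcf.

Set Implicit Arguments.
Unset Strict Implicit.
Unset Printing Implicit Defensive.

Import Order.TTheory GRing.Theory Num.Theory.
Import numFieldNormedType.Exports.

Record sgraph := SGraph {
  vertex :> finType;
  adj : rel vertex;
  adj_sym : symmetric adj;
  adj_irr : irreflexive adj }.

Arguments adj {s}.

Definition nvert (G : sgraph) : nat := #|{: G}|.

Definition ncomp (G : sgraph) : nat := n_comp (@adj G) predT.

Definition degree (G : sgraph) (x : G) : nat := #|[pred y | adj x y]|.

Definition hom (F G : sgraph) : nat :=
  #|[set f : {ffun F -> G} |
      [forall x, forall y, adj x y ==> adj (f x) (f y)]]|.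

(** [ucycle adj p] also holds when [p] consists of the two ends of an edge,
    hence the bound on the length. *)
Definition is_tree (F : sgraph) : Prop :=
  [/\ (0 < nvert F)%N,
      forall x y : F, connect adj x y
    & forall p : seq F, ucycle adj p -> (size p <= 2)%N].

Definition edges (G : sgraph) : {set {set G}} :=
  [set e : {set G} | [exists x, exists y, adj x y && (e == [set x; y])]].

(** Edges are non-empty, so [trivIset M] says that the edges in [M] are
    pairwise disjoint. *)
Definition is_matching (G : sgraph) (M : {set {set G}}) : bool :=
  (M \subset edges G) && finset.trivIset M.

Definition nmatch (G : sgraph) (k : nat) : nat :=
  #|[set M : {set {set G}} | is_matching M & #|M| == k]|.

Definition total_matchings (G : sgraph) : nat :=
  #|[set M : {set {set G}} | is_matching M]|.

Lemma card_matching (G : sgraph) (M : {set {set G}}) :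
  is_matching M -> (#|M| <= (nvert G)./2)%N.
Proof.
case/andP=> /fintype.subsetP ME /eqP tM.
rewrite geq_half_double; apply: leq_trans (max_card (finset.cover M)).
rewrite -tM -muln2 -sum_nat_const leq_sum//.
move=> A /ME; rewrite inE => /existsP[x /existsP[y /andP[xy /eqP->]]].
by rewrite cards2; case: eqVneq xy => // ->; rewrite adj_irr.
Qed.

Lemma total_matchingsE (G : sgraph) :
  total_matchings G = (\sum_(k < (nvert G)./2.+1) nmatch G k)%N.
Proof.
rewrite /total_matchings -sum1_card.
rewrite (partition_big (fun M : {set {set G}} => inord #|M| : 'I_(nvert G)./2.+1)
  xpredT)//=.
apply: eq_bigr => k _; rewrite /nmatch -sum1_card; apply: eq_bigl => M.
rewrite !inE; case: (boolP (is_matching M)) => //= mM.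
by rewrite -val_eqE/= inordK// ltnS card_matching.
Qed.

Local Open Scope classical_set_scope.
Local Open Scope ring_scope.

Section real.
Context {R : realType}.
Implicit Types (G F : sgraph) (d : R).

(** The degree bound [d] is a real number.  Graphs in admissible pairs are
    non-empty. *)
Definition admissible G d : Prop :=
  [/\ (0 < nvert G)%N, 1 <= d & forall x : G, (degree x)%:R <= d].

Definition density F G d : R :=
  (hom F G)%:R / ((nvert G)%:R ^+ ncomp F * d ^+ (nvert F - ncomp F)).

Definition alpha_regular (alpha : R) (G : nat -> sgraph) (d : nat -> R) : Prop :=
  forall eps : R, 0 < eps ->
    #|[pred x : G n | eps < `|(degree x)%:R / d n - alpha|]|%:R
      / (nvert (G n))%:R @[n --> \oo] --> (0 : R).

Definition matching_poly G : {poly R} :=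
  \sum_(k < (nvert G)./2.+1)
    ((-1) ^+ k * (nmatch G k)%:R) *: 'X^(nvert G - k.*2).

(** The roots of [p] in [R], with multiplicity.  This is the full multiset of
    roots of a matching polynomial, whose roots are all real. *)
Definition roots_mult (p : {poly R}) : seq R :=
  flatten [seq nseq (mup x p) x | x <- rootsR p].

Definition matching_measure G d : {measure set R -> \bar R} :=
  mscale ((nvert G)%:R^-1)%:nng
    (msum (fun k => \d_((roots_mult (matching_poly G))`_k / Num.sqrt d))
          (size (roots_mult (matching_poly G)))).

Definition weak_cvg (mu_ : nat -> {measure set R -> \bar R})
    (mu : {measure set R -> \bar R}) : Prop :=
  forall f : R -> R, continuous f -> bounded_fun f ->
    (\int[mu_ n]_x (f x)%:E)%E @[n --> \oo] --> (\int[mu]_x (f x)%:E)%E.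

(** [Num.sqrt] vanishes on negative reals, so this density is supported
    on [-2, 2]. *)
Definition semicircle_pdf (x : R) : R := Num.sqrt (4 - x ^+ 2) / (2 * pi).

Lemma semicircle_pdf_ge0 (x : R) : 0 <= semicircle_pdf x.
Proof. by rewrite divr_ge0 ?sqrtr_ge0// mulr_ge0// pi_ge0. Qed.

Lemma measurable_semicircle_pdf : measurable_fun [set: R] semicircle_pdf.
Proof.
apply: measurable_funM => //; apply: continuous_measurable_fun => x.
apply: (continuous_comp (f := fun x : R => 4 - x ^+ 2)); last first.
  exact: sqrt_continuous.
apply: cvgB; first exact: cvg_cst.
exact: exprn_continuous.
Qed.

Definition std_semicircle : set R -> \bar R :=
  fun A => (\int[lebesgue_measure]_(x in A) (semicircle_pdf x)%:E)%E.

Let std_semicircle0 : std_semicircle set0 = 0%E.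
Proof. by rewrite /std_semicircle integral_set0. Qed.

Let std_semicircle_ge0 A : (0 <= std_semicircle A)%E.
Proof. by apply: integral_ge0 => x _; rewrite lee_fin semicircle_pdf_ge0. Qed.

Let std_semicircle_sigma_additive : semi_sigma_additive std_semicircle.
Proof.
move=> /= F mF tF mUF; rewrite /std_semicircle; apply: cvg_toP.
  apply: ereal_nondecreasing_is_cvgn => m n mn.
  apply: lee_sum_nneg_natr => // k _ _.
  exact: std_semicircle_ge0.
rewrite ge0_integral_bigcup//=.
- apply: measurable_funTS; apply: measurableT_comp => //.
  exact: measurable_semicircle_pdf.
- by move=> x _; rewrite lee_fin semicircle_pdf_ge0.
Qed.

HB.instance Definition _ := isMeasure.Build _ _ _ std_semicircle
  std_semicircle0 std_semicircle_ge0 std_semicircle_sigma_additive.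

(** The law of [b * X], where [X] has law [std_semicircle]; for [b = 0] it is
    the Dirac mass at 0. *)
Definition semicircle (b : R) : set R -> \bar R :=
  pushforward std_semicircle ( *%R b).

Let semicircle0 b : semicircle b set0 = 0%E.
Proof. by rewrite /semicircle /pushforward preimage_set0 measure0. Qed.

Let semicircle_ge0 b A : (0 <= semicircle b A)%E.
Proof. exact: std_semicircle_ge0. Qed.

Let measurable_mulr (b : R) : measurable_fun [set: R] ( *%R b).
Proof. by apply: measurable_funM. Qed.

Let semicircle_sigma_additive b : semi_sigma_additive (semicircle b).
Proof.
move=> F mF tF mUF; rewrite /semicircle /pushforward preimage_bigcup.
have mp A : measurable A -> measurable ( *%R b @^-1` A).
  by move=> mA; rewrite -[X in measurable X]setTI; exact: measurable_mulr.
apply: (measure_semi_sigma_additive (s := std_semicircle)).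
- by move=> n; exact: mp.
- apply/trivIsetP => /= i j _ _ ij; rewrite -preimage_setI.
  by move/trivIsetP : tF => /(_ _ _ _ _ ij) ->//; rewrite preimage_set0.
- by rewrite -preimage_bigcup; exact: mp.
Qed.

HB.instance Definition _ b := isMeasure.Build _ _ _ (semicircle b)
  (semicircle0 b) (semicircle_ge0 b) (@semicircle_sigma_additive b).

End real.

(* Main.v *)
(** Let [mu(S)] be the matching polynomial of the subgraph induced by [S].  Expanding along
    a vertex [v] gives [mu(S) = x mu(S - v) - \sum_(u ~ v) mu(S - v - u)].  The roots are
    therefore real, they lie in [[-2 sqrt d, 2 sqrt d]] when the degrees are at most [d], and
    their power sums count tree-like closed walks.  Up to an error [O(1 / d)] these are coded
    by homomorphisms from plane trees, so convergence of the tree densities gives convergence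
    of the moments of [rho_n], hence of [rho_n] itself.  In the [alpha]-regular case the counts
    are [alpha ^ j] times the Catalan numbers, the moments of the semicircle law.

    As [M(G) = \prod_r (1 + r ^ 2)^(1/2)] over the roots [r], the logarithm of
    [M(G)^(2 / v(G)) / d] is the [rho_n]-mean of [ln (1 / d + x ^ 2)], which is eventually at
    most the mean of [ln (eps + x ^ 2)]; then let [n -> oo] and [eps -> 0].  The limit for the
    semicircle law is not computed: complete graphs are [1]-regular, and there the mean of
    [ln (eps + x ^ 2)] can be bounded by hand through the recursion above. *)

Require Import Defs.
From HB Require Import structures.
From mathcomp Require Import all_boot all_order all_algebra.
From mathcomp Require Import all_classical all_reals all_analysis.
From mathcomp Require Import measurable_realfun polyrcf complex ring lra.

Set Implicit Arguments.
Unset Strict Implicit.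
Unset Printing Implicit Defensive.

Import Order.TTheory GRing.Theory Num.Theory.
Import numFieldNormedType.Exports.

Local Open Scope ring_scope.

(** * Matching generating functions *)

(** In part (a) the limit measure has to be produced from its moments alone. Measures are therefore
    handled as functionals on continuous functions ([is_mean]), a notion that passes to limits; the
    limiting functional is then turned into a measure through a distribution function read off from
    continuous cut-offs. The logarithm is unbounded at 0, where the [rho_n] may concentrate, so weak
    convergence does not apply to it; the regularisation by [eps] works in one direction only, hence
    an upper bound.

    A single generating function [mgen x t] serves three ends: [t = -1] gives the matching
    polynomial, [x = t = 1] counts matchings, and [x = 1] with [t = - 'X^2] gives the reversed
    polynomial of Newton's identities. Power series of walks are replaced by polynomials truncated
    at depth [J], and identities between series by congruences modulo a power of the variable.

    In part (b) the limit of a mean depends on [alpha] only, so a bound along one 1-regular sequence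
    is a bound for the law, and scaling extends it to every [alpha]. The constant [1 / e] comes from
    the growth of [n!]. *)

Section MatchingGenFun.
Variable G : sgraph.
Implicit Types (S : {set G}) (M : {set {set G}}) (u v : G).

Lemma card_cover_matching M : is_matching M -> #|finset.cover M| = #|M|.*2.
Proof.
case/andP=> /fintype.subsetP ME /eqP <-.
rewrite -muln2 -sum_nat_const; apply: eq_bigr => e /ME.
rewrite inE => /existsP[a /existsP[b /andP[ab /eqP->]]].
by rewrite cards2; case: eqVneq ab => // ->; rewrite adj_irr.
Qed.

Lemma matching_edge_uniq M v u w : is_matching M ->
  [set v; u]%SET \in M -> [set v; w]%SET \in M -> u = w.
Proof.
case/andP=> _ /finset.trivIsetP tM uM wM.
case: (eqVneq [set v; u]%SET [set v; w]%SET) => [e|ne].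
  have : u \in [set v; w]%SET by rewrite -e !inE eqxx orbT.
  rewrite !inE => /orP[/eqP uv|/eqP//].
  have : w \in [set v; u]%SET by rewrite e !inE eqxx orbT.
  by rewrite !inE uv orbb => /eqP.
have /disjoint_setI0/setP/(_ v) := tM _ _ uM wM ne.
by rewrite !inE eqxx.
Qed.

Lemma matching_coverP M v : is_matching M ->
  reflect (exists2 u, adj v u & [set v; u]%SET \in M) (v \in finset.cover M).
Proof.
case/andP=> /fintype.subsetP ME _.
apply: (iffP finset.bigcupP) => [[e eM ve]|[u _ uM]]; last first.
  by exists [set v; u]%SET => //; rewrite !inE eqxx.
have := ME _ eM; rewrite inE => /existsP[a /existsP[b /andP[ab /eqP ee]]].
move: ve; rewrite ee !inE => /orP[]/eqP vE.
  by exists b; rewrite vE// -ee.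
by exists a; [rewrite vE adj_sym|rewrite vE finset.setUC -ee].
Qed.

Variable A : comNzRingType.

(** [mgen x t setT] is the matching polynomial [mu(G, x)] for [t = -1]. *)
Definition mgen (x t : A) S : A :=
  \sum_(M : {set {set G}} | is_matching M && (finset.cover M \subset S))
    t ^+ #|M| * x ^+ (#|S| - #|M|.*2).

Lemma is_matching0 : is_matching (finset.set0 : {set {set G}}).
Proof.
rewrite /is_matching finset.sub0set /=.
by apply/finset.trivIsetP => a b; rewrite inE.
Qed.

Lemma mgen0 x t : mgen x t finset.set0 = 1.
Proof.
rewrite /mgen (big_pred1 finset.set0) => [|M /=]; first by rewrite !cards0 !expr0 mulr1.
apply/andP/eqP => [[mM]|->]; last by rewrite is_matching0 /finset.cover big_set0 finset.sub0set.
rewrite finset.subset0 => /eqP cM.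
by apply/eqP; rewrite -cards_eq0 -double_eq0 -(card_cover_matching mM) cM cards0.
Qed.

Lemma cover_setD1 M (e : {set G}) : is_matching M -> e \in M ->
  finset.cover (M :\ e) = (finset.cover M :\: e)%SET.
Proof.
case/andP=> _ /finset.trivIsetP tM eM; apply/setP => x; rewrite finset.in_setD.
apply/finset.bigcupP/andP => [[f]|[xe /finset.bigcupP[f fM xf]]].
  rewrite !inE => /andP[fe fM] xf; split; last by apply/finset.bigcupP; exists f.
  have /disjoint_setI0/setP/(_ x) := tM _ _ fM eM fe.
  by rewrite !inE xf /= => ->.
by exists f => //; rewrite !inE fM andbT; apply: contraNneq xe => <-.
Qed.

Lemma cover_setU1 M (e : {set G}) :
  finset.cover (e |: M) = (e :|: finset.cover M)%SET.
Proof.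
case: (boolP (e \in M)) => eM; last by rewrite /finset.cover big_setU1.
have -> : e |: M = M by apply/setP => f; rewrite !inE; case: eqP => // ->; rewrite eM.
apply/esym/finset.setUidPr; apply/fintype.subsetP => x xe.
by apply/finset.bigcupP; exists e.
Qed.

Lemma is_matchingS M M' : M' \subset M -> is_matching M -> is_matching M'.
Proof.
move=> sM /andP[ME /finset.trivIsetP tM].
rewrite /is_matching (fintype.subset_trans sM ME) /=.
by apply/finset.trivIsetP => a b /(fintype.subsetP sM) aM /(fintype.subsetP sM); exact: tM.
Qed.

Lemma is_matchingU1 M v u : is_matching M -> adj v u ->
  [disjoint [set v; u]%SET & finset.cover M] ->
  is_matching ([set v; u]%SET |: M).
Proof.
case/andP=> ME /finset.trivIsetP tM vu dM; apply/andP; split.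
  apply/fintype.subsetP => e; rewrite inE => /orP[|/(fintype.subsetP ME)//].
  rewrite inE => /eqP->; rewrite inE; apply/existsP; exists v.
  by apply/existsP; exists u; rewrite vu eqxx.
have dis f : f \in M -> [disjoint [set v; u]%SET & f].
  move=> fM; apply: disjointWr dM; apply/fintype.subsetP => x xf.
  by apply/finset.bigcupP; exists f.
apply/finset.trivIsetP => a b; rewrite !inE.
move=> /orP[/eqP->|aM] /orP[/eqP->|bM] ab.
- by rewrite eqxx in ab.
- exact: dis.
- by rewrite disjoint_sym; exact: dis.
- exact: tM.
Qed.

Lemma mgen_rec x t S v : v \in S ->
  mgen x t S = x * mgen x t (S :\ v)
             + t * \sum_(u in S | adj v u) mgen x t (S :\ v :\ u).
Proof.
move=> vS; have cS : #|S| = #|S :\ v|.+1 by rewrite (cardsD1 v S) vS.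
rewrite {1}/mgen (bigID (fun M => v \notin finset.cover M)) /=; congr (_ + _).
  rewrite /mgen big_distrr /=; apply: eq_big => [M|M vM].
    by rewrite finset.subsetD1 andbA.
  have /andP[/andP[mM cM] vcM] := vM; rewrite mulrCA -exprS cS subSn//.
  rewrite -card_cover_matching//; apply: subset_leq_card.
  by rewrite finset.subsetD1 cM vcM.
pose e u := [set v; u]%SET.
(* A matching that covers [v] contains exactly one edge [e u], so the sum over [u] counts it
   once. *)
transitivity (\sum_(u in S | adj v u)
    \sum_(M : {set {set G}} | [&& is_matching M, finset.cover M \subset S & e u \in M])
      t ^+ #|M| * x ^+ (#|S| - #|M|.*2)).
  rewrite (exchange_big_dep (fun M : {set {set G}} => (is_matching M && (finset.cover M \subset S))
     && ~~ (v \notin finset.cover M))) /=.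
    apply: eq_bigr => M /andP[/andP[mM cM]]; rewrite negbK => vM.
    have /matching_coverP[//|u vu uM] := vM.
    rewrite (big_pred1 u)// => w /=; rewrite mM cM /=.
    apply/idP/eqP => [/andP[_ wM]|->]; first exact: (matching_edge_uniq mM wM uM).
    rewrite vu uM /= !andbT; apply: (fintype.subsetP cM).
    by apply/finset.bigcupP; exists (e u) => //; rewrite !inE eqxx orbT.
  move=> u M /andP[uS vu] /and3P[mM cM uM]; rewrite mM cM /= negbK.
  by apply/finset.bigcupP; exists (e u) => //; rewrite !inE eqxx.
rewrite big_distrr /=; apply: eq_bigr => u /andP[uS vu].
have vNu : v != u by apply: contraTneq vu => ->; rewrite adj_irr.
have eS : e u \subset S.
  by apply/fintype.subsetP => w; rewrite !inE => /orP[]/eqP->.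
have SD : (S :\ v :\ u = S :\: e u)%SET.
  by apply/setP => w; rewrite !inE negb_or andbA (andbC (w != u)).
(* Removing [e u] is a bijection onto the matchings that avoid both [v] and [u]. *)
rewrite (reindex_onto (fun M => e u |: M)%SET (fun M => M :\ e u)%SET) /=; last first.
  by move=> M /and3P[_ _ uM]; rewrite finset.setD1K.
rewrite /mgen big_distrr /=; apply: eq_big => [M|M].
  rewrite cover_setU1 SD; apply/andP/andP.
    move=> [/and3P[mM cM _] /eqP eM].
    have euM : e u \notin M by rewrite -eM !inE eqxx.
    have mM' : is_matching M.
      by apply: is_matchingS mM; exact: finset.subsetUr.
    split=> //; have := cover_setD1 mM (finset.setU11 _ _).
    rewrite finset.setU1K// => ->; apply: finset.setSD.
    by rewrite cover_setU1.
  move=> [mM cM]; have dM : [disjoint e u & finset.cover M].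
    by move: cM; rewrite finset.subsetD => /andP[_]; rewrite disjoint_sym.
  have euM : e u \notin M.
    apply: contraL dM => eM; apply/pred0Pn; exists v.
    rewrite /= !inE eqxx /=; apply/finset.bigcupP; exists (e u) => //.
    by rewrite !inE eqxx.
  split; last by rewrite finset.setU1K.
  rewrite is_matchingU1//= finset.setU11 andbT finset.subUset eS /=.
  by move: cM; rewrite finset.subsetD => /andP[].
move=> /andP[/and3P[mM cM _] /eqP eM].
have euM : e u \notin M by rewrite -eM !inE eqxx.
rewrite cardsU1 euM add1n exprS mulrA; congr (_ * _ ^+ _).
rewrite cS (cardsD1 u (S :\ v)%SET) !inE eq_sym vNu uS /= add1n doubleS.
by rewrite !subSS.
Qed.

(** Homogeneity: an uncovered vertex has weight 1 and an edge, replacing two of them, weight 2. The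
    case [a = -1] gives the parity of the matching polynomial, [a = 'i] exchanges [t = -1] and
    [t = 1], and [a = y] reverses the polynomial. *)
Lemma mgen_scale (a x t : A) S :
  mgen (a * x) (a ^+ 2 * t) S = a ^+ #|S| * mgen x t S.
Proof.
rewrite /mgen big_distrr /=; apply: eq_bigr => M /andP[mM cM].
have kS : (#|M|.*2 <= #|S|)%N by rewrite -card_cover_matching// subset_leq_card.
rewrite [(a ^+ 2 * t) ^+ _]exprMn [(a * x) ^+ _]exprMn -[(a ^+ 2) ^+ _]exprM.
by rewrite mulnC muln2 mulrACA -exprD subnKC.
Qed.

(** A matching occurs on the left once for each vertex of [S] that it misses. This is the derivative
    in [x] of [mgen x t S], taken at [x = 1]. *)
Lemma mgen1_sum (t : A) S :
  \sum_(v in S) mgen 1 t (S :\ v) =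
  \sum_(M : {set {set G}} | is_matching M && (finset.cover M \subset S))
    t ^+ #|M| *+ (#|S| - #|M|.*2).
Proof.
rewrite /mgen (exchange_big_dep (fun M : {set {set G}} =>
  is_matching M && (finset.cover M \subset S))) /=; last first.
  by move=> v M vS; rewrite finset.subsetD1 => /and3P[-> ->].
apply: eq_bigr => M /andP[mM cM]; rewrite -card_cover_matching//.
have <- : #|S :\: finset.cover M|%SET = (#|S| - #|finset.cover M|)%N.
  by rewrite cardsD (finset.setIidPr cM).
rewrite -sumr_const.
apply: eq_big => [v|v _]; last by rewrite expr1n mulr1.
by rewrite !inE finset.subsetD1 mM cM /= andbC.
Qed.

End MatchingGenFun.

Lemma matching_coverT (G : sgraph) (M : {set {set G}}) :
  is_matching M && (finset.cover M \subset [set: G]%SET) = is_matching M.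
Proof. by rewrite finset.subsetT andbT. Qed.

Lemma matching_polyE (R : realType) (G : sgraph) :
  matching_poly G = mgen 'X (-1) [set: G]%SET :> {poly R}.
Proof.
rewrite /mgen (eq_bigl _ _ (@matching_coverT G)) cardsT -/(nvert G).
rewrite (partition_big (fun M : {set {set G}} => inord #|M| : 'I_(nvert G)./2.+1)
  xpredT)//=.
apply: eq_bigr => k _; have cE (M : {set {set G}}) :
    is_matching M && (inord #|M| == k) = (M \in [set M : {set {set G}} | is_matching M & #|M| == k]%SET).
  rewrite inE; case: (boolP (is_matching M)) => //= mM.
  by rewrite -val_eqE/= inordK// ltnS card_matching.
rewrite (eq_bigl _ _ cE) (eq_bigr (fun=> ((-1) ^+ k : R) *: 'X^(nvert G - k.*2))).
  by rewrite sumr_const mulr_natr -scalerMnl.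
move=> M; rewrite inE => /andP[_ /eqP->].
by rewrite -mul_polyC rmorphXn rmorphN1.
Qed.

Lemma total_matchings_mgen (A : comNzRingType) (G : sgraph) :
  (total_matchings G)%:R = mgen 1 1 [set: G]%SET :> A.
Proof.
rewrite /mgen (eq_bigl _ _ (@matching_coverT G)) (eq_bigr (fun=> 1)).
  by rewrite sumr_const /total_matchings; congr (_ *+ _); apply: eq_card => M; rewrite !inE.
by move=> M _; rewrite !expr1n mulr1.
Qed.

(** * Roots of the matching polynomial *)

Lemma mgen_rmorph (A B : comNzRingType) (f : {rmorphism A -> B}) (G : sgraph)
    (x t : A) (S : {set G}) :
  f (mgen x t S) = mgen (f x) (f t) S.
Proof.
by rewrite /mgen rmorph_sum; apply: eq_bigr => M _; rewrite rmorphM !rmorphXn.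
Qed.

(** The ratio [mu(S) / mu(S - v)] equals [x] minus the sum of the inverses of the ratios
    [mu(S - v) / mu(S - v - u)], so by induction on [S] it stays in the upper half plane. *)
Lemma mgen_upper_half_plane (C : numClosedFieldType) (G : sgraph) (x : C) (S : {set G}) :
  0 < 'Im x -> mgen x (-1) S != 0 /\
  forall v, v \in S -> 0 < 'Im (mgen x (-1) S / mgen x (-1) (S :\ v)).
Proof.
move=> x0; have [n] := ubnP #|S|; elim: n S => // n IHn S nS.
have ratio v : v \in S -> 0 < 'Im (mgen x (-1) S / mgen x (-1) (S :\ v)).
  move=> vS; have [] := IHn (S :\ v)%SET.
    by rewrite -ltnS (leq_trans _ nS)// (cardsD1 v S) vS.
  move=> m0 IHv; rewrite (mgen_rec _ _ vS) mulN1r mulrBl mulfK// raddfB.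
  rewrite big_distrl raddf_sum /= -sumrN ltr_wpDr// sumr_ge0// => u /andP[uS vu].
  have uSv : u \in (S :\ v)%SET.
    by rewrite !inE uS andbT; apply: contraTneq vu => ->; rewrite adj_irr.
  rewrite -invf_div ImV mulNr opprK divr_ge0 ?exprn_ge0//.
  exact/ltW/IHv.
split=> //; have [->|[v vS]] := set_0Vmem S; first by rewrite mgen0 oner_eq0.
by apply/eqP => S0; have := ratio _ vS; rewrite S0 mul0r raddf0 ltxx.
Qed.

Lemma mgenN (A : comNzRingType) (G : sgraph) (x t : A) (S : {set G}) :
  mgen (- x) t S = (-1) ^+ #|S| * mgen x t S.
Proof. by rewrite -mgen_scale sqrrN expr1n mul1r mulN1r. Qed.

(** If [x] is not real, [x] or [- x] lies in the upper half plane, and by parity both are roots or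
    neither is. *)
Lemma mgen_root_real (C : numClosedFieldType) (G : sgraph) (x : C) (S : {set G}) :
  mgen x (-1) S = 0 -> x \is Num.real.
Proof.
move=> x0; apply/Creal_ImP/eqP; move: (Creal_Im x).
rewrite realE le_eqVlt [_ <= 0]le_eqVlt (eq_sym 0) => /orP[] /orP[//|Ix].
  by have [] := mgen_upper_half_plane S Ix; rewrite x0 eqxx.
have Ix' : 0 < 'Im (- x) by rewrite raddfN oppr_gt0.
have [] := mgen_upper_half_plane S Ix'.
by rewrite mgenN x0 mulr0 eqxx.
Qed.

Lemma size_mgenX (A : idomainType) (G : sgraph) (S : {set G}) (t : A) :
  mgen 'X t%:P S \is monic /\ size (mgen 'X t%:P S) = #|S|.+1.
Proof.
have [n] := ubnP #|S|; elim: n S => // n IHn S nS.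
have [->|[v vS]] := set_0Vmem S; first by rewrite mgen0 monic1 size_poly1 cards0.
have cS : #|S| = #|S :\ v|.+1 by rewrite (cardsD1 v S) vS.
have [|mv sv] := IHn (S :\ v)%SET; first by rewrite -ltnS -cS.
have sXv : size ('X * mgen 'X t%:P (S :\ v)) = #|S|.+1.
  by rewrite mulrC size_mulX ?monic_neq0// sv cS.
have ss : (size (t%:P * \sum_(u in S | adj v u) mgen 'X t%:P (S :\ v :\ u))%R <
    size ('X * mgen 'X t%:P (S :\ v))%R)%N.
  rewrite sXv ltnS mul_polyC (leq_trans (size_scale_leq _ _))//.
  apply: (leq_trans (size_sum _ _ _)); apply/bigmax_leqP => u /andP[uS vu].
  have uSv : u \in (S :\ v)%SET.
    by rewrite !inE uS andbT; apply: contraTneq vu => ->; rewrite adj_irr.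
  have [|_ ->] := IHn (S :\ v :\ u)%SET; last by rewrite cS (cardsD1 u (S :\ v)%SET) uSv.
  by rewrite -ltnS (leq_trans _ nS)// cS ltnS (cardsD1 u (S :\ v)%SET) uSv ltnW.
rewrite (mgen_rec _ _ vS) size_polyDl//; split=> //.
by rewrite monicE lead_coefDl// lead_coefM lead_coefX mul1r -monicE.
Qed.

Lemma roots_mult_prod (R : realType) (s : seq R) :
  perm_eq (roots_mult (\prod_(r <- s) ('X - r%:P))) s.
Proof.
set p := \prod_(_ <- _) _.
have p0 : p != 0 by rewrite monic_neq0// monic_prod_XsubC.
apply/allP => x _ /=; apply/eqP; rewrite /roots_mult count_flatten -map_comp.
rewrite -(mu_prod_XsubC x s) -/p.
have rE : uniq (rootsR p) /\ forall y, root p y = (y \in rootsR p).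
  split; first by have := sorted_roots (- cauchy_bound p) (cauchy_bound p) p; exact: lt_sorted_uniq.
  by move=> y; have := roots_on_rootsR p0 y; rewrite in_itv.
case: rE => ur rr.
rewrite (eq_map (g := fun y => ((y == x) * mup y p)%N)); last first.
  by move=> y /=; rewrite count_nseq.
rewrite sumnE big_map; have [xr|xr] := boolP (root p x).
  rewrite (bigD1_seq x)/= -?rr// eqxx mul1n big1 ?addn0// => y /negPf ->.
  by rewrite mul0n.
rewrite mupNroot// big_seq big1// => y; case: eqP => [->|]; last by rewrite mul0n.
by rewrite -rr (negPf xr).
Qed.

(** Heilmann--Lieb *)
Lemma matching_poly_splits (R : realType) (G : sgraph) :
  matching_poly G = \prod_(r <- roots_mult (matching_poly G)) ('X - r%:P) :> {poly R}.
Proof.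
suff [s ps] : exists s : seq R, matching_poly G = \prod_(r <- s) ('X - r%:P).
  by rewrite ps; apply: perm_big; rewrite perm_sym roots_mult_prod.
set p : {poly R} := matching_poly G.
have pE : p = mgen 'X (-1)%:P [set: G]%SET by rewrite /p matching_polyE rmorphN1.
have [mp _] := size_mgenX [set: G]%SET (-1 : R).
pose f := real_complex R : {rmorphism R -> complex R}.
have [s sE] := closed_field_poly_normal (map_poly f p).
have ps : map_poly f p = \prod_(z <- s) ('X - z%:P).
  by rewrite sE lead_coef_map pE (monicP mp) rmorph1 scale1r.
(* The complex roots are real, so taking real parts loses nothing. *)
exists [seq complex.Re z | z <- s]; apply: (map_poly_inj f).
rewrite ps big_map rmorph_prod /= big_seq [RHS]big_seq; apply: eq_bigr => z zs.
rewrite rmorphB /= map_polyX map_polyC /=; congr ('X - _%:P).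
rewrite RRe_real//; apply: (@mgen_root_real _ G z [set: G]%SET).
have : root (map_poly f p) z by rewrite ps root_prod_XsubC.
rewrite /root => /eqP; rewrite pE mgen_rmorph /= map_polyX map_polyC /=.
by rewrite -/(horner_eval z _) mgen_rmorph /= /horner_eval hornerX hornerC rmorphN1.
Qed.

Lemma size_roots_matching (R : realType) (G : sgraph) :
  size (roots_mult (matching_poly G : {poly R})) = nvert G.
Proof.
apply: succn_inj; rewrite -(size_prod_XsubC _ id) -matching_poly_splits.
have [_] := size_mgenX [set: G]%SET (-1 : R).
by rewrite matching_polyE rmorphN1 cardsT.
Qed.

Lemma horner_matching_poly (R : realType) (G : sgraph) (x : R) :
  (matching_poly G).[x] = mgen x (-1) [set: G]%SET.
Proof.
by rewrite matching_polyE -/(horner_eval x _) mgen_rmorph /= /horner_eval hornerX hornerN hornerC.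
Qed.

(** [y ^+ 2 + r ^+ 2] factors as [(i y - r) (- i y - r)], so the product is the matching polynomial
    at [i y] times its value at [- i y]; scaling by [i] turns both into the generating function with
    positive signs. *)
Lemma prod_sqr_roots_matching (R : realType) (G : sgraph) (y : R) :
  \prod_(r <- roots_mult (matching_poly G)) (y ^+ 2 + r ^+ 2) =
  mgen y 1 [set: G]%SET ^+ 2.
Proof.
pose f := real_complex R : {rmorphism R -> complex R}.
apply: (fmorph_inj f); rewrite rmorph_prod rmorphXn mgen_rmorph rmorph1 /=.
have evalE z : mgen z (-1) [set: G]%SET = \prod_(r <- roots_mult (matching_poly G)) (z - f r).
  have := congr1 (fun p => horner (map_poly f p) z) (matching_poly_splits R G).
  rewrite /= rmorph_prod horner_prod matching_polyE mgen_rmorph /= map_polyX rmorphN1.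
  rewrite -/(horner_eval z _) mgen_rmorph /= /horner_eval hornerX hornerN hornerC => ->.
  by apply: eq_bigr => r _; rewrite rmorphB /= map_polyX map_polyC /= !hornerE.
pose i : complex R := 'i; have i2 : i ^+ 2 = -1 by rewrite /i sqrCi.
have iE : mgen (i * f y) (-1) [set: G]%SET = i ^+ nvert G * mgen (f y) 1 [set: G]%SET.
  by rewrite -[nvert G]cardsT -mgen_scale mulr1 i2.
have sq : mgen (f y) 1 [set: G]%SET ^+ 2 =
    mgen (i * f y) (-1) [set: G]%SET * mgen (- (i * f y)) (-1) [set: G]%SET.
  rewrite mgenN mulrCA -expr2 iE exprMn -exprM mulnC exprM i2 cardsT mulrA -exprMn.
  by rewrite mulrNN mulr1 expr1n mul1r.
rewrite sq !evalE -big_split /=; apply: eq_bigr => r _.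
rewrite rmorphD !rmorphXn /=.
have -> : (i * f y - f r) * (- (i * f y) - f r) = f r ^+ 2 - i ^+ 2 * f y ^+ 2 by ring.
by rewrite i2 mulN1r opprK addrC.
Qed.

Lemma card_nbr_le_degree (G : sgraph) (S : {set G}) (v : G) :
  (#|[pred u in S | adj v u]| <= degree v)%N.
Proof. by apply: subset_leq_card; apply/fintype.subsetP => u; rewrite !inE => /andP[]. Qed.

(** The ratio of the values at [S] and [S - v] stays at least [sqrt d]: it is [x] minus at most [d]
    inverses of such ratios, hence at least [2 sqrt d - d / sqrt d]. *)
Lemma mgen_gt0_large (R : realType) (G : sgraph) (d x : R) (S : {set G}) :
  admissible G d -> 2 * Num.sqrt d <= x ->
  0 < mgen x (-1) S /\
  forall v, v \in S -> Num.sqrt d * mgen x (-1) (S :\ v) <= mgen x (-1) S.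
Proof.
move=> [_ d1 dG] dx; have d0 : 0 < d by rewrite (lt_le_trans ltr01).
have [n] := ubnP #|S|; elim: n S => // n IHn S nS.
have ratio v : v \in S -> 0 < mgen x (-1) (S :\ v) /\
    Num.sqrt d * mgen x (-1) (S :\ v) <= mgen x (-1) S.
  move=> vS; have [|m0 IHv] := IHn (S :\ v)%SET.
    by rewrite -ltnS (leq_trans _ nS)// (cardsD1 v S) vS.
  split=> //; rewrite (mgen_rec _ _ vS) mulN1r lerBrDr.
  suff : \sum_(u in S | adj v u) mgen x (-1) (S :\ v :\ u)
      <= Num.sqrt d * mgen x (-1) (S :\ v).
    move=> /(lerD (lexx _)) /le_trans; apply.
    by rewrite -mulrDl ler_pM2r// -mulr2n -mulr_natl.
  apply: (@le_trans _ _ (\sum_(u in S | adj v u)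
      ((Num.sqrt d)^-1 * mgen x (-1) (S :\ v)))).
    apply: ler_sum => u /andP[uS vu]; rewrite mulrC ler_pdivlMr ?sqrtr_gt0// mulrC.
    by apply: IHv; rewrite !inE uS andbT; apply: contraTneq vu => ->; rewrite adj_irr.
  rewrite sumr_const -mulr_natl mulrA ler_pM2r// ler_pdivrMr ?sqrtr_gt0//.
  rewrite -expr2 sqr_sqrtr ?(ltW d0)// (le_trans _ (dG v))// ler_nat.
  exact: card_nbr_le_degree.
split; last by move=> v /ratio[].
have [->|[v vS]] := set_0Vmem S; first by rewrite mgen0 ltr01.
have [m0] := ratio _ vS; apply: lt_le_trans.
by rewrite mulr_gt0 ?sqrtr_gt0.
Qed.

Lemma roots_matching_bound (R : realType) (G : sgraph) (d r : R) :
  admissible G d -> r \in roots_mult (matching_poly G) -> `|r| <= 2 * Num.sqrt d.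
Proof.
move=> adm rG; have r0 : mgen r (-1) [set: G]%SET = 0.
  rewrite -horner_matching_poly matching_poly_splits; apply/rootP.
  by rewrite root_prod_XsubC.
have no x : 2 * Num.sqrt d <= x -> mgen x (-1) [set: G]%SET != 0.
  by move=> /(mgen_gt0_large [set: G]%SET adm)[/lt0r_neq0].
rewrite ler_norml lerNl -[r <= _]/(r <= _).
by apply/andP; split; rewrite leNgt; apply/negP => /ltW /no; rewrite ?mgenN r0 ?mulr0 eqxx.
Qed.

(** * Tree-like walks and power sums of the roots *)

Lemma mem_setD1_adj (G : sgraph) (S : {set G}) (u v : G) :
  u \in S -> adj v u -> u \in (S :\ v)%SET.
Proof. by move=> uS vu; rewrite !inE uS andbT; apply: contraTneq vu => ->; rewrite adj_irr. Qed.

(** The coefficient of [z ^+ j], [j < J], in [tree_walks z J S v] is the number of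
    tree-like closed walks of length [2j] in [S] that start at [v]; [plane_walks] drops the
    condition that the vertices on the path from [v] be distinct. *)
Fixpoint tree_walks (A : comNzRingType) (G : sgraph) (z : A) (J : nat)
    (S : {set G}) (v : G) : A :=
  if J is J'.+1 then
    1 + z * (\sum_(u in S | adj v u) tree_walks z J' (S :\ v) u) * tree_walks z J' S v
  else 0.

Fixpoint plane_walks (A : comNzRingType) (G : sgraph) (z : A) (J : nat) (v : G) : A :=
  if J is J'.+1 then
    1 + z * (\sum_(u | adj v u) plane_walks z J' u) * plane_walks z J' v
  else 0.

Section rmorph.
Variables (A B : comNzRingType) (f : {rmorphism A -> B}) (G : sgraph) (z : A) (J : nat).

Lemma tree_walks_rmorph (S : {set G}) (v : G) :
  f (tree_walks z J S v) = tree_walks (f z) J S v.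
Proof.
elim: J S v => [|k IH] S v /=; first by rewrite rmorph0.
rewrite rmorphD rmorph1 !rmorphM rmorph_sum /= IH; congr (1 + _ * _ * _).
by apply: eq_bigr => u _; exact: IH.
Qed.

End rmorph.

(** As a power series in [z], [tree_walks] is the quotient of the matching generating
    functions of [S - v] and [S]; both satisfy the same continued fraction recursion. *)
Lemma tree_walks_mod (A : comNzRingType) (G : sgraph) (z : A) (J : nat)
    (S : {set G}) (v : G) : v \in S ->
  exists c, mgen 1 (- z) (S :\ v) - mgen 1 (- z) S * tree_walks z J S v = z ^+ J * c.
Proof.
elim: J S v => [|J IH] S v vS.
  by exists (mgen 1 (- z) (S :\ v)); rewrite /= mulr0 subr0 mul1r.
have [c cE] := IH _ _ vS.
have [e eE] : exists e, \sum_(u in S | adj v u) (mgen 1 (- z) (S :\ v :\ u) -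
    mgen 1 (- z) (S :\ v) * tree_walks z J (S :\ v) u) = z ^+ J * e.
  apply: (big_ind (fun s => exists e, s = z ^+ J * e)).
  - by exists 0; rewrite mulr0.
  - by move=> _ _ [a ->] [b ->]; exists (a + b); rewrite mulrDr.
  - by move=> u /andP[uS vu]; apply: IH; exact: mem_setD1_adj.
exists (e + (\sum_(u in S | adj v u) tree_walks z J (S :\ v) u) * c).
rewrite exprS.
have -> : z * z ^+ J * (e + (\sum_(u in S | adj v u) tree_walks z J (S :\ v) u) * c) =
   z * (z ^+ J * e) + z * (\sum_(u in S | adj v u) tree_walks z J (S :\ v) u) * (z ^+ J * c).
  by ring.
rewrite -eE -cE sumrB -mulr_sumr /= (mgen_rec _ _ vS) mul1r.
move: (\sum_(_ in _ | _) tree_walks _ _ _ _) (\sum_(_ in _ | _) mgen _ _ _) => a b.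
by ring.
Qed.

(** Logarithmic derivative: for [Q] the product of the [1 - r X], the quotient [(n Q - X Q') / Q] is
    the sum of the series [1 / (1 - r X)]. Cutting these at order [K] leaves a multiple of
    ['X^K]. *)
Lemma geometric_mod (A : comNzRingType) (s : seq A) (K : nat) :
  exists c : {poly A},
    (size s)%:R * \prod_(r <- s) (1 - r *: 'X) - 'X * (\prod_(r <- s) (1 - r *: 'X))^`()
    - \prod_(r <- s) (1 - r *: 'X) * \sum_(r <- s) \sum_(k < K) (r *: 'X) ^+ k = 'X^K * c.
Proof.
elim: s => [|r s [c cE]].
  by exists 0; rewrite !big_nil mul0r derivC !mulr0 !subr0.
rewrite !big_cons derivM derivB derivZ derivX derivC sub0r.
move: cE; move: (\prod_(_ <- _) _) (\sum_(_ <- _) _) => P S cE.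
pose g : {poly A} := \sum_(k < K) (r *: 'X) ^+ k.
have gE : (1 - r *: 'X) * g = 1 - (r ^+ K)%:P * 'X^K.
  by rewrite -opprB mulNr -subrX1 opprB exprZn mul_polyC.
exists ((1 - r *: 'X) * c + P * (r ^+ K)%:P).
have -> : 'X^K * ((1 - r *: 'X) * c + P * (r ^+ K)%:P) =
    (1 - r *: 'X) * ('X^K * c) + P * ((r ^+ K)%:P * 'X^K) by ring.
rewrite -cE [LHS](_ : _ = (1 - r *: 'X) * ((size s)%:R * P - 'X * P^`() - P * S)
   + P * (1 - (1 - r *: 'X) * g)); last first.
  rewrite /= -/g -addn1 natrD -[r *: 1]mul_polyC -[r *: 'X]mul_polyC; set q := r%:P.
  by ring.
by rewrite gE; ring.
Qed.

(** At [y != 0] both sides are [y ^ n] times the matching polynomial at [1 / y], and two polynomials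
    that agree at all nonzero points are equal. *)
Lemma rev_matching_poly (R : realType) (G : sgraph) :
  mgen 1 (- 'X^2) [set: G]%SET =
  \prod_(r <- roots_mult (matching_poly G)) (1 - r *: 'X) :> {poly R}.
Proof.
set P := mgen _ _ _; set Q := \prod_(_ <- _) _.
have ev y : y != 0 -> P.[y] = Q.[y].
  move=> y0; rewrite /P -/(horner_eval y _) mgen_rmorph rmorph1 rmorphN /= /horner_eval hornerXn.
  have -> : mgen 1 (- y ^+ 2) [set: G]%SET = mgen (y * y^-1) (y ^+ 2 * -1) [set: G]%SET.
    by rewrite divff// mulrN1.
  rewrite mgen_scale -horner_matching_poly matching_poly_splits cardsT -/(nvert G).
  rewrite -(size_roots_matching R G) /Q; move: (roots_mult _) => s.
  rewrite !horner_prod; elim: s => [|r s IHs]; first by rewrite !big_nil mulr1.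
  by rewrite !big_cons exprS mulrACA IHs !hornerE mulrBr divff// (mulrC r).
apply/eqP; rewrite -subr_eq0; apply/eqP.
(* As many distinct nonzero points as the size of [P - Q], hence more than its degree. *)
pose rs : seq R := [seq i.+1%:R | i <- iota 0 (size (P - Q))].
apply: (@roots_geq_poly_eq0 _ _ rs).
- by apply/allP => _ /mapP[i _ ->]; rewrite /root hornerD hornerN ev ?pnatr_eq0// subrr.
- by rewrite map_inj_uniq ?iota_uniq// => i j /eqP; rewrite eqr_nat eqSS => /eqP.
- by rewrite size_map size_iota.
Qed.

(** A matching with [k] edges contributes a monomial of degree [2k], on which [n - X d/dX] acts as
    multiplication by [n - 2k], the number of vertices it misses. *)
Lemma sum_mgen_deriv (R : realType) (G : sgraph) :
  \sum_(v in [set: G]%SET) mgen 1 (- 'X^2) ([set: G] :\ v)%SET =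
  (nvert G)%:R * mgen 1 (- 'X^2) [set: G]%SET - 'X * (mgen 1 (- 'X^2) [set: G]%SET)^`()
  :> {poly R}.
Proof.
rewrite mgen1_sum /mgen raddf_sum /= !mulr_sumr -sumrB; apply: eq_bigr => M /andP[mM cM].
rewrite cardsT -/(nvert G) expr1n mulr1 mulrnBr; last first.
  by rewrite -(card_cover_matching mM) max_card.
rewrite mulr_natl; congr (_ - _); rewrite exprNn -exprM mul2n derivM derivXn.
have -> : ((-1) ^+ #|M| : {poly R})^`() = 0.
  by rewrite -polyC1 -polyCN -rmorphXn derivC.
rewrite mul0r add0r mulrCA mulrnAr.
case: #|M| => [|k]; first by rewrite !mulr0n mulr0.
by rewrite -['X * 'X^_]exprS prednK// mulrnAr.
Qed.

(** Newton's identities: [nQ - XQ'], for [Q] the reverse of the matching polynomial, is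
    computed both from the roots of [Q] and from the matching polynomials of the [G - v]. *)
Lemma power_sum_roots_mod (R : realType) (G : sgraph) (J : nat) :
  'X^(J.*2) %| (\sum_(r <- roots_mult (matching_poly G)) \sum_(k < J.*2) (r *: 'X) ^+ k
    - \sum_(v in [set: G]%SET) tree_walks 'X^2 J [set: G]%SET v : {poly R}).
Proof.
have [c] := geometric_mod (roots_mult (matching_poly G : {poly R})) J.*2.
rewrite -rev_matching_poly size_roots_matching -sum_mgen_deriv => cE.
have [e eE] : exists e : {poly R}, \sum_(v in [set: G]%SET) (mgen 1 (- 'X^2) ([set: G] :\ v)%SET -
    mgen 1 (- 'X^2) [set: G]%SET * tree_walks 'X^2 J [set: G]%SET v) = 'X^(J.*2) * e.
  apply: (big_ind (fun s => exists e, s = 'X^(J.*2) * e)).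
  - by exists 0; rewrite mulr0.
  - by move=> _ _ [a ->] [b ->]; exists (a + b); rewrite mulrDr.
  - by move=> v vG; have [a ->] := @tree_walks_mod {poly R} G 'X^2 J _ v vG; exists a; rewrite -exprM mul2n.
move: eE; rewrite sumrB -mulr_sumr => eE.
(* The generating function has constant term 1, from the empty matching, so it is coprime to ['X]
   and can be cancelled. *)
rewrite -(@Gauss_dvdpr _ _ (mgen 1 (- 'X^2) [set: G]%SET)); last first.
  rewrite coprimep_expl// coprimep_sym coprimepX /root -/(horner_eval 0 _) mgen_rmorph.
  rewrite rmorph1 rmorphN /= /horner_eval hornerXn expr0n oppr0 /mgen.
  rewrite (bigD1 finset.set0)/= ?is_matching0 ?/finset.cover ?big_set0 ?finset.sub0set//.
  rewrite cards0 expr0 expr1n mulr1 big1 ?addr0 ?oner_eq0// => M /andP[_ M0].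
  by rewrite expr0n cards_eq0 (negPf M0) mul0r.
apply/dvdpP; exists (e - c); transitivity ('X^(J.*2) * e - 'X^(J.*2) * c); last by ring.
by rewrite -cE -eE; ring.
Qed.

Lemma coef_power_sum (R : realType) (s : seq R) (k K : nat) : (k < K)%N ->
  (\sum_(r <- s) \sum_(i < K) (r *: 'X) ^+ i)`_k = \sum_(r <- s) r ^+ k.
Proof.
move=> kK; rewrite coef_sum; apply: eq_bigr => r _; rewrite coef_sum.
rewrite (bigD1 (Ordinal kK))//= exprZn coefZ coefXn eqxx mulr1 big1 ?addr0// => i.
by rewrite -val_eqE eq_sym => /negPf /= ik; rewrite exprZn coefZ coefXn ik mulr0.
Qed.

(** The walk polynomial is a polynomial in ['X^2], which kills the odd power sums; [k < J.*2] places
    the coefficient below the order of the error. *)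
Lemma power_sum_roots (R : realType) (G : sgraph) (k J : nat) : (k < J.*2)%N ->
  \sum_(r <- roots_mult (matching_poly G)) r ^+ k =
    (if odd k then 0 else (\sum_(v : G) tree_walks 'X J [set: G]%SET v)`_k./2) :> R.
Proof.
move=> kJ; have /dvdpP[c] := power_sum_roots_mod R G J.
move=> /(congr1 (fun p : {poly R} => p`_k)); rewrite coefMXn kJ coefB coef_power_sum//.
move/eqP; rewrite subr_eq0 => /eqP ->.
have -> : \sum_(v in [set: G]%SET) tree_walks 'X^2 J [set: G]%SET v =
    (\sum_(v : G) tree_walks 'X J [set: G]%SET v) \Po 'X^2 :> {poly R}.
  rewrite raddf_sum /=; apply: eq_big => [v|v _]; first by rewrite inE.
  rewrite -[_ \Po _]/((comp_poly 'X^2 : {rmorphism {poly R} -> {poly R}}) _).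
  by rewrite tree_walks_rmorph /= comp_polyX.
rewrite coef_comp_poly_Xn// dvdn2; case: (odd k) => //=.
by rewrite divn2.
Qed.

(** * Comparison of tree-like walks with plane walks *)

Section WalkEstimates.
Variables (R : realType) (G : sgraph) (d : R).
Hypothesis adm : admissible G d.
Implicit Types (S : {set G}) (v : G).

Local Notation nneg_poly := (polyOver (@Num.Def.nneg_num_pred R)).
Local Notation tw := (@tree_walks {poly R} G 'X).
Local Notation pw := (@plane_walks {poly R} G 'X).

Lemma tree_walks_nneg J S v : tw J S v \is a nneg_poly.
Proof.
elim: J S v => [|J IH] S v /=; first exact: rpred0.
by rewrite rpredD ?rpred1// !rpredM ?polyOverX ?rpred_sum.
Qed.

Lemma sum_adj_split (V : zmodType) J S v (f : nat -> G -> V) (g : nat -> {set G} -> G -> V) :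
  \sum_(u | adj v u) f J u - \sum_(u in S | adj v u) g J (S :\ v)%SET u =
  \sum_(u | adj v u && (u \notin S)) f J u +
  \sum_(u in S | adj v u) (f J u - g J (S :\ v)%SET u).
Proof.
rewrite (bigID (mem S)) /= sumrB (eq_bigl (fun u => (u \in S) && adj v u)); last first.
  by move=> u; rewrite andbC.
by rewrite addrAC addrC.
Qed.

(** Every term on the right has a difference of the previous depth as a factor, except the walks
    whose first step leaves [S]. All signs are positive, which gives both the nonnegativity and the
    bound of the gap. *)
Lemma walks_sub_succ J S v :
  pw J.+1 v - tw J.+1 S v =
  'X * ((\sum_(u | adj v u && (u \notin S)) pw J u +
  \sum_(u in S | adj v u) (pw J u - tw J (S :\ v)%SET u)) * pw J v +
  (\sum_(u in S | adj v u) tw J (S :\ v)%SET u) * (pw J v - tw J S v)).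
Proof.
rewrite -(sum_adj_split J S v (fun J => pw J) (fun J => tw J)) /=.
by ring.
Qed.

Lemma walks_sub_nneg J S v : pw J v - tw J S v \is a nneg_poly.
Proof.
elim: J S v => [|J IH] S v; first by rewrite /= subr0 rpred0.
have pn u : pw J u \is a nneg_poly.
  by rewrite -(subrK (tw J S u) (pw J u)) rpredD// tree_walks_nneg.
rewrite walks_sub_succ; apply: rpredM; first exact: polyOverX.
apply: rpredD; apply: rpredM => //; last exact: rpred_sum (fun u _ => tree_walks_nneg _ _ _).
by apply: rpredD; apply: rpred_sum => u _.
Qed.

Lemma plane_walks_nneg J v : pw J v \is a nneg_poly.
Proof.
by rewrite -(subrK (tw J finset.set0 v) (pw J v)) rpredD ?walks_sub_nneg ?tree_walks_nneg.
Qed.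

Lemma horner_nneg_ge0 (p : {poly R}) (y : R) :
  p \is a nneg_poly -> 0 <= y -> 0 <= p.[y].
Proof.
move=> /polyOverP pn y0; rewrite horner_coef sumr_ge0// => i _.
by rewrite mulr_ge0 ?exprn_ge0//; exact: pn.
Qed.

(** Used at [y = d^-1]: a step has at most [d] choices and carries one factor [z], so values there
    are bounded independently of the graph, and they control all coefficients at once. *)
Lemma coef_le_horner (p : {poly R}) (y : R) j :
  p \is a nneg_poly -> 0 <= y -> p`_j * y ^+ j <= p.[y].
Proof.
move=> /polyOverP pn y0; have [jp|jp] := ltnP j (size p); last first.
  by rewrite nth_default// mul0r horner_nneg_ge0//; exact/polyOverP.
rewrite horner_coef (bigD1 (Ordinal jp))//= lerDl sumr_ge0// => i _.
by rewrite mulr_ge0 ?exprn_ge0//; exact: pn.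
Qed.

Let d0 : 0 < d. Proof. by case: adm => _ d1 _; exact: lt_le_trans d1. Qed.
Let dV0 : 0 <= d^-1. Proof. by rewrite invr_ge0 ltW. Qed.

Fixpoint pw_bound (J : nat) : R := if J is J'.+1 then 1 + pw_bound J' ^+ 2 else 0.

(** With [k] vertices outside [S], the error terms at the next depth add up to
    [k b ^ 2 + (k + 2) g b + (k + 1) g b], where [b] is [pw_bound] and [g] is [walks_gap]. The 3 is
    chosen so that [2k + 3 <= 3 (k + 1)]. *)
Fixpoint walks_gap (J : nat) : R :=
  if J is J'.+1 then pw_bound J' ^+ 2 + 3 * walks_gap J' * pw_bound J' else 0.

Lemma pw_bound_ge0 J : 0 <= pw_bound J.
Proof. by case: J => //= J; rewrite addr_ge0 ?sqr_ge0. Qed.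

Lemma walks_gap_ge0 J : 0 <= walks_gap J.
Proof. by elim: J => //= J IH; rewrite addr_ge0 ?sqr_ge0// !mulr_ge0 ?pw_bound_ge0. Qed.

Lemma sum_nbr_le (P : pred G) v (f : G -> R) (c : R) : 0 <= c ->
  (forall u, f u <= c) -> \sum_(u | P u && adj v u) f u <= d * c.
Proof.
move=> c0 fc; apply: (@le_trans _ _ (\sum_(u | P u && adj v u) c)); first exact: ler_sum.
rewrite sumr_const -mulr_natl ler_wpM2r//; case: adm => _ _ /(_ v); apply: le_trans.
by rewrite ler_nat; apply: subset_leq_card; apply/fintype.subsetP => u; rewrite !inE => /andP[].
Qed.

Lemma plane_walks_le J v : (pw J v).[d^-1] <= pw_bound J.
Proof.
elim: J v => [|J IH] v /=; first by rewrite horner0.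
rewrite !hornerE horner_sum lerD2l expr2.
rewrite ler_pM// ?horner_nneg_ge0 ?plane_walks_nneg//.
  by rewrite mulr_ge0// sumr_ge0// => u _; rewrite horner_nneg_ge0 ?plane_walks_nneg.
rewrite mulrC ler_pdivrMr// mulrC.
by rewrite (@sum_nbr_le xpredT) ?pw_bound_ge0.
Qed.

(** Forbidding a vertex costs at most one of the possible neighbours, which has relative weight
    [1 / d]; the number of forbidden vertices grows by at most one per level. *)
Lemma walks_gap_le J S v :
  (pw J v - tw J S v).[d^-1] <= (#|~: S|.+1)%:R / d * walks_gap J.
Proof.
elim: J S v => [|J IH] S v; first by rewrite /= subr0 horner0 mulr0.
have pn u : 0 <= (pw J u).[d^-1] by rewrite horner_nneg_ge0 ?plane_walks_nneg.
have tn T u : 0 <= (tw J T u).[d^-1] by rewrite horner_nneg_ge0 ?tree_walks_nneg.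
have dn T u : 0 <= (pw J u - tw J T u).[d^-1] by rewrite horner_nneg_ge0 ?walks_sub_nneg.
set k : R := #|~: S|%:R; have k0 : 0 <= k by rewrite ler0n.
have b0 := pw_bound_ge0 J; have g0 := walks_gap_ge0 J.
have A1 : \sum_(u | adj v u && (u \notin S)) (pw J u).[d^-1] <= k * pw_bound J.
  apply: (@le_trans _ _ (\sum_(u | adj v u && (u \notin S)) pw_bound J)).
    by apply: ler_sum => u _; exact: plane_walks_le.
  rewrite sumr_const -mulr_natl ler_wpM2r// ler_nat.
  by apply: subset_leq_card; apply/fintype.subsetP => u; rewrite !inE => /andP[].
have A2 : \sum_(u in S | adj v u) (pw J u - tw J (S :\ v) u).[d^-1] <= (k + 2) * walks_gap J.
  have -> : (k + 2) * walks_gap J = d * ((k + 2) / d * walks_gap J).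
    by rewrite mulrA mulrCA divff ?mulr1 ?gt_eqF.
  apply: sum_nbr_le => [|u]; first by rewrite !mulr_ge0// addr_ge0.
  apply: (le_trans (IH _ _)); rewrite ler_wpM2r// ler_wpM2r//.
  (* Removing [v] raises the factor [k + 1] of the induction hypothesis to at most [k + 2]. *)
  have -> : (~: (S :\ v) = v |: ~: S)%SET.
    by apply/setP => w; rewrite !inE negb_and negbK.
  rewrite cardsU1 -natr1 natrD /k; have := ler0n R #|~: S|%SET.
  by case: (_ \notin _) => /=; lra.
have A3 : \sum_(u in S | adj v u) (tw J (S :\ v) u).[d^-1] <= d * pw_bound J.
  apply: sum_nbr_le => // u; apply: le_trans (plane_walks_le J u).
  by rewrite -subr_ge0 -hornerN -hornerD.
rewrite walks_sub_succ hornerM hornerX hornerD !hornerM hornerD !horner_sum -natr1 -/k.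
have {}A3 : (\sum_(u in S | adj v u) (tw J (S :\ v) u).[d^-1]) * (pw J v - tw J S v).[d^-1]
    <= (k + 1) * (walks_gap J * pw_bound J).
  apply: (@le_trans _ _ (d * pw_bound J * ((k + 1) / d * walks_gap J))).
    rewrite ler_pM ?sumr_ge0//; apply: (le_trans (IH _ _)); rewrite natr1 -/k//.
  by rewrite le_eqVlt; apply/orP; left; apply/eqP; field; rewrite gt_eqF.
rewrite [X in _ <= X]mulrAC -[X in _ <= X]mulrC ler_wpM2l//.
have := ler_pM _ _ (lerD A1 A2) (plane_walks_le J v).
rewrite addr_ge0 ?sumr_ge0// (pn v) => /(_ isT isT) A12.
apply: (le_trans (lerD A12 A3)).
have : 0 <= k * (walks_gap J * pw_bound J) by rewrite !mulr_ge0.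
have := sqr_ge0 (pw_bound J).
by rewrite /=; lra.
Qed.

Lemma coef_walks_gap J j :
  `|(\sum_(v : G) tw J [set: G]%SET v)`_j - (\sum_(v : G) pw J v)`_j|
    / ((nvert G)%:R * d ^+ j) <= walks_gap J / d.
Proof.
have n0 : 0 < (nvert G)%:R :> R by rewrite ltr0n; case: adm.
have c0 v : 0 <= (pw J v - tw J [set: G]%SET v)`_j.
  by have /polyOverP := walks_sub_nneg J [set: G]%SET v; exact.
rewrite distrC -coefB -sumrB coef_sum ger0_norm ?sumr_ge0//.
rewrite ler_pdivrMr ?mulr_gt0 ?exprn_gt0//.
apply: (@le_trans _ _ (\sum_(v : G) (walks_gap J / d * d ^+ j))).
  apply: ler_sum => v _; rewrite -ler_pdivrMr ?exprn_gt0// -exprVn.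
  apply: (le_trans (coef_le_horner _ (walks_sub_nneg _ _ _) dV0)).
  by apply: (le_trans (walks_gap_le _ _ _)); rewrite finset.setCT cards0 div1r mulrC.
by rewrite sumr_const -[leLHS]mulr_natl mulrCA -/(nvert G).
Qed.

End WalkEstimates.

(** * Walks as homomorphisms from trees *)

Section Join.
Variables (F1 F2 : sgraph) (r1 : F1) (r2 : F2).

Definition graph_join_adj (x y : F1 + F2) : bool :=
  match x, y with
  | inl a, inl b => adj a b
  | inr a, inr b => adj a b
  | inl a, inr b => (a == r1) && (b == r2)
  | inr a, inl b => (b == r1) && (a == r2)
  end.

Lemma graph_join_adj_sym : symmetric graph_join_adj.
Proof. by move=> [a|a] [b|b] //=; exact: adj_sym. Qed.

Lemma graph_join_adj_irr : irreflexive graph_join_adj.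
Proof. by move=> [a|a] /=; exact: adj_irr. Qed.

Definition graph_join : sgraph := SGraph graph_join_adj_sym graph_join_adj_irr.

End Join.

Definition one_vertex : sgraph :=
  @SGraph unit (fun _ _ => false) (fun _ _ => erefl) (fun _ => erefl).

Definition is_hom (F G : sgraph) (f : {ffun F -> G}) : bool :=
  [forall x, forall y, adj x y ==> adj (f x) (f y)].

Definition hom_at (F G : sgraph) (r : F) (v : G) : nat :=
  #|[set f : {ffun F -> G} | is_hom f & f r == v]|.

Lemma hom_sum_at (F G : sgraph) (r : F) : Defs.hom F G = (\sum_(v : G) hom_at r v)%N.
Proof.
rewrite /Defs.hom -sum1_card (partition_big (fun f : {ffun F -> G} => f r) xpredT)//=.
apply: eq_bigr => v _; rewrite /hom_at -sum1_card; apply: eq_bigl => f.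
by rewrite !inE.
Qed.

Lemma is_homP (F G : sgraph) (f : {ffun F -> G}) :
  reflect (forall x y, adj x y -> adj (f x) (f y)) (is_hom f).
Proof.
apply: (iffP forallP) => [h x y|h x]; first by move/forallP: (h x) => /(_ y) /implyP.
by apply/forallP => y; apply/implyP; exact: h.
Qed.

Lemma hom_at_point (G : sgraph) (v : G) : hom_at (tt : one_vertex) v = 1%N.
Proof.
rewrite /hom_at -(cards1 ([ffun=> v] : {ffun one_vertex -> G})); congr #|pred_of_set _|.
apply/setP => f; rewrite !inE; apply/andP/eqP => [[_ /eqP fv]|->].
  by apply/ffunP => -[]; rewrite ffunE.
by rewrite ffunE; split=> //; apply/is_homP.
Qed.

(** A homomorphism from the join is a pair of homomorphisms whose root images are adjacent. This is
    the product in the recursion of [plane_walks]. *)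
Lemma hom_at_join (F1 F2 G : sgraph) (r1 : F1) (r2 : F2) (v : G) :
  hom_at (inr r2 : graph_join r1 r2) v = ((\sum_(u | adj v u) hom_at r1 u) * hom_at r2 v)%N.
Proof.
pose T := ({ffun F1 -> G} * {ffun F2 -> G})%type.
pose glue (p : T) : {ffun graph_join r1 r2 -> G} :=
  [ffun x => match x with inl a => p.1 a | inr b => p.2 b end].
pose split (f : {ffun graph_join r1 r2 -> G}) : T :=
  ([ffun a => f (inl a)], [ffun b => f (inr b)]).
have glueK : cancel glue split.
  by move=> [f1 f2]; congr pair; apply/ffunP => a; rewrite !ffunE.
have splitK : cancel split glue.
  by move=> f; apply/ffunP => -[a|b]; rewrite !ffunE.
have glue_hom p : is_hom (glue p) = [&& is_hom p.1, is_hom p.2 & adj (p.2 r2) (p.1 r1)].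
  apply/is_homP/and3P => [h|[/is_homP h1 /is_homP h2 h12]].
    split.
    - by apply/is_homP => x y xy; have := h (inl x) (inl y) xy; rewrite !ffunE.
    - by apply/is_homP => x y xy; have := h (inr x) (inr y) xy; rewrite !ffunE.
    - have := h (inr r2) (inl r1); rewrite !ffunE /=; apply.
      by rewrite !eqxx.
  move=> [a|a] [b|b]; rewrite !ffunE /=.
  - exact: h1.
  - by move=> /andP[/eqP -> /eqP ->]; rewrite adj_sym.
  - by move=> /andP[/eqP -> /eqP ->].
  - exact: h2.
rewrite /hom_at -sum1_card (reindex glue) /=; last first.
  by exists split => x _; [exact: glueK|exact: splitK].
rewrite (eq_bigl (fun p : T => [&& is_hom p.1 & adj v (p.1 r1)] && [&& is_hom p.2 & p.2 r2 == v])); last first.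
  move=> [f1 f2]; rewrite inE glue_hom /= ffunE /=; case: eqP => [->|]; last by rewrite !andbF.
  by rewrite !andbT andbA andbAC.
rewrite -(pair_big (fun f1 : {ffun F1 -> G} => is_hom f1 && adj v (f1 r1))
  (fun f2 : {ffun F2 -> G} => is_hom f2 && (f2 r2 == v)) (fun _ _ => 1%N)) /=.
have -> : #|[set f : {ffun F2 -> G} | is_hom f & f r2 == v]| =
    (\sum_(f2 : {ffun F2 -> G} | is_hom f2 && (f2 r2 == v)) 1)%N.
  by rewrite -sum1_card; apply: eq_bigl => f; rewrite inE.
set N := (X in (_ * X)%N).
transitivity (\sum_(f1 : {ffun F1 -> G} | is_hom f1 && adj v (f1 r1)) 1 * N)%N.
  by apply: eq_bigr => f1 _; rewrite mul1n.
rewrite -big_distrl /=; congr (_ * _)%N.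
rewrite (partition_big (fun f1 : {ffun F1 -> G} => f1 r1) (adj v)) /=; last first.
  by move=> f /andP[].
apply: eq_bigr => u vu; rewrite /hom_at -sum1_card; apply: eq_bigl => f.
by rewrite inE; case: eqP => [->|]; rewrite ?andbF// vu !andbT.
Qed.

(** Acyclicity is expressed by a numbering in which a vertex has at most one neighbour of smaller
    number, its parent. This form survives a join by shifting one numbering past the other, which is
    what the bound [nvert F] is for. *)
Record rooted_tree (F : sgraph) (r : F) : Prop := RootedTree {
  rooted_connect : forall x, connect adj r x;
  rooted_rank : exists rk : F -> nat,
    [/\ injective rk, forall x, (rk x < nvert F)%N, rk r = 0%N
      & forall x y z, adj x y -> adj x z -> (rk y < rk x)%N -> (rk z < rk x)%N -> y = z] }.

Lemma connect_adj_sym (F : sgraph) : connect_sym (@adj F).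
Proof. by apply: sym_connect_sym; exact: adj_sym. Qed.

(** A vertex of maximal rank on a cycle has both its cycle neighbours below it. *)
Lemma rooted_is_tree (F : sgraph) (r : F) : rooted_tree r -> is_tree F.
Proof.
move=> [cF [rk [rkI _ _ rkU]]]; split.
- by rewrite /nvert; apply/card_gt0P; exists r.
- by move=> x y; apply: connect_trans (cF y); rewrite connect_adj_sym.
move=> p /andP[cp up]; rewrite leqNgt; apply/negP => sp.
have [x xp xmax] : exists2 x, x \in p & forall y, y \in p -> (rk y <= rk x)%N.
  case: p sp {cp up} => // x0 p _.
  have [x xp xm] := @arg_maxnP _ x0 (mem (x0 :: p)) rk (mem_head _ _).
  by exists x.
have [i q pE] := rot_to xp.
move: cp up sp; rewrite -(rot_cycle i) -(rot_uniq i) -(size_rot i) pE.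
have {xmax} qmax y : y \in q -> (rk y <= rk x)%N.
  by move=> yq; apply: xmax; rewrite -(mem_rot i) pE inE yq orbT.
case: q pE qmax => [|y [|z q]] // _ qmax; rewrite (cycle_path x) /=.
move=> /and3P[xl xy _] /and3P[]; rewrite inE negb_or => /andP[xny xnzq] /= ynq _ _.
have lt w : w \in [:: y, z & q] -> w != x -> (rk w < rk x)%N.
  by move=> wq wx; rewrite ltn_neqAle qmax// andbT (inj_eq rkI).
have lq : last z q \in z :: q by rewrite mem_last.
have /eqP : y = last z q.
  apply: (rkU x) => //; first by rewrite adj_sym.
    by apply: lt; rewrite ?mem_head// eq_sym.
  apply: lt; first by rewrite inE lq orbT.
  by apply: contraNneq xnzq => <-.
by apply/negP; apply: contraNneq ynq => ->.
Qed.

Lemma ncomp_rooted (F : sgraph) (r : F) : rooted_tree r -> ncomp F = 1%N.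
Proof.
move=> [cF _]; rewrite /ncomp -(n_comp_connect (@connect_adj_sym F) r).
by apply: eq_n_comp_r => x; rewrite !inE cF.
Qed.

Lemma rooted_one_vertex : @rooted_tree one_vertex tt.
Proof.
split; first by case; exact: connect0.
by exists (fun=> 0%N); split=> // [[] []|x]//; rewrite /nvert card_unit.
Qed.

Lemma nvert_graph_join (F1 F2 : sgraph) (r1 : F1) (r2 : F2) :
  nvert (graph_join r1 r2) = (nvert F1 + nvert F2)%N.
Proof. by rewrite /nvert card_sum. Qed.

(** The vertices of [F1] are numbered after those of [F2], so [r2] becomes the parent of [r1]; it is
    the only one because [r1] had number 0 in its own tree. *)
Lemma rooted_graph_join (F1 F2 : sgraph) (r1 : F1) (r2 : F2) :
  rooted_tree r1 -> rooted_tree r2 -> @rooted_tree (graph_join r1 r2) (inr r2).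
Proof.
move=> [c1 [k1 [I1 b1 z1 U1]]] [c2 [k2 [I2 b2 z2 U2]]]; split.
  have inrP b : connect (@adj (graph_join r1 r2)) (inr r2) (inr b).
    have /connectP[p pp ->] := c2 b; apply/connectP; exists (map inr p).
      by rewrite path_map.
    by rewrite last_map.
  case=> // a; apply: (@connect_trans _ _ (inl r1)).
    by apply: connect1; rewrite /= !eqxx.
  have /connectP[p pp ->] := c1 a; apply/connectP; exists (map inl p).
    by rewrite path_map.
  by rewrite last_map.
exists (fun x => match x with inl a => (nvert F2 + k1 a)%N | inr b => k2 b end); split.
- move=> [a|a] [b|b] //=.
  + by move/addnI/I1 ->.
  + by move=> e; have := b2 b; rewrite -e ltnNge leq_addr.
  + by move=> e; have := b2 a; rewrite e ltnNge leq_addr.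
  + by move/I2 ->.
- move=> [a|b]; rewrite nvert_graph_join; last by rewrite ltn_addl.
  by rewrite [ltnRHS]addnC ltn_add2l.
- by [].
move=> [a|a] [b|b] [c|c] //=; rewrite ?ltn_add2l.
- by move=> ab ac ba ca; rewrite (U1 _ _ _ ab ac).
- by move=> _ /andP[/eqP-> _]; rewrite z1.
- by move=> /andP[/eqP-> _] _ _; rewrite z1.
- by move=> /andP[_ /eqP->] /andP[_ /eqP->].
- by move=> _ _ ba; rewrite ltnNge (leq_trans (ltnW (b2 _))) ?leq_addr.
- by move=> _ _; rewrite ltnNge (leq_trans (ltnW (b2 _))) ?leq_addr.
- by move=> _ _ _; rewrite ltnNge (leq_trans (ltnW (b2 _))) ?leq_addr.
- by move=> ab ac ba ca; rewrite (U2 _ _ _ ab ac).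
Qed.

Record rtree := RTree {
  rtree_graph :> sgraph; rtree_root : rtree_graph; rtreeP : rooted_tree rtree_root }.

Definition rtree_join (a b : rtree) : rtree := RTree (rooted_graph_join (rtreeP a) (rtreeP b)).

(** [Graft a b] is [b] with [a] attached to its root as a new first subtree.  Sums are
    indexed by these codes, as [rtree] lives in too high a universe for [exchange_big]. *)
Inductive plane_tree := Leaf | Graft of plane_tree & plane_tree.

Fixpoint tree_graph (t : plane_tree) : rtree :=
  if t is Graft a b then rtree_join (tree_graph a) (tree_graph b) else RTree rooted_one_vertex.

Fixpoint plane_trees (J : nat) : seq plane_tree :=
  if J is J'.+1 then Leaf :: [seq Graft a b | a <- plane_trees J', b <- plane_trees J'] else [::].

Lemma rtree_nvert_gt0 (t : rtree) : (0 < nvert t)%N.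
Proof. by apply/card_gt0P; exists (rtree_root t). Qed.

(** Both sides unfold alike: a nonempty walk is an excursion into a neighbour followed by the rest,
    and a nontrivial tree is a first subtree grafted on the rest. The exponent counts edges, and the
    joining edge supplies the extra ['X]. *)
Lemma plane_walks_hom (R : comNzRingType) (G : sgraph) (J : nat) (v : G) :
  plane_walks 'X J v =
  \sum_(t <- plane_trees J) (hom_at (rtree_root (tree_graph t)) v)%:R *: 'X^((nvert (tree_graph t)).-1) :> {poly R}.
Proof.
elim: J v => [|J IH] v /=; first by rewrite big_nil.
rewrite big_cons hom_at_point {1}/nvert card_unit /= expr0 scale1r; congr (_ + _).
rewrite big_allpairs_dep /= -mulrA.
have E : \sum_(u | adj v u) plane_walks 'X J u = \sum_(a <- plane_trees J)
    \sum_(u | adj v u) (hom_at (rtree_root (tree_graph a)) u)%:R *: 'X^((nvert (tree_graph a)).-1) :> {poly R}.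
  by rewrite (eq_bigr _ (fun u _ => IH u)); exact: exchange_big.
rewrite E IH big_distrl mulr_sumr /=; apply: eq_bigr => a _.
rewrite !mulr_sumr; apply: eq_bigr => b _ /=.
rewrite hom_at_join nvert_graph_join natrM natr_sum -scaler_suml.
rewrite -(prednK (rtree_nvert_gt0 (tree_graph a))) -(prednK (rtree_nvert_gt0 (tree_graph b))) addSn addnS /=.
by rewrite -scalerAl -!scalerAr scalerA mulrC exprS exprD.
Qed.

(** A tree with [j] edges has [j + 1] vertices and one component, so its density has exactly the
    denominator on the left. *)
Lemma sum_plane_walks (R : realType) (G : sgraph) (d : R) (J j : nat) : admissible G d ->
  (\sum_(v : G) plane_walks 'X J v)`_j / ((nvert G)%:R * d ^+ j) =
  \sum_(t <- plane_trees J | (nvert (tree_graph t)).-1 == j) density (tree_graph t) G d :> R.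
Proof.
move=> [n0 d1 _]; rewrite coef_sum.
under eq_bigr do rewrite plane_walks_hom coef_sum.
rewrite exchange_big /= mulr_suml [RHS]big_mkcond /=; apply: eq_bigr => t _.
under eq_bigr do rewrite coefZ coefXn eq_sym.
rewrite -mulr_suml; case: eqP => [<-|_]; last by rewrite mulr0 mul0r.
rewrite mulr1 -natr_sum -hom_sum_at /density (ncomp_rooted (rtreeP (tree_graph t))) expr1.
by rewrite subn1.
Qed.

Lemma plane_walks_cvg (R : realType) (G : nat -> sgraph) (d : nat -> R) (J j : nat) :
  (forall n, admissible (G n) (d n)) ->
  (forall F : sgraph, is_tree F -> cvgn (fun n => density F (G n) (d n))) ->
  cvgn (fun n => (\sum_(v : G n) plane_walks 'X J v)`_j / ((nvert (G n))%:R * d n ^+ j)).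
Proof.
move=> adm cF; under eq_fun do rewrite sum_plane_walks//.
elim: (plane_trees J) => [|t s IH].
  by under eq_fun do rewrite big_nil; exact: is_cvg_cst.
under eq_fun do rewrite big_cons.
case: eqP => // _; apply: is_cvgD => //.
by apply: cF; exact: (rooted_is_tree (rtreeP (tree_graph t))).
Qed.

(** * Walks in regular sequences *)

Section RegularStep.
Variables (R : realType) (G : sgraph) (d alpha : R).
Hypothesis adm : admissible G d.
Hypothesis alpha0 : 0 <= alpha.

Definition avg (f : G -> R) : R := (\sum_(v : G) f v) / (nvert G)%:R.

Lemma nvert_gt0 : 0 < (nvert G)%:R :> R.
Proof. by case: adm => n0 _ _; rewrite ltr0n. Qed.

Lemma adm_gt0 : 0 < d.
Proof. by case: adm => _ d1 _; exact: lt_le_trans d1. Qed.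

Lemma le_avg f g : (forall v, f v <= g v) -> avg f <= avg g.
Proof. by move=> fg; rewrite /avg ler_wpM2r ?invr_ge0 ?ler0n//; apply: ler_sum. Qed.

Lemma avgD f g : avg (fun v => f v + g v) = avg f + avg g.
Proof. by rewrite /avg big_split mulrDl. Qed.

Lemma avgZr f c : avg (fun v => f v * c) = avg f * c.
Proof. by rewrite /avg -mulr_suml mulrAC. Qed.

Lemma avg_sum (I : Type) (s : seq I) (f : I -> G -> R) :
  avg (fun v => \sum_(i <- s) f i v) = \sum_(i <- s) avg (f i).
Proof. by rewrite /avg exchange_big /= mulr_suml. Qed.

Lemma avg_cst c : avg (fun=> c) = c.
Proof. by rewrite /avg sumr_const -[X in X / _]mulr_natr mulfK// gt_eqF// nvert_gt0. Qed.

(** Double counting: [f u] occurs once for each neighbour of [u], hence at most [d] times. *)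
Lemma avg_nbr f : (forall v, 0 <= f v) ->
  avg (fun v => (\sum_(u | adj v u) f u) / d) <= avg f.
Proof.
move=> f0; rewrite avgZr ler_pdivrMr ?adm_gt0// /avg mulrAC ler_wpM2r ?invr_ge0 ?ler0n//.
rewrite mulr_suml (exchange_big_dep xpredT)//=; apply: ler_sum => u _.
rewrite sumr_const -[leLHS]mulr_natr ler_wpM2l//; case: adm => _ _ /(_ u).
by apply: le_trans; rewrite ler_nat; apply: subset_leq_card; apply/fintype.subsetP => v;
  rewrite !inE adj_sym.
Qed.

Definition walk_density (J : nat) (v : G) (j : nat) : R := (plane_walks 'X J v)`_j / d ^+ j.

Lemma walk_density_ge0 J v j : 0 <= walk_density J v j.
Proof.
rewrite divr_ge0 ?exprn_ge0 ?(ltW adm_gt0)//.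
by have /polyOverP := plane_walks_nneg R J v; exact.
Qed.

Lemma walk_density_le J v j : walk_density J v j <= pw_bound R J.
Proof.
apply: le_trans (plane_walks_le adm J v); rewrite /walk_density -exprVn.
by rewrite coef_le_horner ?plane_walks_nneg// invr_ge0 ltW// adm_gt0.
Qed.

Lemma walk_density0 J v : walk_density J.+1 v 0 = 1.
Proof. by rewrite /walk_density /= coefD coef1 -mulrA coefXM /= addr0 divr1. Qed.

Lemma walk_densityS J v j : walk_density J.+1 v j.+1 =
  \sum_(i < j.+1) (\sum_(u | adj v u) walk_density J u i) / d * walk_density J v (j - i).
Proof.
rewrite /walk_density /= coefD coef1 add0r -mulrA coefXM /= coefM mulr_suml.
apply: eq_bigr => i _; rewrite coef_sum -mulr_suml.
have -> : d ^+ j.+1 = d * d ^+ i * d ^+ (j - i).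
  by rewrite -mulrA -exprD subnKC -?exprS// -ltnS.
by field; rewrite !expf_neq0 ?gt_eqF ?adm_gt0.
Qed.

(** The Catalan numbers, given by their recursion; [c] is later instantiated with the even moments
    of the semicircle law. *)
Variable c : nat -> R.
Hypothesis c0 : c 0 = 1.
Hypothesis cS : forall j, c j.+1 = \sum_(i < j.+1) c i * c (j - i)%N.

Let k j := alpha ^+ j * c j.

Lemma catalan_ge0 j : 0 <= c j.
Proof.
have [n] := ubnP j; elim: n j => // n IH [|j] jn; first by rewrite c0.
rewrite cS sumr_ge0// => i _; apply: mulr_ge0; apply: IH; first exact: (@leq_trans j.+1).
exact: (@leq_ltn_trans j _ _ (leq_subr _ _)).
Qed.

Definition walk_error J j : R := avg (fun v => `|walk_density J v j - k j|).
Definition degree_error : R := avg (fun v => `|(degree v)%:R / d - alpha|).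

(** Errors are measured in the mean over vertices because [alpha]-regularity tolerates a few bad
    vertices. Averaging over neighbours does not increase such an error, so a step adds only the
    degree error; the uniform bound [pw_bound] handles the other factor of each product. *)
Lemma walk_error_step J j :
  walk_error J.+1 j.+1 <= \sum_(i < j.+1)
    ((walk_error J i + degree_error * k i) * pw_bound R J + walk_error J (j - i) * (alpha * k i)).
Proof.
have k0 i : 0 <= k i by rewrite mulr_ge0 ?exprn_ge0 ?catalan_ge0.
have kS : k j.+1 = \sum_(i < j.+1) alpha * k i * k (j - i)%N.
  rewrite /k cS mulr_sumr; apply: eq_bigr => i _.
  rewrite exprS -{1}(@subnKC i j); last by rewrite -ltnS.
  by rewrite exprD; ring.
pose e i v : R := (\sum_(u | adj v u) `|walk_density J u i - k i|) / d.
pose D (v : G) : R := `|(degree v)%:R / d - alpha|.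
apply: (@le_trans _ _ (avg (fun v => \sum_(i < j.+1)
  ((e i v + D v * k i) * pw_bound R J + `|walk_density J v (j - i) - k (j - i)%N| * (alpha * k i))))).
  apply: le_avg => v; rewrite walk_densityS kS -sumrB.
  apply: (le_trans (ler_norm_sum _ _ _)); apply: ler_sum => i _.
  set A := (_ / d) in e *; set B := walk_density _ _ _.
  have -> : A * B - alpha * k i * k (j - i)%N =
      (A - alpha * k i) * B + (B - k (j - i)%N) * (alpha * k i) by ring.
  apply: (le_trans (ler_normD _ _)).
  rewrite (normrM (A - _)) (normrM (B - _)) (ger0_norm (mulr_ge0 alpha0 (k0 i))) lerD2r.
  rewrite ler_pM//; last by rewrite ger0_norm ?walk_density_ge0 ?walk_density_le.
  have -> : A - alpha * k i = (\sum_(u | adj v u) (walk_density J u i - k i)) / d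
      + ((degree v)%:R / d - alpha) * k i.
    rewrite sumrB sumr_const -[k i *+ _]mulr_natl -/(degree v) /A; ring.
  apply: (le_trans (ler_normD _ _)).
  rewrite (normrM _ d^-1) (normrM _ (k i)) (ger0_norm (k0 i)) lerD2r.
  rewrite (@ger0_norm _ d^-1) ?invr_ge0 ?(ltW adm_gt0)// ler_wpM2r ?invr_ge0 ?(ltW adm_gt0)//.
  exact: ler_norm_sum.
rewrite avg_sum; apply: ler_sum => i _; rewrite avgD !avgZr lerD2r ler_wpM2r ?pw_bound_ge0//.
by rewrite avgD avgZr lerD2r avg_nbr.
Qed.

End RegularStep.

Local Open Scope classical_set_scope.

Lemma cvg_sum_seq (R : realType) (I : Type) (s : seq I) (f : I -> nat -> R) (l : I -> R) :
  (forall i, f i n @[n --> \oo] --> l i) ->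
  (\sum_(i <- s) f i n) @[n --> \oo] --> \sum_(i <- s) l i.
Proof.
move=> fl; elim: s => [|i s IH].
  by rewrite big_nil; under eq_fun do rewrite big_nil; exact: cvg_cst.
by rewrite big_cons; under eq_fun do rewrite big_cons; exact: cvgD.
Qed.

Section RegularLimit.
Variables (R : realType) (G : nat -> sgraph) (d : nat -> R) (alpha : R).
Hypothesis adm : forall n, admissible (G n) (d n).
Hypothesis alpha01 : 0 <= alpha <= 1.
Hypothesis reg : alpha_regular alpha G d.

(** Convergence in probability becomes convergence in mean because the deviations are bounded by 1:
    both the normalised degree and [alpha] lie in [[0, 1]]. *)
Lemma degree_error_cvg : degree_error (G n) (d n) alpha @[n --> \oo] --> 0.
Proof.
have [a0 a1] := andP alpha01.
apply/cvgr0Pnorm_le => e e0; have e2 : 0 < e / 2 by rewrite divr_gt0.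
move/cvgr0Pnorm_le: (reg e2) => /(_ _ e2); apply: filterS => n.
have N0 := nvert_gt0 (adm n); have D0 := adm_gt0 (adm n).
set p := _ / _ => pe.
rewrite ger0_norm; last by rewrite divr_ge0 ?sumr_ge0.
apply: (@le_trans _ _ (p + e / 2)); last first.
  by have := ler_norm p; lra.
rewrite /p -[X in _ + X](avg_cst (adm n)) /avg -mulrDl ler_wpM2r ?invr_ge0 ?ler0n//.
rewrite -sumr_const (@big_mkcond _ _ _ _ _ (fun v => v \in _)) -big_split /=.
apply: ler_sum => v _; rewrite inE; case: ltP => [_|]; last by rewrite add0r.
apply: (@le_trans _ _ 1); last by rewrite lerDl ltW.
have q0 : 0 <= (degree v)%:R / d n by rewrite divr_ge0 ?(ltW D0).
have q1 : (degree v)%:R / d n <= 1.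
  by rewrite ler_pdivrMr// mul1r; case: (adm n).
rewrite ler_norml; lra.
Qed.

Variable c : nat -> R.
Hypothesis c0 : c 0 = 1.
Hypothesis cS : forall j, c j.+1 = \sum_(i < j.+1) c i * c (j - i)%N.

Lemma walk_error_cvg J j : (j < J)%N ->
  walk_error (G n) (d n) alpha c J j @[n --> \oo] --> 0.
Proof.
have [a0 a1] := andP alpha01.
elim: J j => // J IH [|j] jJ.
  under eq_fun do rewrite /walk_error /avg.
  apply: cvg_near_cst; apply: nearW => n; rewrite big1 ?mul0r// => v _.
  by rewrite walk_density0 c0 expr0 mulr1 subrr normr0.
pose g i n := (walk_error (G n) (d n) alpha c J i + degree_error (G n) (d n) alpha * (alpha ^+ i * c i))
  * pw_bound R J + walk_error (G n) (d n) alpha c J (j - i) * (alpha * (alpha ^+ i * c i)).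
apply: (@squeeze_cvgr _ _ _ _ (fun=> 0) (fun n => \sum_(i < j.+1) g i n)).
- apply: nearW => n; rewrite {1}/walk_error divr_ge0 ?sumr_ge0//=.
  exact: walk_error_step.
- exact: cvg_cst.
- pose l (i : 'I_j.+1) : R := (0 + 0 * (alpha ^+ i * c i)) * pw_bound R J
     + 0 * (alpha * (alpha ^+ i * c i)).
  have l0 : \sum_i l i = 0 by rewrite big1// => i _; rewrite /l !(mul0r, addr0).
  rewrite -[X in _ --> X]l0.
  apply: (@cvg_sum_seq _ _ _ (fun i : 'I_j.+1 => g i) l) => i.
  apply: cvgD; apply: cvgMr_tmp.
    apply: cvgD; last by apply: cvgMr_tmp; exact: degree_error_cvg.
    by apply: IH; exact: leq_trans (ltn_ord i) _.
  by apply: IH; exact: (@leq_ltn_trans j _ _ (leq_subr _ _)).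
Qed.

Lemma plane_walks_regular J j : (j < J)%N ->
  (\sum_(v : G n) plane_walks 'X J v)`_j / ((nvert (G n))%:R * d n ^+ j)
    @[n --> \oo] --> alpha ^+ j * c j.
Proof.
move=> jJ; apply/cvgrPdist_le => e e0.
move/cvgr0Pnorm_le: (walk_error_cvg jJ) => /(_ _ e0); apply: filterS => n.
apply: le_trans; rewrite distrC.
have -> : (\sum_(v : G n) plane_walks 'X J v)`_j / ((nvert (G n))%:R * d n ^+ j)
    - alpha ^+ j * c j = avg (fun v : G n => walk_density (d n) J v j - alpha ^+ j * c j).
  rewrite avgD (avg_cst (adm n)) /walk_density avgZr /avg coef_sum invfM mulrA mulrAC.
  by [].
rewrite [leRHS]ger0_norm ?divr_ge0 ?sumr_ge0// /avg normrM [`|_^-1|]ger0_norm ?invr_ge0 ?ler0n//.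
by rewrite ler_wpM2r ?invr_ge0 ?ler0n// ler_norm_sum.
Qed.

End RegularLimit.

(** * Moments and weak limits *)

(** Heine's theorem, with only [x] confined to the segment. *)
Lemma uniform_continuity_segment (R : realType) (f : R -> R) (a b e : R) :
  continuous f -> 0 < e ->
  exists2 del : R, 0 < del & forall x y, a <= x <= b -> `|x - y| < del -> `|f x - f y| <= e.
Proof.
move=> cf e0; have e2 : 0 < e / 2 by rewrite divr_gt0.
have := (compact_near_coveringP _).1 (@segment_compact R a b).
move=> /(_ _ (0:R)^'+ (fun d x => forall y, `|x - y| < d -> `|f x - f y| <= e)).
move=> /(_ _)[].
  move=> x _; have := cf x => /cvgrPdist_lt /(_ _ e2) /nbhs_ballP[r /= r0 rf].
  have r2 : 0 < r / 2 by rewrite divr_gt0.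
  have rr : r / 2 < r by rewrite ltr_pdivrMr// ltr_pMr// ltr1n.
  near=> x' d => y xy.
  have x'r : `|x - x'| < r / 2 by near: x'; exact: (nbhsx_ballx x (r / 2)).
  have dr : d < r / 2 by near: d; exact: nbhs_right_lt.
  have fx' : `|f x - f x'| < e / 2 by apply: rf; apply: lt_trans rr.
  have fy : `|f x - f y| < e / 2.
    apply: rf; suff : `|x - y| < r by [].
    rewrite -(subrK x' x) -addrA.
    apply: (le_lt_trans (ler_normD _ _)); rewrite [ltRHS]splitr ltrD//.
    exact: lt_trans xy dr.
  rewrite -(subrK (f x) (f x')) -addrA; apply: (le_trans (ler_normD _ _)).
  by rewrite [`|f x' - _|]distrC [leRHS]splitr lerD// ltW.
move=> del /= del0 H.
exists (del / 2); first by rewrite divr_gt0.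
move=> x y xab xy; apply: (H (del / 2)) => //=.
  by rewrite sub0r normrN ger0_norm ?divr_ge0 ?ltW// ltr_pdivrMr// ltr_pMr// ltr1n.
by rewrite divr_gt0.
Unshelve. all: end_near. Qed.

(** [bernstein n h] is the Bernstein polynomial with values [h 0, ..., h n], i.e. the mean
    of [h] under the binomial law of parameter ['X]. *)
Fixpoint bernstein (R : comNzRingType) (n : nat) (h : nat -> R) : {poly R} :=
  if n is m.+1 then 'X * bernstein m (fun k => h k.+1) + (1 - 'X) * bernstein m h
  else (h 0)%:P.

Section Bernstein.
Variable R : realType.
Implicit Types (n : nat) (h : nat -> R) (t : R).

Lemma hornerS_bernstein n h t : (bernstein n.+1 h).[t] =
  t * (bernstein n (fun k => h k.+1)).[t] + (1 - t) * (bernstein n h).[t].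
Proof. by rewrite /= !hornerE. Qed.

Lemma le_bernstein n h1 h2 t : 0 <= t <= 1 -> (forall k, (k <= n)%N -> h1 k <= h2 k) ->
  (bernstein n h1).[t] <= (bernstein n h2).[t].
Proof.
move=> /andP[t0 t1]; elim: n h1 h2 => [|n IH] h1 h2 h12; first by rewrite !hornerC h12.
rewrite !hornerS_bernstein lerD// ler_wpM2l ?subr_ge0//; apply: IH => k kn; apply: h12.
  by [].
exact: leqW.
Qed.

Lemma bernsteinB n h1 h2 t :
  (bernstein n (fun k => h1 k - h2 k)).[t] = (bernstein n h1).[t] - (bernstein n h2).[t].
Proof.
elim: n h1 h2 => [|n IH] h1 h2; first by rewrite !hornerC.
by rewrite !hornerS_bernstein (IH (fun k => h1 k.+1) (fun k => h2 k.+1)) IH; ring.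
Qed.

Lemma bernstein_cst n (c : R) t : (bernstein n (fun=> c)).[t] = c.
Proof. by elim: n => [|n IH]; rewrite ?hornerC// hornerS_bernstein IH; ring. Qed.

(** The second moment of the binomial law about [c]: squared bias plus the variance
    [n t (1 - t)]. *)
Lemma bernstein_affine_sqr n (a b c : R) t :
  (bernstein n (fun k => a + b * (k%:R - c) ^+ 2)).[t] =
  a + b * ((n%:R * t - c) ^+ 2 + n%:R * t * (1 - t)).
Proof.
elim: n c => [|n IH] c; first by rewrite hornerC; ring.
rewrite hornerS_bernstein IH.
have -> : (fun k => a + b * (k.+1%:R - c) ^+ 2) = (fun k => a + b * (k%:R - (c - 1)) ^+ 2).
  by apply/funext => k; rewrite -natr1; congr (_ + _ * _ ^+ 2); ring.
by rewrite IH -natr1; ring.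
Qed.

(** Bernstein's proof by Chebyshev's inequality: the deviation of [g] at [k / n] is dominated by a
    quadratic function of [k], whose binomial mean is explicit. *)
Lemma weierstrass01 (g : R -> R) (e : R) : continuous g -> 0 < e ->
  exists p : {poly R}, forall t, 0 <= t <= 1 -> `|g t - p.[t]| <= e.
Proof.
move=> cg e0; have e2 : 0 < e / 2 by rewrite divr_gt0.
have [del del0 gd] := @uniform_continuity_segment _ g 0 1 _ cg e2.
have [M M0 gM] : exists2 M : R, 0 < M & forall t, 0 <= t <= 1 -> `|g t| <= M.
  have /compact_bounded[M [_ Mg]] : compact (g @` `[0, 1]).
    apply: continuous_compact; last exact: segment_compact.
    exact: continuous_subspaceT.
  exists (Num.max 0 M + 1); first by rewrite ltr_pwDr// le_max lexx.
  move=> t t01; apply: (Mg (Num.max 0 M + 1)); last by exists t => //=; rewrite in_itv.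
  by rewrite ltr_pwDr// le_max lexx orbT.
(* Makes [2 M / (del ^ 2 n)] at most [e / 2], where [t (1 - t)] is bounded by 1. *)
pose n := (Num.truncn (4 * M / (del ^+ 2 * e))).+1.
have n0 : 0 < n%:R :> R by rewrite ltr0n.
have nM : 4 * M / (del ^+ 2 * e) < n%:R by exact: truncnS_gt.
(* Makes the quadratic term reach [2 M], the trivial bound on the deviation, once [k / n] is at
   distance [del] from [t]. *)
pose B := 2 * M / (del ^+ 2 * n%:R ^+ 2).
have B0 : 0 <= B by rewrite divr_ge0 ?mulr_ge0 ?exprn_ge0 ?ltW.
exists (bernstein n (fun k => g (k%:R / n%:R))) => t t01; have /andP[t0 t1] := t01.
have key k : (k <= n)%N -> `|g t - g (k%:R / n%:R)| <= e / 2 + B * (k%:R - n%:R * t) ^+ 2.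
  move=> kn; have [td|td] := ltP `|t - k%:R / n%:R| del.
    by rewrite (le_trans (gd _ _ t01 td))// lerDl mulr_ge0 ?sqr_ge0.
  have kn01 : 0 <= (k%:R / n%:R : R) <= 1.
    by rewrite divr_ge0 ?ler0n//= ler_pdivrMr// mul1r ler_nat.
  apply: (@le_trans _ _ (2 * M)).
    by rewrite (le_trans (ler_normB _ _))// mulr2n mulrDl !mul1r lerD// gM.
  have -> : B * (k%:R - n%:R * t) ^+ 2 = 2 * M * ((t - k%:R / n%:R) ^+ 2 / del ^+ 2).
    by rewrite /B; field; rewrite !gt_eqF.
  rewrite -[leLHS]mulr1 (le_trans (ler_wpM2l _ (_ : 1 <= (t - k%:R / n%:R) ^+ 2 / del ^+ 2)))//.
  - by rewrite mulr_ge0// ltW.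
  - rewrite ler_pdivlMr ?exprn_gt0// mul1r -[leRHS]real_normK ?num_real//.
    by rewrite ler_sqr ?nnegrE// ltW.
  - by rewrite lerDr ltW.
have bnd : (bernstein n (fun k => e / 2 + B * (k%:R - n%:R * t) ^+ 2)).[t] <= e.
  rewrite bernstein_affine_sqr subrr expr0n add0r.
  have tt : t * (1 - t) <= 1 by nra.
  have -> : B * (n%:R * t * (1 - t)) = 2 * M / (del ^+ 2 * n%:R) * (t * (1 - t)).
    by rewrite /B; field; rewrite !gt_eqF.
  have b2 : 2 * M / (del ^+ 2 * n%:R) <= e / 2.
    move: nM; rewrite ltr_pdivrMr ?mulr_gt0 ?exprn_gt0// => nM.
    rewrite ler_pdivrMr ?mulr_gt0 ?exprn_gt0//.
    have -> : e / 2 * (del ^+ 2 * n%:R) = n%:R * (del ^+ 2 * e) / 2 by field.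
    by rewrite ler_pdivlMr// ltW// (le_lt_trans _ nM)// le_eqVlt; apply/orP; left; apply/eqP; ring.
  rewrite [leRHS]splitr lerD2l (le_trans _ b2)// -[leRHS]mulr1 ler_wpM2l//.
  by rewrite divr_ge0 ?mulr_ge0 ?exprn_ge0 ?ltW.
rewrite -{1}(bernstein_cst n (g t) t) -bernsteinB ler_norml; apply/andP; split.
  rewrite lerNl; apply: le_trans bnd.
  have -> : - (bernstein n (fun k => g t - g (k%:R / n%:R))).[t] =
      (bernstein n (fun k => 0 - (g t - g (k%:R / n%:R)))).[t].
    by rewrite (bernsteinB n (fun=> 0) (fun k => g t - g (k%:R / n%:R))) bernstein_cst sub0r.
  apply: le_bernstein => // k kn; apply: le_trans (key k kn).
  by rewrite sub0r (le_trans (ler_norm _))// normrN.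
apply: le_trans bnd; apply: le_bernstein => // k kn; apply: le_trans (key k kn).
exact: ler_norm.
Qed.

Lemma weierstrass (f : R -> R) (e : R) : continuous f -> 0 < e ->
  exists p : {poly R}, forall x, -2 <= x <= 2 -> `|f x - p.[x]| <= e.
Proof.
move=> cf e0; have cg : continuous (fun t : R => f (4 * t - 2)).
  move=> t; apply: continuous_comp; last exact: cf.
  by apply: cvgB; [apply: cvgMl_tmp; exact: cvg_id|exact: cvg_cst].
have [p gp] := weierstrass01 cg e0.
exists (p \Po (4^-1 *: 'X + (2^-1)%:P)) => x x2.
rewrite horner_comp !hornerE.
have /gp : 0 <= 4^-1 * x + 2^-1 <= 1 by lra.
by congr (`|f _ - _| <= e); field.
Qed.

End Bernstein.

Section Means.
Variable R : realType.

(** Integration against a probability measure carried by [[-2, 2]]. *)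
Record is_mean (A : (R -> R) -> R) : Prop := IsMean {
  mean_one : A (fun=> 1) = 1;
  mean_linear : forall (a : R) (f g : R -> R), continuous f -> continuous g ->
    A (fun x => a * f x + g x) = a * A f + A g;
  mean_norm_le : forall (f : R -> R) (e : R), continuous f -> (forall x : R, -2 <= x <= 2 -> `|f x| <= e) ->
    `|A f| <= e }.

Lemma mean_sub A (f g : R -> R) : is_mean A -> continuous f -> continuous g ->
  A (fun x => f x - g x) = A f - A g.
Proof.
move=> mA cf cg; rewrite addrC -mulN1r -(mean_linear mA)//; congr A.
by apply/funext => x; rewrite mulN1r addrC.
Qed.

Lemma mean_dist_le A (f g : R -> R) (e : R) : is_mean A -> continuous f -> continuous g ->
  (forall x : R, -2 <= x <= 2 -> `|f x - g x| <= e) -> `|A f - A g| <= e.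
Proof.
move=> mA cf cg fg; rewrite -mean_sub//; apply: (mean_norm_le mA) => //.
by move=> x; apply: cvgB; [exact: cf|exact: cg].
Qed.

Lemma mean_horner A (p : {poly R}) : is_mean A ->
  A (fun x => p.[x]) = \sum_(i < size p) p`_i * A (fun x => x ^+ i).
Proof.
move=> mA; under eq_fun do rewrite horner_coef.
elim: (size p) => [|n IH].
  rewrite big_ord0; apply/eqP; rewrite -normr_le0; apply: (mean_norm_le mA).
    by under eq_fun do rewrite big_ord0; exact: cst_continuous.
  by move=> x _; rewrite big_ord0 normr0.
rewrite big_ord_recr /= -IH addrC -(mean_linear mA).
- by congr A; apply/funext => x; rewrite big_ord_recr /= addrC.
- exact: exprn_continuous.
- rewrite (_ : (fun x => _) = horner (\poly_(i < n) p`_i)); first exact: continuous_horner.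
  by apply/funext => x; rewrite horner_poly.
Qed.

Section cvg.
Variables (A : nat -> (R -> R) -> R).
Hypothesis mA : forall n, is_mean (A n).

Lemma mean_moment_lim (B : (R -> R) -> R) (f : R -> R) : is_mean B ->
  (forall k, A n (fun x => x ^+ k) @[n --> \oo] --> B (fun x => x ^+ k)) ->
  continuous f -> A n f @[n --> \oo] --> B f.
Proof.
move=> mB AB cf; apply/cvgrPdist_le => e e0; have e3 : 0 < e / 3 by rewrite divr_gt0.
have [p fp] := weierstrass cf e3.
have /cvgrPdist_le/(_ _ e3) : A n (fun x => p.[x]) @[n --> \oo] --> B (fun x => p.[x]).
  under eq_fun do rewrite mean_horner//.
  by rewrite mean_horner//; apply: cvg_sum_seq => i; apply: cvgMl_tmp.
apply: filterS => n pn.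
have h1 := mean_dist_le mB cf (@continuous_horner R p) fp.
have h2 := mean_dist_le (mA n) cf (@continuous_horner R p) fp.
move: h1 h2 pn; rewrite !ler_norml; lra.
Qed.

Lemma mean_moment_cvg (f : R -> R) :
  (forall k, cvgn (fun n => A n (fun x => x ^+ k))) ->
  continuous f -> cvgn (fun n => A n f).
Proof.
move=> Ak cf; apply/cauchy_cvgP/cauchy_exP => e e0.
have e3 : 0 < e / 3 by rewrite divr_gt0.
have [p fp] := weierstrass cf e3.
have : cvgn (fun n => A n (fun x => p.[x])).
  under eq_fun do rewrite mean_horner//.
  apply: cvgP; apply: cvg_sum_seq => i; apply: cvgMl_tmp; exact: Ak.
set l := lim _ => /cvgrPdist_le/(_ _ e3) pl; exists l.
move: pl; apply: filterS => n pn; rewrite /ball /=.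
have h2 := mean_dist_le (mA n) cf (@continuous_horner R p) fp.
move: h2 pn; rewrite !ler_norml ltr_norml; lra.
Qed.

Lemma mean_lim : (forall f : R -> R, continuous f -> cvgn (fun n => A n f)) ->
  is_mean (fun f => limn (fun n => A n f)).
Proof.
move=> cA; split=> [|a f g cf cg|f e cf fe].
  by under eq_fun do rewrite (mean_one (mA _)); exact: lim_cst.
  under eq_fun do rewrite (mean_linear (mA _))//.
  apply/cvg_lim => //; apply: cvgD; last exact: cA.
  by apply: cvgMl_tmp; exact: cA.
rewrite -lim_norm; last exact: cA.
apply: limr_le; first by apply: is_cvg_norm; exact: cA.
by apply: nearW => n; exact: (mean_norm_le (mA n)).
Qed.

End cvg.
End Means.

(** * Moments of the matching measures *)

Section MatchingMean.
Variable R : realType.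

Definition matching_mean (G : sgraph) (d : R) (f : R -> R) : R :=
  (\sum_(r <- roots_mult (matching_poly G)) f (r / Num.sqrt d)) / (nvert G)%:R.

Lemma matching_mean_is_mean G d : admissible G d -> is_mean (matching_mean G d).
Proof.
move=> adm; split=> [|a f g _ _|f e _ fe].
  rewrite /matching_mean big_const_seq count_predT size_roots_matching iter_addr_0.
  by rewrite divff// gt_eqF// (nvert_gt0 adm).
  by rewrite /matching_mean big_split /= -mulr_sumr mulrDl mulrA.
have s0 : 0 < Num.sqrt d by rewrite sqrtr_gt0 (adm_gt0 adm).
rewrite /matching_mean normrM [`|_^-1|]ger0_norm ?invr_ge0 ?ler0n// ler_pdivrMr ?(nvert_gt0 adm)//.
apply: (le_trans (ler_norm_sum _ _ _)).
apply: (@le_trans _ _ (\sum_(r <- roots_mult (matching_poly G : {poly R})) e)); last first.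
  by rewrite big_const_seq count_predT size_roots_matching iter_addr_0 mulr_natr.
rewrite big_seq [leRHS]big_seq; apply: ler_sum => r /(roots_matching_bound adm) rb.
apply: fe; rewrite ler_pdivlMr// ler_pdivrMr// mulNr.
by move: rb; rewrite ler_norml.
Qed.

Lemma matching_mean_odd G d j : matching_mean G d (fun x => x ^+ j.*2.+1) = 0.
Proof.
rewrite /matching_mean; under eq_bigr do rewrite exprMn.
rewrite -mulr_suml (@power_sum_roots _ _ _ j.+1); last by rewrite doubleS.
by rewrite /= odd_double !mul0r.
Qed.

Lemma matching_mean_even G d j : 0 < d -> matching_mean G d (fun x => x ^+ j.*2) =
  (\sum_(v : G) tree_walks 'X j.+1 [set: G]%SET v)`_j / ((nvert G)%:R * d ^+ j).
Proof.
move=> d0; rewrite /matching_mean; under eq_bigr do rewrite exprMn.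
rewrite -mulr_suml (@power_sum_roots _ _ _ j.+1); last by rewrite doubleS.
rewrite odd_double doubleK exprVn -mul2n exprM sqr_sqrtr ?ltW// invfM mulrA.
by rewrite mulrAC.
Qed.

(** The gap between tree-like and plane walks is a constant over [d n], so it disappears in the
    limit. *)
Lemma matching_mean_moment (G : nat -> sgraph) (d : nat -> R) j (l : R) :
  (forall n, admissible (G n) (d n)) -> d n @[n --> \oo] --> +oo ->
  (\sum_(v : G n) plane_walks 'X j.+1 v)`_j / ((nvert (G n))%:R * d n ^+ j) @[n --> \oo] --> l ->
  matching_mean (G n) (d n) (fun x => x ^+ j.*2) @[n --> \oo] --> l.
Proof.
move=> adm doo pl.
pose gap n : R := walks_gap R j.+1 / d n.
have g0 : gap n @[n --> \oo] --> 0.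
  rewrite -[X in _ --> X](mulr0 (walks_gap R j.+1)); apply: cvgMl_tmp.
  by apply/gtr0_cvgV0 => //; apply: nearW => n; exact: adm_gt0 (adm n).
apply/cvgrPdist_le => e e0; have e2 : 0 < e / 2 by rewrite divr_gt0.
near=> n.
have h1 : `|gap n| <= e / 2.
  by near: n; move/cvgr0Pnorm_le: g0 => /(_ _ e2).
have h2 : `|l - (\sum_(v : G n) plane_walks 'X j.+1 v)`_j / ((nvert (G n))%:R * d n ^+ j)| <= e / 2.
  by near: n; move/cvgrPdist_le: pl => /(_ _ e2).
have h3 := coef_walks_gap (adm n) j.+1 j.
rewrite matching_mean_even ?(adm_gt0 (adm n))//.
move: h2 h3; set q := _%:R * _; set a := (_)`_j; set b := (_)`_j => h2 h3.
have q0 : 0 < q by rewrite mulr_gt0 ?exprn_gt0 ?(nvert_gt0 (adm n)) ?(adm_gt0 (adm n)).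
have {}h3 : `|b / q - a / q| <= gap n.
  by rewrite -mulrBl normrM [`|q^-1|]ger0_norm// invr_ge0 ltW.
move: h1 h2 h3; rewrite !ler_norml; lra.
Unshelve. all: end_near. Qed.

End MatchingMean.

(** * Representation of a mean by a probability measure *)

Section IntegralMean.
Variables (R : realType) (mu : {measure set R -> \bar R}).
Hypothesis mu1 : mu `[-2, 2] = 1%E.

(** Restricting to the segment makes every continuous function integrable, bounded on the line or
    not. *)
Definition integral_mean (f : R -> R) : R := \int[mu]_(x in `[-2, 2]) f x.

Lemma continuous_integrable_mean (f : R -> R) : continuous f ->
  mu.-integrable `[-2, 2] (EFin \o f).
Proof.
move=> cf; apply: measurable_bounded_integrable => //.
- by rewrite mu1 ltry.
- by apply: measurable_funTS; exact: continuous_measurable_fun.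
- have /compact_bounded : compact (f @` `[-2, 2]).
    by apply: continuous_compact; [exact: continuous_subspaceT|exact: segment_compact].
  move=> [M [Mr Mf]]; exists M; split=> // x Mx y /= y2; apply: (Mf x Mx).
  by exists y.
Qed.

Lemma integral_mean_cst (c : R) : integral_mean (fun=> c) = c.
Proof. by rewrite /integral_mean Rintegral_cst// mu1 mulr1. Qed.

Lemma integral_mean_is_mean : is_mean integral_mean.
Proof.
split=> [|a f g cf cg|f e cf fe].
- exact: integral_mean_cst.
- have af : continuous (fun x => a * f x) by move=> x; apply: cvgMl_tmp; exact: cf.
  rewrite /integral_mean RintegralD//; try exact: continuous_integrable_mean.
  by rewrite RintegralZl//; exact: continuous_integrable_mean.
- apply: (le_trans (le_normr_Rintegral _ (continuous_integrable_mean cf))) => //.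
  rewrite -[leRHS]integral_mean_cst /integral_mean; apply: le_Rintegral => //.
  + apply: (@continuous_integrable_mean (fun x => `|f x|)) => x.
    by apply: cvg_norm; exact: cf.
  + by apply: continuous_integrable_mean; exact: cst_continuous.
Qed.

End IntegralMean.

Section Ramp.
Variable R : realType.

(** A continuous stand-in for the indicator of a left half-line: for [a < b] it is 1 up to [a], 0
    from [b] on and linear between. *)
Definition ramp (a b x : R) : R := Num.min 1 (Num.max 0 ((b - x) / (b - a))).

Lemma continuous_ramp a b : continuous (ramp a b).
Proof.
apply: min_fun_continuous; first exact: cst_continuous.
apply: max_fun_continuous; first exact: cst_continuous.
by move=> x; apply: cvgMr_tmp; apply: cvgB; [exact: cvg_cst|exact: cvg_id].
Qed.

Lemma ramp01 a b x : 0 <= ramp a b x <= 1.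
Proof. by rewrite /ramp ge_min lexx/= le_min ler01 le_max lexx. Qed.

Lemma ramp_left a b x : a < b -> x <= a -> ramp a b x = 1.
Proof.
move=> ab xa; have h : 1 <= (b - x) / (b - a) by rewrite ler_pdivlMr ?subr_gt0// mul1r lerD2l lerN2.
by rewrite /ramp max_r ?(le_trans ler01)// min_l.
Qed.

Lemma ramp_right a b x : a < b -> b <= x -> ramp a b x = 0.
Proof.
move=> ab bx; have h : (b - x) / (b - a) <= 0.
  by rewrite ler_pdivrMr ?subr_gt0// mul0r subr_le0.
by rewrite /ramp max_l// min_r.
Qed.

End Ramp.

Lemma probability_of_cdf (R : realType) (F : R -> R) :
  {homo F : x y / x <= y} -> right_continuous F ->
  F @ -oo --> (0:R) -> F @ +oo --> (1:R) ->
  exists rho : probability R R, forall r, rho `]-oo, r] = (F r)%:E.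
Proof.
move=> Fnd Frc F0 F1.
pose C1 := isCumulative.Build R _ R F Fnd Frc.
pose C2 := isCumulativeBounded.Build R 0 1 F F0 F1.
pose Fc : cumulativeBounded (0:R) (1:R) := HB.pack F C1 C2.
(* The law of the identity map carries the Stieltjes measure from [measurableTypeR R] to [R]. *)
pose idTR : measurableTypeR R -> R := idfun.
pose M := @isMeasurableFun.Build _ _ _ _ idTR (@measurable_id _ _ setT).
pose X : {mfun measurableTypeR R >-> R} := HB.pack idTR M.
exists (distribution (lebesgue_stieltjes_measure Fc) X) => r.
exact: (cdf_lebesgue_stieltjes_id Fc r).
Qed.

Section MeanRepresentation.
Variables (R : realType) (L : (R -> R) -> R).
Hypothesis mL : is_mean L.

Lemma mean_cst (c : R) : L (fun=> c) = c.
Proof.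
have L0 : L (fun=> 0) = 0.
  apply/eqP; rewrite -normr_le0; apply: (mean_norm_le mL) => [|x _].
    exact: cst_continuous.
  by rewrite normr0.
have := mean_linear mL c (@cst_continuous R R 1) (@cst_continuous R R 0).
by rewrite (mean_one mL) L0 !mulr1 !addr0.
Qed.

(** Positivity is hidden in the norm bound: a function with values in [[0, 1]] is within 1/2 of the
    constant 1/2. *)
Lemma mean_ge0 (f : R -> R) : continuous f -> (forall x, -2 <= x <= 2 -> 0 <= f x <= 1) ->
  0 <= L f <= 1.
Proof.
move=> cf f01.
have : `|L f - L (fun=> 2^-1)| <= 2^-1.
  apply: mean_dist_le => //; first exact: cst_continuous.
  by move=> x /f01; rewrite ler_norml; lra.
by rewrite mean_cst ler_norml; lra.
Qed.

Lemma le_mean_ramp (a b a' b' : R) : a < b -> b <= a' -> a' < b' ->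
  L (ramp a b) <= L (ramp a' b').
Proof.
move=> ab ba' ab'; rewrite -subr_ge0 -mean_sub//; try exact: continuous_ramp.
suff /andP[] : 0 <= L (fun x => ramp a' b' x - ramp a b x) <= 1 by [].
apply: mean_ge0; first by move=> x; apply: cvgB; exact: continuous_ramp.
move=> x _; have /andP[r0 r1] := ramp01 a b x; have /andP[r0' r1'] := ramp01 a' b' x.
have [xb|bx] := leP x b; last by rewrite (ramp_right ab (ltW bx)) subr0 r0' r1'.
by rewrite (@ramp_left _ a' b')// ?(le_trans xb)//; lra.
Qed.

Lemma mean_ramp01 a b : 0 <= L (ramp a b) <= 1.
Proof. by apply: mean_ge0 => [|x _]; [exact: continuous_ramp|exact: ramp01]. Qed.

(** Taking [a] and [b] both above [x] makes [mean_cdf] right-continuous by definition. *)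
Definition mean_cdf (x : R) : R :=
  inf [set y | exists a b, [/\ x < a, a < b & y = L (ramp a b)]].

Let has_inf_cdf x : has_inf [set y | exists a b, [/\ x < a, a < b & y = L (ramp a b)]].
Proof.
split; first by exists (L (ramp (x + 1) (x + 2))), (x + 1), (x + 2); split=> //; lra.
by exists 0 => _ [a [b [_ _ ->]]]; have /andP[] := mean_ramp01 a b.
Qed.

Lemma mean_cdf_le x a b : x < a -> a < b -> mean_cdf x <= L (ramp a b).
Proof. by move=> xa ab; apply: ge_inf; [case: (has_inf_cdf x)|exists a, b]. Qed.

Lemma mean_cdf_ge x c : (forall a b, x < a -> a < b -> c <= L (ramp a b)) -> c <= mean_cdf x.
Proof.
move=> h; apply: lb_le_inf; first by case: (has_inf_cdf x).
by move=> _ [a [b [xa ab ->]]]; exact: h.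
Qed.

Lemma ramp_le_mean_cdf a b : a < b -> L (ramp a b) <= mean_cdf b.
Proof. by move=> ab; apply: mean_cdf_ge => a' b' ba' ab'; apply: le_mean_ramp => //; exact: ltW. Qed.

Lemma mean_cdf_nondecreasing : {homo mean_cdf : x y / x <= y}.
Proof.
by move=> x y xy; apply: mean_cdf_ge => a b ya ab; apply: mean_cdf_le => //; exact: le_lt_trans ya.
Qed.

Lemma mean_cdf01 x : 0 <= mean_cdf x <= 1.
Proof.
apply/andP; split; first by apply: mean_cdf_ge => a b _ _; have /andP[] := mean_ramp01 a b.
have := @mean_cdf_le x (x + 1) (x + 2); have /andP[_ h] := mean_ramp01 (x + 1) (x + 2).
by move=> h'; apply: le_trans h; apply: h'; lra.
Qed.

Lemma mean_cdf_right_continuous : right_continuous mean_cdf.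
Proof.
move=> x; apply/cvgrPdist_le => e e0.
have : mean_cdf x < mean_cdf x + e by rewrite ltrDl.
move=> /(inf_lt (has_inf_cdf x).1)[_ [a [b [xa ab ->]]] Le].
near=> y; have xy : x <= y by apply/ltW; near: y; exact: nbhs_right_gt.
have ya : y < a by near: y; exact: nbhs_right_lt.
rewrite distrC ger0_norm ?subr_ge0 ?mean_cdf_nondecreasing//.
rewrite lerBlDl; apply: le_trans (ltW Le); exact: mean_cdf_le.
Unshelve. all: end_near. Qed.

Lemma mean_cdf_low x : x < -2 -> mean_cdf x = 0.
Proof.
move=> x2; apply/eqP; rewrite eq_le; have /andP[-> _] := mean_cdf01 x; rewrite andbT.
have xm : x < (x - 2) / 2 by lra.
apply: (le_trans (mean_cdf_le xm (_ : _ < -2))); first by lra.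
have : `|L (ramp ((x - 2) / 2) (-2))| <= 0.
  apply: (mean_norm_le mL); first exact: continuous_ramp.
  by move=> y /andP[y2 _]; rewrite ramp_right ?normr0//; lra.
by apply: le_trans; exact: ler_norm.
Qed.

Lemma mean_cdf_high x : 2 <= x -> mean_cdf x = 1.
Proof.
move=> x2; apply/eqP; rewrite eq_le; have /andP[_ ->] := mean_cdf01 x => /=.
apply: mean_cdf_ge => a b xa ab.
have : `|L (ramp a b) - L (fun=> 1)| <= 0.
  apply: mean_dist_le => //; [exact: continuous_ramp|exact: cst_continuous|].
  by move=> y /andP[_ y2]; rewrite ramp_left ?subrr ?normr0//; lra.
by rewrite (mean_one mL) normr_le0 subr_eq0 => /eqP ->.
Qed.

Lemma mean_cdf_measure : exists rho : probability R R,
  rho `[-2, 2] = 1%E /\ forall r, rho `]-oo, r] = (mean_cdf r)%:E.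
Proof.
have [] := @probability_of_cdf R mean_cdf mean_cdf_nondecreasing mean_cdf_right_continuous.
- apply: cvg_near_cst; near=> x; apply: mean_cdf_low.
  by near: x; exact: nbhs_ninfty_lt.
- apply: cvg_near_cst; near=> x; apply: mean_cdf_high.
  by near: x; exact: nbhs_pinfty_ge.
move=> rho rhoE; exists rho; split=> //.
(* There may be an atom at -2, so the open half-line is exhausted by closed ones ending before -2,
   where the distribution function vanishes. *)
have low : rho `]-oo, -2[ = 0%E.
  have -> : `]-oo, (-2 : R)[%classic = \bigcup_n `]-oo, -2 - n.+1%:R^-1].
    apply/seteqP; split=> [x|x [n _]] /=; rewrite !in_itv /= => x2.
      have y0 : 0 < -2 - x by lra.
      exists (Num.truncn (-2 - x)^-1) => //=; rewrite in_itv /=.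
      by rewrite lerBrDl -lerBrDr invf_ple ?posrE ?ltr0n// ltW// truncnS_gt.
    by apply: le_lt_trans x2 _; rewrite gtrBl invr_gt0 ltr0n.
  apply/negligibleP; first exact: bigcup_measurable.
  apply: negligible_bigcup => n; apply/negligibleP => //.
  have := rhoE (-2 - n.+1%:R^-1); rewrite mean_cdf_low// gtrBl invr_gt0 ltr0n.
  by [].
have -> : `[-2, 2]%classic = `]-oo, 2] `\` `]-oo, (-2 : R)[ :> set R.
  apply/seteqP; split=> x /=; rewrite !in_itv /=.
    by move=> /andP[x1 x2]; split=> //; apply/negP; rewrite -leNgt.
  by move=> [-> /negP]; rewrite -leNgt => ->.
rewrite measureD//=; last by rewrite rhoE ltry.
rewrite [X in (_ - X)%E](_ : _ = 0%E); last first.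
  rewrite setIidr ?low// => x /=; rewrite !in_itv /= => /ltW x2.
  by apply: le_trans x2 _; lra.
by rewrite rhoE mean_cdf_high// sube0.
Unshelve. all: end_near. Qed.

End MeanRepresentation.

Section CarriedProbability.
Variables (R : realType) (rho : probability R R).
Hypothesis rho1 : rho `[-2, 2] = 1%E.

Lemma carried_outside : rho (~` `[-2, 2]) = 0%E.
Proof. by rewrite probability_setC// rho1 subee. Qed.

Lemma carried_setI (A : set R) : measurable A -> rho (A `&` `[-2, 2]) = rho A.
Proof.
move=> mA; rewrite [RHS](measureDI rho mA (measurable_itv `[(-2 : R), 2]%O)).
rewrite [X in (X + _)%E](_ : _ = 0%E) ?add0e//.
apply/eqP; rewrite eq_le measure_ge0 andbT -carried_outside; apply: le_measure.
- by rewrite inE; exact: measurableD.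
- by rewrite inE; exact: measurableC.
- by move=> x [].
Qed.

Lemma integral_mean_itv (r : R) : integral_mean rho \1_`]-oo, r] = fine (rho `]-oo, r]).
Proof.
rewrite /integral_mean /Rintegral integral_indic//; congr fine; exact: carried_setI.
Qed.

Lemma integral_meanE (f : R -> R) : continuous f -> bounded_fun f ->
  (\int[rho]_x (f x)%:E = (integral_mean rho f)%:E)%E.
Proof.
move=> cf bf; have mf := continuous_measurable_fun cf.
have intf : rho.-integrable setT (EFin \o f).
  apply: measurable_bounded_integrable => //.
  by have := fin_num_measure rho _ measurableT; rewrite ge0_fin_numE.
rewrite /integral_mean /Rintegral fineK; last first.
  exact: integrable_fin_num (continuous_integrable_mean rho1 cf).
rewrite -(setUv `[-2, 2]%classic) integral_setU_EFin//=.
- rewrite [X in (_ + X)%E](_ : _ = 0%E) ?adde0//.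
  apply: null_set_integral => //; last exact: carried_outside.
  + exact: measurableC.
  + by apply: measurable_funTS; exact/measurable_EFinP.
- exact: measurableC.
- exact: measurable_funTS.
- by apply/disj_setPS; rewrite setICr.
Qed.

End CarriedProbability.

Section Representation.
Variables (R : realType) (L : (R -> R) -> R).
Hypothesis mL : is_mean L.
Variable rho : probability R R.
Hypothesis rho1 : rho `[-2, 2] = 1%E.
Hypothesis rhoE : forall r, rho `]-oo, r] = (mean_cdf L r)%:E.

Lemma integral_ramp_bounds (a b : R) : a < b ->
  mean_cdf L a <= integral_mean rho (ramp a b) <= mean_cdf L b.
Proof.
move=> ab; have rE r : mean_cdf L r = integral_mean rho \1_`]-oo, r].
  by rewrite integral_mean_itv// rhoE.
have fin1 : (rho `[(-2)%R, 2%R]%classic < +oo)%E by rewrite rho1 ltry.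
have intI r : rho.-integrable `[-2, 2] (EFin \o \1_`]-oo, r]).
  apply: measurable_bounded_integrable => //.
  exists 1; split=> // M M1 x _ /=; rewrite indicE; case: (_ \in _); rewrite ?normr1 ?normr0.
    exact: ltW.
  by rewrite ltW// (lt_trans _ M1).
have intR := continuous_integrable_mean rho1 (@continuous_ramp R a b).
rewrite !rE /integral_mean; apply/andP; split; apply: le_Rintegral => // x _.
- rewrite indicE; case: (boolP (x \in _)); last by have /andP[] := ramp01 a b x.
  by rewrite inE /= in_itv /= => xa; rewrite ramp_left.
- rewrite indicE; case: (boolP (x \in _)); first by have /andP[] := ramp01 a b x.
  by rewrite notin_setE /= in_itv /= => /negP; rewrite -ltNge => xb; rewrite ramp_right// ltW.
Qed.

(** Both numbers lie between the distribution function at [c] and at [b]. The point [c] is strictly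
    left of [a] because [mean_cdf] is defined from ramps that start strictly to the right. *)
Lemma ramp_dist (a b c : R) : a < b -> c < a ->
  `|L (ramp a b) - integral_mean rho (ramp a b)| <= mean_cdf L b - mean_cdf L c.
Proof.
move=> ab ca; have /andP[h1 h2] := integral_ramp_bounds ab.
have h3 := ramp_le_mean_cdf mL ab; have h4 := mean_cdf_le mL ca ab.
have h5 := mean_cdf_nondecreasing mL (ltW ca).
by rewrite ler_norml; lra.
Qed.

(** The piecewise linear interpolation of [f] at the points [-3 + i * h], [i <= n]. *)
Fixpoint interpolation (f : R -> R) (h : R) (n : nat) (x : R) : R :=
  let a i := -3 + i%:R * h in
  if n is m.+1 then
    - (f (a n) - f (a m)) * ramp (a m) (a n) x + ((f (a n) - f (a m)) + interpolation f h m x)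
  else f (a 0).

Lemma continuous_interpolation (f : R -> R) (h : R) n : continuous (interpolation f h n).
Proof.
elim: n => [|n IH] /=; first exact: cst_continuous.
move=> x; apply: cvgD; first by apply: cvgMl_tmp; exact: continuous_ramp.
by apply: cvgD; [exact: cvg_cst|exact: IH].
Qed.

Lemma interpolation_close (f : R -> R) (h e : R) n : 0 < h ->
  (forall x y : R, `|x - y| <= h -> -3 <= x <= -3 + n%:R * h -> `|f x - f y| <= e) ->
  (forall x : R, -3 <= x <= -3 + n%:R * h -> `|f x - interpolation f h n x| <= e) /\
  (forall x : R, -3 + n%:R * h <= x -> interpolation f h n x = f (-3 + n%:R * h)).
Proof.
move=> h0; elim: n => [|n IH] fe; first split=> [x|x _] //.
  move: fe; rewrite /= mul0r addr0 => fe /[dup] x3; rewrite -eq_le => /eqP xE.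
  rewrite {1}xE; apply: fe; last exact: x3.
  by rewrite subrr normr0 ltW.
have step : -3 + n.+1%:R * h = -3 + n%:R * h + h by rewrite -natr1; ring.
have ab : -3 + n%:R * h < -3 + n.+1%:R * h by rewrite step; lra.
have [|IH1 IH2] := IH.
  by move=> x y xy /andP[x1 x2]; apply: fe => //; rewrite x1/= (le_trans x2)// ltW.
split=> x /=; last first.
  by move=> xn; rewrite ramp_right// IH2 ?(le_trans (ltW ab))//; ring.
move=> /andP[x3 xn]; have [xa|ax] := leP x (-3 + n%:R * h).
  rewrite ramp_left// mulr1 addrA addNr add0r; apply: IH1; by rewrite x3.
rewrite IH2 ?(ltW ax)//; set t := ramp _ _ _; have /andP[t0 t1] : 0 <= t <= 1 := ramp01 _ _ _.
set fa := f (-3 + n%:R * h); set fb := f (-3 + n.+1%:R * h).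
have h1 : `|f x - fa| <= e.
  by apply: fe; rewrite ?x3// ger0_norm; lra.
have h2 : `|f x - fb| <= e.
  by apply: fe; rewrite ?x3// ler0_norm; lra.
have -> : f x - (- (fb - fa) * t + (fb - fa + fa)) = t * (f x - fa) + (1 - t) * (f x - fb) by ring.
apply: (le_trans (ler_normD _ _)); rewrite !normrM (ger0_norm t0) (@ger0_norm _ (1 - t)) ?subr_ge0//.
have t1' : 0 <= 1 - t by rewrite subr_ge0.
by have := lerD (ler_wpM2l t0 h1) (ler_wpM2l t1' h2); lra.
Qed.

(** A ramp contributes at most [e] times the increase of the distribution function over two
    consecutive cells. These increases telescope, leaving its values at the last two grid points, so
    the bound does not grow with [n]. *)
Lemma interpolation_dist (f : R -> R) (h e : R) n : 0 < h -> 0 <= e ->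
  (forall i, (i < n)%N -> `|f (-3 + i.+1%:R * h) - f (-3 + i%:R * h)| <= e) ->
  `|L (interpolation f h n) - integral_mean rho (interpolation f h n)| <=
  e * (mean_cdf L (-3 + n%:R * h) + mean_cdf L (-3 + n%:R * h - h)).
Proof.
move=> h0 e0; have mB := integral_mean_is_mean rho1.
elim: n => [|n IH] fe.
  rewrite (mean_cst mL) (mean_cst mB) subrr normr0 mulr_ge0// addr_ge0//.
    by have /andP[] := mean_cdf01 mL (-3 + 0%:R * h).
  by have /andP[] := mean_cdf01 mL (-3 + 0%:R * h - h).
have step : -3 + n.+1%:R * h = -3 + n%:R * h + h by rewrite -natr1; ring.
have split A : is_mean A -> A (interpolation f h n.+1) =
    - (f (-3 + n.+1%:R * h) - f (-3 + n%:R * h)) * A (ramp (-3 + n%:R * h) (-3 + n.+1%:R * h)) +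
    ((f (-3 + n.+1%:R * h) - f (-3 + n%:R * h)) + A (interpolation f h n)).
  move=> mA; rewrite [LHS](mean_linear mA); last 2 first.
  - exact: continuous_ramp.
  - by move=> x; apply: cvgD; [exact: cvg_cst|exact: continuous_interpolation].
  congr (_ + _); set c := _ - _.
  have := mean_linear mA 1 (@cst_continuous R R c) (@continuous_interpolation f h n).
  by rewrite (mean_cst mA) !mul1r.
rewrite (split L mL) (split _ mB) step; set c := _ - f _; set ra := ramp _ _.
have cE : `|c| <= e by rewrite /c -step; exact: fe.
have {}IH := IH (fun i (ni : (i < n)%N) => fe i (ltnW ni)).
have rd : `|L ra - integral_mean rho ra| <=
    mean_cdf L (-3 + n%:R * h + h) - mean_cdf L (-3 + n%:R * h - h).
  by apply: ramp_dist; lra.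
have -> : - c * L ra + (c + L (interpolation f h n)) -
    (- c * integral_mean rho ra + (c + integral_mean rho (interpolation f h n))) =
    - c * (L ra - integral_mean rho ra) +
    (L (interpolation f h n) - integral_mean rho (interpolation f h n)) by ring.
apply: (le_trans (ler_normD _ _)); rewrite normrM normrN addrK.
apply: (le_trans (lerD (ler_pM _ _ cE rd) IH)) => //.
by rewrite -mulrDr ler_wpM2l//; lra.
Qed.

Lemma mean_representation (f : R -> R) : continuous f -> integral_mean rho f = L f.
Proof.
move=> cf; have mB := integral_mean_is_mean rho1.
(* An error [e] for interpolating under each of the two means, and [2 e] from [interpolation_dist],
   as the distribution function is at most 1. *)
suff : forall e, 0 < e -> `|L f - integral_mean rho f| <= 4 * e.
  move=> fe; apply/esym/eqP; rewrite -subr_eq0 -normr_le0.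
  apply/ler_addgt0Pr => e e0; rewrite add0r.
  have -> : e = 4 * (e / 4) by field.
  by apply: fe; rewrite divr_gt0.
move=> e e0; have [del del0 fd] := @uniform_continuity_segment R f (-3) 3 e cf e0.
pose N := (Num.truncn (6 / del)).+1; pose h : R := 6 / N%:R.
have N0 : 0 < N%:R :> R by rewrite ltr0n.
have h0 : 0 < h by rewrite divr_gt0.
have hd : h < del by rewrite ltr_pdivrMr// mulrC -ltr_pdivrMr// truncnS_gt.
have Nh : -3 + N%:R * h = 3 by rewrite /h mulrCA divff ?gt_eqF// mulr1; lra.
have fxy (x y : R) : `|x - y| <= h -> -3 <= x <= -3 + N%:R * h -> `|f x - f y| <= e.
  by rewrite Nh => xy x3; apply: fd => //; exact: le_lt_trans hd.
have [close _] := interpolation_close h0 fxy.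
have close2 (x : R) : -2 <= x <= 2 -> `|f x - interpolation f h N x| <= e.
  by move=> x2; apply: close; rewrite Nh; lra.
have h1 := mean_dist_le mL cf (@continuous_interpolation f h N) close2.
have h2 := mean_dist_le mB cf (@continuous_interpolation f h N) close2.
have h3 : `|L (interpolation f h N) - integral_mean rho (interpolation f h N)| <= 2 * e.
  apply: (le_trans (interpolation_dist h0 (ltW e0) _)).
    move=> i iN; apply: fxy.
      by rewrite -natr1 ger0_norm; lra.
    have : i.+1%:R * h <= N%:R * h by rewrite ler_wpM2r ?(ltW h0)// ler_nat.
    by rewrite lerDl lerD2l => ->; rewrite mulr_ge0 ?(ltW h0).
  have /andP[_ c1] := mean_cdf01 mL (-3 + N%:R * h).
  have /andP[_ c2] := mean_cdf01 mL (-3 + N%:R * h - h).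
  by rewrite mulrC ler_wpM2r ?(ltW e0)//; lra.
move: h1 h2 h3; rewrite !ler_norml; lra.
Qed.

End Representation.

(** * Matching measures and the number of matchings *)

Section MatchingMeasure.
Variables (R : realType) (G : sgraph) (d : R).
Hypothesis adm : admissible G d.

Lemma ge0_integral_matching_measure (f : R -> R) : measurable_fun setT f ->
  (forall x, 0 <= f x) ->
  (\int[matching_measure G d]_x (f x)%:E = (matching_mean G d f)%:E)%E.
Proof.
move=> mf f0; have mEf : measurable_fun setT (EFin \o f) by exact/measurable_EFinP.
rewrite ge0_integral_mscale//=; last by move=> x _; rewrite lee_fin.
rewrite ge0_integral_measure_sum//=; last by move=> x _; rewrite lee_fin.
under eq_bigr do rewrite integral_dirac//= diracT mul1e.
rewrite sumEFin -EFinM /matching_mean mulrC; congr (_ / _)%:E.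
by rewrite (big_nth 0) big_mkord.
Qed.

Lemma integral_matching_measure (f : R -> R) : measurable_fun setT f ->
  (\int[matching_measure G d]_x (f x)%:E = (matching_mean G d f)%:E)%E.
Proof.
move=> mf; rewrite integralE.
have -> : ((EFin \o f)^\+)%E = EFin \o (fun x => Num.max (f x) 0).
  by apply/funext => x; rewrite funeposE /= EFin_max.
have -> : ((EFin \o f)^\-)%E = EFin \o (fun x => Num.max (- f x) 0).
  by apply/funext => x; rewrite funenegE /= EFin_max.
rewrite (ge0_integral_matching_measure (f := fun x => Num.max (f x) 0)); last 2 first.
- exact: measurable_maxr.
- by move=> x; rewrite le_max lexx orbT.
rewrite (ge0_integral_matching_measure (f := fun x => Num.max (- f x) 0)); last 2 first.
- by apply: measurable_maxr => //; exact: measurableT_comp.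
- by move=> x; rewrite le_max lexx orbT.
rewrite -EFinB /matching_mean -mulrBl -sumrB; congr (_ / _)%:E; apply: eq_bigr => r _.
case: (leP (f (r / Num.sqrt d)) 0) => h.
  by rewrite max_l ?oppr_ge0// opprK add0r.
by rewrite max_r ?subr0// oppr_le0 ltW.
Qed.

Lemma mgen_gt0 (y : R) (S : {set G}) : 0 < y -> 0 < mgen y 1 S.
Proof.
move=> y0; rewrite /mgen (bigD1 finset.set0)/=; last first.
  by rewrite is_matching0 /finset.cover big_set0 finset.sub0set.
rewrite ltr_wpDr//; last by rewrite expr1n mul1r exprn_gt0.
by apply: sumr_ge0 => M _; rewrite mulr_ge0 ?exprn_ge0 ?(ltW y0).
Qed.

(** The shift [eps] becomes the vertex weight [Num.sqrt (eps * d)]. The value [eps = d^-1] counts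
    matchings; a fixed [eps] is what complete graphs are evaluated at. *)
Lemma matching_mean_ln (eps : R) : 0 < eps ->
  matching_mean G d (fun x => ln (eps + x ^+ 2)) =
  2 / (nvert G)%:R * ln (mgen (Num.sqrt (eps * d)) 1 [set: G]%SET) - ln d.
Proof.
move=> e0; have d0 := adm_gt0 adm; have n0 := nvert_gt0 adm.
have ed0 : 0 < eps * d by rewrite mulr_gt0.
have rE (r : R) : ln (eps + (r / Num.sqrt d) ^+ 2) =
    ln (Num.sqrt (eps * d) ^+ 2 + r ^+ 2) - ln d.
  rewrite exprMn exprVn !sqr_sqrtr ?ltW// -ln_div ?posrE//; last first.
    by rewrite ltr_pwDl ?sqr_ge0.
  by congr ln; field; rewrite gt_eqF.
rewrite /matching_mean; under eq_bigr do rewrite rE.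
rewrite sumrB big_const_seq count_predT size_roots_matching iter_addr_0 mulrBl.
rewrite -[ln d *+ _]mulr_natr mulfK ?gt_eqF//; congr (_ - _).
have -> : \sum_(r <- roots_mult (matching_poly G)) ln (Num.sqrt (eps * d) ^+ 2 + r ^+ 2) =
    ln (\prod_(r <- roots_mult (matching_poly G)) (Num.sqrt (eps * d) ^+ 2 + r ^+ 2)).
  have p0 (r : R) : 0 < Num.sqrt (eps * d) ^+ 2 + r ^+ 2.
    by rewrite ltr_pwDl ?sqr_ge0 ?exprn_gt0 ?sqrtr_gt0.
  elim: (roots_mult _) => [|r s IH]; first by rewrite !big_nil ln1.
  by rewrite !big_cons IH lnM ?posrE ?prodr_gt0.
rewrite prod_sqr_roots_matching lnXn ?mgen_gt0 ?sqrtr_gt0// -[ln _ *+ 2]mulr_natl.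
by rewrite mulrAC.
Qed.

Lemma ln_total_matchings :
  ln ((total_matchings G)%:R `^ (2 / (nvert G)%:R) / d) =
  matching_mean G d (fun x => ln (d^-1 + x ^+ 2)).
Proof.
have d0 := adm_gt0 adm; rewrite matching_mean_ln ?invr_gt0// mulVf ?gt_eqF// sqrtr1.
rewrite (total_matchings_mgen R) ln_div ?posrE ?powR_gt0 ?mgen_gt0//.
by rewrite ln_powR.
Qed.

Lemma ln_total_matchings_le (eps : R) : d^-1 <= eps ->
  ln ((total_matchings G)%:R `^ (2 / (nvert G)%:R) / d) <=
  matching_mean G d (fun x => ln (eps + x ^+ 2)).
Proof.
move=> de; have dV0 : 0 < d^-1 by rewrite invr_gt0 (adm_gt0 adm).
rewrite ln_total_matchings /matching_mean ler_wpM2r ?invr_ge0 ?ler0n//.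
apply: ler_sum => r _; rewrite ler_ln ?posrE ?lerD2r//.
  by rewrite ltr_pwDl ?sqr_ge0.
by rewrite ltr_pwDl ?sqr_ge0// (lt_le_trans dV0).
Qed.

End MatchingMeasure.

Lemma continuous_ln_sqr (R : realType) (eps : R) : 0 < eps ->
  continuous (fun x : R => ln (eps + x ^+ 2)).
Proof.
move=> e0 x; apply: (@continuous_comp _ _ _ (fun x : R => eps + x ^+ 2) (@ln R)).
  by apply: cvgD; [exact: cvg_cst|exact: exprn_continuous].
by apply: continuous_ln; rewrite ltr_pwDl ?sqr_ge0.
Qed.

Lemma limn_esup_le (R : realType) (u : nat -> R) (c : R) :
  (forall e, 0 < e -> \forall n \near \oo, u n <= c + e) ->
  (limn_esup (fun n => (u n)%:E) <= c%:E)%E.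
Proof.
move=> uc; apply/lee_addgt0Pr => e e0; have [N _ Nu] := uc e e0.
apply: ge_ereal_inf; exists (ereal_sup ((fun n => (u n)%:E) @` [set n | (N <= n)%N])).
  by exists [set n | (N <= n)%N] => //; exists N.
by apply: ge_ereal_sup => _ [n Nn <-]; rewrite -EFinD lee_fin; exact: Nu.
Qed.

Lemma cvg_EFin_seq (R : realType) (u : nat -> R) (l : R) :
  u n @[n --> \oo] --> l -> ((u n)%:E @[n --> \oo] --> l%:E)%E.
Proof. by move=> ul; apply/fine_cvgP; split=> //; exact: nearW. Qed.

(** * The logarithmic integral *)

Section LogIntegral.
Variables (R : realType) (rho : {measure set R -> \bar R}).
Hypothesis rho1 : rho `[-2, 2] = 1%E.

Let D : set R := `[-2, 2]%classic.
Let g (k : nat) (x : R) : R := ln (k.+1%:R^-1 + x ^+ 2).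
(** An upper bound for every [g k] on [[-2, 2]], since [k.+1%:R^-1 + x ^+ 2 <= 1 + 4]. Thus the
    [c - g k] are nonnegative there and increase to [phi], which is [+oo] at 0. *)
Let c : R := ln 5.
Let phi (x : R) : \bar R := (c%:E - 2%:E * lne `|x|%:E)%E.

Let g_pos k x : 0 < k.+1%:R^-1 + x ^+ 2 :> R.
Proof. by rewrite ltr_pwDl ?sqr_ge0. Qed.

Let phi_cvg (x : R) : ((c - g k x)%:E @[k --> \oo] --> phi x)%E.
Proof.
have V0 : (k.+1%:R^-1 : R) @[k --> \oo] --> (0 : R).
  exact: cvg_harmonic.
rewrite /phi; have [->|x0] := eqVneq x 0.
  rewrite normr0 le0_lneNy// mulrNy gtr0_sg// mul1e /=.
  rewrite addey//; apply/cvgeryP/cvgryPge => A.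
  near=> k; have kA : expR A <= k%:R by near: k; exact: nbhs_infty_ger.
  rewrite /g expr0n addr0 lnV ?posrE// opprK -[A]expRK.
  apply: (@le_trans _ _ (ln k.+1%:R)).
    by rewrite ler_ln ?posrE ?expR_gt0// (le_trans kA)// ler_nat.
  by rewrite lerDr ln_ge0// ler1n.
rewrite lne_EFin ?normr_gt0// -EFinM -EFinB; apply: cvg_EFin_seq.
apply: cvgB; first exact: cvg_cst.
have -> : 2 * ln `|x| = ln (0 + x ^+ 2).
  by rewrite add0r -real_normK ?num_real// lnXn ?normr_gt0// mulr_natl.
apply: (@cvg_comp _ _ _ (fun k => k.+1%:R^-1 + x ^+ 2) (@ln R)).
  by apply: cvgD V0 _; exact: cvg_cst.
by apply: continuous_ln; rewrite add0r exprn_even_gt0.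
Unshelve. all: end_near. Qed.

(** Monotone convergence for [c - g k]. The value [S = +oo] contradicts the bound for [k = 0] and
    [S = -oo] is trivial, so [S] may be taken finite. *)
Lemma le_log_integral (S : \bar R) :
  (forall k, S <= (integral_mean rho (g k))%:E)%E ->
  (S <= 2%:E * \int[rho]_(x in `[(-2)%R, 2%R]) lne `|x|%:E)%E.
Proof.
case: S => [s|h|_]; [|by have := h 0%N; rewrite leye_eq|exact: leNye].
move=> sg; have mD : measurable D by exact: measurable_itv.
have cg k : continuous (g k) by exact: continuous_ln_sqr.
have ccg k : continuous (fun x => c - g k x) by move=> x; apply: cvgB; [exact: cvg_cst|exact: cg].
have intg k := continuous_integrable_mean rho1 (ccg k).
have mphin k : measurable_fun D (fun x => (c - g k x)%:E).
  by apply/measurable_EFinP; apply: measurable_funTS; exact: continuous_measurable_fun.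
have phin0 k x : D x -> (0 <= (c - g k x)%:E)%E.
  rewrite /D /= in_itv /= => x2; rewrite lee_fin subr_ge0 ler_ln ?posrE//.
  have -> : 5 = 1 + 4 :> R by lra.
  by rewrite lerD ?invf_le1 ?ler1n//; nra.
have mphi : measurable_fun D phi.
  by apply: (emeasurable_fun_cvg (fun k x => (c - g k x)%:E)) => // x _; exact: phi_cvg.
have phi0 x : D x -> (0 <= phi x)%E.
  by move=> Dx; apply: (cvge_to_ge (@phi_cvg x)); apply: nearW => k; exact: phin0.
have Iphi : (\int[rho]_(x in D) phi x <= (c - s)%:E)%E.
  have -> : (\int[rho]_(x in D) phi x = \int[rho]_(x in D) limn (fun k => (c - g k x)%:E))%E.
    by apply: eq_integral => x _; apply/esym/cvg_lim => //; exact: phi_cvg.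
  rewrite monotone_convergence//.
  - apply: lime_le.
      apply: ereal_nondecreasing_is_cvgn => m n mn; apply: ge0_le_integral => //.
        by move=> x; exact: phin0.
      move=> x _; rewrite lee_fin lerD2l lerN2 ler_ln ?posrE// lerD2r.
      by rewrite lef_pV2 ?posrE// ler_nat.
    apply: nearW => k; have := sg k; rewrite lee_fin => sk.
    rewrite -[X in (X <= _)%E]fineK; last exact: integrable_fin_num (intg k).
    rewrite lee_fin -/(Rintegral rho D (fun x => c - g k x)).
    rewrite RintegralB//.
    + rewrite Rintegral_cst// rho1 mulr1 lerD2l lerN2//.
    + by apply: (continuous_integrable_mean rho1); exact: cst_continuous.
    + exact: (continuous_integrable_mean rho1).
  - by move=> x _ m n mn; rewrite lee_fin lerD2l lerN2 ler_ln ?posrE// lerD2r lef_pV2 ?posrE// ler_nat.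
(* Finiteness of [S] makes [phi] integrable, which allows the integral of [c - phi] to be split. *)
have iphi : rho.-integrable D phi.
  apply/integrableP; split=> //.
  rewrite (eq_integral phi); first exact: le_lt_trans Iphi (ltry _).
  by move=> x /set_mem Dx; rewrite gee0_abs// phi0.
have ic : rho.-integrable D (cst c%:E).
  have := continuous_integrable_mean rho1 (@cst_continuous R R c); exact.
have lneE (x : R) : (lne `|x|%:E = (2^-1)%:E * (c%:E - phi x))%E.
  have : lne `|x|%:E != +oo%E by rewrite /lne; case: ifP.
  rewrite /phi; case: (lne `|x|%:E) => [r||]// _.
    by have {1}-> : r = 2^-1 * (c - (c - 2 * r)) by field.
  by rewrite mulrNy gtr0_sg// mul1e /= mulrNy gtr0_sg ?invr_gt0// mul1e.
under eq_integral do rewrite lneE.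
rewrite integralZl//; last exact: integrableB.
rewrite muleA -EFinM divff// mul1e integralB//.
rewrite integral_cst// rho1 mule1.
rewrite -(fineK (integrable_fin_num _ iphi))// -EFinB lee_fin lerBrDl -lerBrDr.
by rewrite -lee_fin fineK//; exact: integrable_fin_num iphi.
Qed.

End LogIntegral.

Section TreeConvergent.
Variables (R : realType) (G : nat -> sgraph) (d : nat -> R).
Hypothesis adm : forall n, admissible (G n) (d n).
Hypothesis d_oo : d n @[n --> \oo] --> +oo.

Lemma ln_total_matchings_limsup (eps l e : R) : 0 < eps -> 0 < e ->
  matching_mean (G n) (d n) (fun x => ln (eps + x ^+ 2)) @[n --> \oo] --> l ->
  \forall n \near \oo,
    ln ((total_matchings (G n))%:R `^ (2 / (nvert (G n))%:R) / d n) <= l + e.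
Proof.
move=> eps0 e0 /cvgrPdist_le/(_ _ e0) near_l.
near=> n.
have h1 : `|l - matching_mean (G n) (d n) (fun x => ln (eps + x ^+ 2))| <= e by near: n.
have h2 : (d n)^-1 <= eps.
  rewrite invf_ple ?posrE ?(adm_gt0 (adm n))//; near: n.
  by move/cvgryPge: d_oo; exact.
apply: (le_trans (ln_total_matchings_le (adm n) h2)).
by move: h1; rewrite ler_norml; lra.
Unshelve. all: end_near. Qed.

Lemma tree_convergent_matching_measures :
  (forall F : sgraph, is_tree F -> cvgn (fun n => density F (G n) (d n))) ->
  exists rho : probability R R,
      [/\ rho `[-2, 2]%classic = 1%E,
          weak_cvg (fun n => matching_measure (G n) (d n)) rho
        & (limn_esup (fun n => (ln (
             (total_matchings (G n))%:R `^ (2 / (nvert (G n))%:R) / d n)%R)%:E)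
           <= 2%:E * \int[rho]_(x in `[(-2)%R, 2%R]) lne `|x|%:E)%E].
Proof.
move=> cF; have mA n := matching_mean_is_mean (adm n).
have moments k : cvgn (fun n => matching_mean (G n) (d n) (fun x => x ^+ k)).
  rewrite -(odd_double_half k); case: (odd k) => /=.
    by under eq_fun do rewrite matching_mean_odd; exact: is_cvg_cst.
  have := @plane_walks_cvg R G d k./2.+1 k./2 adm cF; set l := lim _ => pl.
  exact: cvgP (matching_mean_moment adm d_oo pl).
have cA f (cf : continuous f) := mean_moment_cvg mA moments cf.
pose L f := limn (fun n => matching_mean (G n) (d n) f).
have mL : is_mean L := mean_lim mA cA.
have [rho [rho1 rhoE]] := mean_cdf_measure mL.
have LE f (cf : continuous f) : integral_mean rho f = L f := mean_representation mL rho1 rhoE cf.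
exists rho; split=> //.
- move=> f cf bf; rewrite integral_meanE//.
  under eq_fun do rewrite (integral_matching_measure _ _ (continuous_measurable_fun cf)).
  by apply: cvg_EFin_seq; rewrite LE//; exact: cA.
- apply: le_log_integral => // k; apply: limn_esup_le => e e0.
  have cg := @continuous_ln_sqr R k.+1%:R^-1 (_ : 0 < _).
  rewrite LE; last by apply: cg; rewrite invr_gt0.
  apply: (@ln_total_matchings_limsup k.+1%:R^-1) => //; apply: cA.
  by apply: cg; rewrite invr_gt0.
Qed.

End TreeConvergent.

(** * Moments of the semicircle law *)

Section Density.
Local Open Scope ereal_scope.
Context d (T : measurableType d) (R : realType).
Variables (mu nu : {measure set T -> \bar R}) (p : T -> R).
Hypothesis mp : measurable_fun setT p.
Hypothesis p0 : forall x, (0 <= p x)%R.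
Hypothesis nuE : forall A, measurable A -> nu A = \int[mu]_(x in A) (p x)%:E.

Import HBNNSimple.

Let integral_density_nnsfun (h : {nnsfun T >-> R}) :
  \int[nu]_x (h x)%:E = \int[mu]_x (h x * p x)%:E.
Proof.
under [LHS]eq_integral do rewrite fimfunE -fsumEFin//.
rewrite [LHS]ge0_integral_fsum//; last 2 first.
  - by move=> r; exact/measurable_EFinP/measurableT_comp.
  - by move=> n x _; rewrite EFinM nnfun_muleindic_ge0.
under [RHS]eq_integral.
  move=> x xD; rewrite EFinM fimfunE -fsumEFin// ge0_mule_fsuml; last first.
    by move=> r; rewrite EFinM nnfun_muleindic_ge0.
  over.
rewrite [RHS]ge0_integral_fsum//; last 2 first.
  - move=> r; apply: emeasurable_funM; last exact/measurable_EFinP.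
    by apply/measurable_EFinP/measurableT_comp.
  - move=> n x _; apply: mule_ge0; last by rewrite lee_fin.
    by rewrite EFinM nnfun_muleindic_ge0.
apply: eq_fsbigr => r _.
have mr : measurable (h @^-1` [set r]) by [].
rewrite integralZl_indic_nnsfun// integral_indic// setIT nuE//.
rewrite [X in _ * X]integral_mkcond.
have [r0|r0] := leP 0%R r.
  rewrite -ge0_integralZl//; last 2 first.
  - apply/(measurable_restrictT _ mr).
    by apply/measurable_EFinP; exact: measurable_funTS.
  - by move=> x _; rewrite erestrict_ge0// => y _; rewrite lee_fin.
  apply: eq_integral => x _; rewrite patchE /=.
  rewrite indicE; case: (x \in _); rewrite ?mulr1 ?mulr0 ?mul0e ?mule0//.
have -> : h @^-1` [set r] = set0.
  apply/seteqP; split=> // x /= hx; have : (0 <= h x)%R by exact: fun_ge0.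
  by rewrite hx leNgt r0.
rewrite patch_set0 integral0 mule0; apply/esym.
apply: integral0_eq => x _.
by rewrite indicE in_set0 mulr0 mul0e.
Qed.

(** Approximation by simple functions from below, with monotone convergence on both sides. *)
Lemma ge0_integral_density (f : T -> R) : measurable_fun setT f -> (forall x, (0 <= f x)%R) ->
  \int[nu]_x (f x)%:E = \int[mu]_x (f x * p x)%:E.
Proof.
move=> mf f0; have mEf : measurable_fun setT (EFin \o f) by exact/measurable_EFinP.
pose f_ := nnsfun_approx measurableT mEf.
have f_cvg x : (f_ n x)%:E @[n --> \oo] --> (f x)%:E.
  by apply: (cvg_nnsfun_approx measurableT mEf) => // y _; rewrite lee_fin.
have f_nd x m n : (m <= n)%N -> (f_ m x <= f_ n x)%R.
  by move=> mn; exact/lefP/nd_nnsfun_approx.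
transitivity (limn (fun n => \int[nu]_x (f_ n x)%:E)).
  rewrite -monotone_convergence//=.
  - by apply: eq_integral => x _; apply/esym/cvg_lim => //; exact: f_cvg.
  - by move=> n; exact/measurable_EFinP/measurable_funTS.
  - by move=> n x _; rewrite lee_fin.
  - by move=> x _ m n mn; rewrite lee_fin f_nd.
rewrite (_ : (fun n => _) = (fun n => \int[mu]_x (f_ n x * p x)%:E)); last first.
  by apply/funext => n; exact: integral_density_nnsfun.
rewrite -monotone_convergence//=.
- apply: eq_integral => x _; apply/cvg_lim => //.
  under eq_fun do rewrite EFinM.
  by rewrite EFinM; apply: cvgeZr => //; exact: f_cvg.
- by move=> n; apply/measurable_EFinP; apply: measurable_funM.
- by move=> n x _; rewrite lee_fin mulr_ge0.
- by move=> x _ m n mn; rewrite lee_fin ler_wpM2r// f_nd.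
Qed.

End Density.

Section SemicircleMean.
Variable R : realType.
Local Notation mu := (@lebesgue_measure R).
Local Notation pdf := (@semicircle_pdf R).

Definition semicircle_mean (f : R -> R) : R := \int[mu]_(x in `[-2, 2]) (f x * pdf x).

Lemma continuous_semicircle_pdf : continuous pdf.
Proof.
move=> x; rewrite /semicircle_pdf; apply: cvgMr_tmp.
apply: (@continuous_comp _ _ _ (fun x : R => 4 - x ^+ 2) (@Num.sqrt R)).
  by apply: cvgB; [exact: cvg_cst|exact: exprn_continuous].
exact: sqrt_continuous.
Qed.

Lemma semicircle_pdf_outside x : ~ `[-2, 2]%classic x -> pdf x = 0.
Proof.
rewrite /= in_itv /= => /negP; rewrite negb_and -!ltNge => x2.
by rewrite /semicircle_pdf ler0_sqrtr ?mul0r//; case/orP: x2; nra.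
Qed.

Lemma integrable_semicircle (f : R -> R) : continuous f ->
  mu.-integrable `[-2, 2] (EFin \o (fun x => f x * pdf x)).
Proof.
move=> cf; apply: continuous_compact_integrable; first exact: segment_compact.
apply: continuous_subspaceT => x; apply: cvgM; first exact: cf.
exact: continuous_semicircle_pdf.
Qed.

Lemma continuous_scale (f : R -> R) (b : R) : continuous f -> continuous (fun x => f (b * x)).
Proof.
move=> cf x; apply: (@continuous_comp _ _ _ (fun x => b * x) f); last exact: cf.
by apply: cvgMl_tmp; exact: cvg_id.
Qed.

Lemma ge0_integral_semicircle (f : R -> R) (b : R) : continuous f -> (forall x, 0 <= f x) ->
  (\int[semicircle b]_x (f x)%:E = (semicircle_mean (fun x => f (b * x)))%:E)%E.
Proof.
move=> cf f0; have mf := continuous_measurable_fun cf.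
have cfb := @continuous_scale f b cf; have mfb := continuous_measurable_fun cfb.
(* The law is repackaged over [measurableTypeR R], the type that carries the Lebesgue measure. *)
pose C := isMeasure.Build _ (measurableTypeR R) R (@std_semicircle R)
  (measure0 (@std_semicircle R)) (measure_ge0 (@std_semicircle R))
  (@measure_semi_sigma_additive _ _ _ (@std_semicircle R)).
pose nu : {measure set (measurableTypeR R) -> \bar R} :=
  HB.pack (@std_semicircle R : set (measurableTypeR R) -> \bar R) C.
pose phi : measurableTypeR R -> R := ( *%R b).
have mphi : measurable_fun setT phi by exact: measurable_funM.
transitivity (\int[nu]_x (f (b * x))%:E)%E.
  have := @ge0_integral_pushforward _ _ _ _ R phi mphi nu setT (EFin \o f).
  rewrite preimage_setT; apply => //.
  - exact/measurable_EFinP.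
  - by move=> x _; rewrite lee_fin.
transitivity (\int[mu]_x (f (b * x) * pdf x)%:E)%E.
  apply: (@ge0_integral_density _ (measurableTypeR R) R mu nu pdf) => //.
  - exact: measurable_semicircle_pdf.
  - exact: semicircle_pdf_ge0.
rewrite /semicircle_mean /Rintegral fineK; last first.
  exact: integrable_fin_num (integrable_semicircle cfb).
rewrite [RHS]integral_mkcond; apply: eq_integral => x _; rewrite patchE.
case: ifPn => //; rewrite notin_setE => x2.
by rewrite semicircle_pdf_outside// mulr0.
Qed.

Lemma integral_semicircle (f : R -> R) (b : R) : continuous f ->
  (\int[semicircle b]_x (f x)%:E = (semicircle_mean (fun x => f (b * x)))%:E)%E.
Proof.
move=> cf; rewrite integralE.
have cp : continuous (fun x => Num.max (f x) 0).
  by apply: max_fun_continuous => //; exact: cst_continuous.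
have cn : continuous (fun x => Num.max (- f x) 0).
  apply: max_fun_continuous; last exact: cst_continuous.
  by move=> x; apply: cvgN; exact: cf.
have -> : ((EFin \o f)^\+)%E = EFin \o (fun x => Num.max (f x) 0).
  by apply/funext => x; rewrite funeposE /= EFin_max.
have -> : ((EFin \o f)^\-)%E = EFin \o (fun x => Num.max (- f x) 0).
  by apply/funext => x; rewrite funenegE /= EFin_max.
rewrite (@ge0_integral_semicircle _ b cp); last by move=> x; rewrite le_max lexx orbT.
rewrite (@ge0_integral_semicircle _ b cn); last by move=> x; rewrite le_max lexx orbT.
rewrite -EFinB /semicircle_mean -RintegralB//; last 2 first.
- exact: integrable_semicircle (@continuous_scale _ b cp).
- exact: integrable_semicircle (@continuous_scale _ b cn).
congr _%:E; apply: eq_Rintegral => x _; rewrite -mulrBl; congr (_ * _).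
case: (leP (f (b * x)) 0) => h; first by rewrite max_l ?oppr_ge0// opprK add0r.
by rewrite max_r ?subr0// oppr_le0 ltW.
Qed.

Let w (x : R) : R := Num.sqrt (4 - x ^+ 2).

Let continuous_w : continuous w.
Proof.
move=> x; apply: (@continuous_comp _ _ _ (fun x : R => 4 - x ^+ 2) (@Num.sqrt R)).
  by apply: cvgB; [exact: cvg_cst|exact: exprn_continuous].
exact: sqrt_continuous.
Qed.

Let w_gt0 (x : R) : -2 < x < 2 -> 0 < w x.
Proof. by move=> x2; rewrite sqrtr_gt0; nra. Qed.

Let is_derive_w (x : R) : -2 < x < 2 -> is_derive x 1 w (- x / w x).
Proof.
move=> x2; have h : 0 < 4 - x ^+ 2 by nra.
have h1 : is_derive x 1 (fun x : R => 4 - x ^+ 2) (- (2 * x)).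
  by apply: is_derive_eq; rewrite -[_ *: _]/(_ * _); ring.
have h2 := is_derive1_sqrt h.
have := @is_derive1_comp R (@Num.sqrt R) (fun x : R => 4 - x ^+ 2) x _ _ h2 h1.
move/(is_derive_eq); apply; rewrite -/(w x).
by field; rewrite gt_eqF// w_gt0.
Qed.

(** The derivative is asked for inside the interval only, since the chain rule through [w] fails at
    the ends of [[-2, 2]]. *)
Lemma continuous_FTC2_everywhere (f F : R -> R) (a b : R) : a < b ->
  continuous f -> continuous F ->
  (forall x : R, a < x < b -> is_derive x 1 F (f x)) ->
  (\int[mu]_(x in `[a, b]) (f x)%:E = (F b - F a)%:E)%E.
Proof.
move=> ab cf cF dF; rewrite EFinB; apply: continuous_FTC2 => //.
- exact: continuous_subspaceT.
- split=> [x||].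
  + by rewrite in_itv /= => xab; case: (dF x xab).
  + by apply: cvg_at_right_filter; exact: cF.
  + by apply: cvg_at_left_filter; exact: cF.
- move=> x; rewrite in_itv /= => xab; have dFx := dF x xab.
  by rewrite derive1E; exact: derive_val.
Qed.

(** The function [x ^ k w ^ 3] vanishes at both ends, and its derivative is [(4 k x ^ (k - 1) - (k +
    3) x ^ (k + 1)) w]. For [k = 0] the truncated predecessor is harmless, its coefficient being
    0. *)
Lemma semicircle_mean_ibp k :
  (k.+3)%:R * semicircle_mean (fun x => x ^+ k.+1) =
  4 * k%:R * semicircle_mean (fun x => x ^+ k.-1).
Proof.
pose f (x : R) := (4 * k%:R * x ^+ k.-1 - k.+3%:R * x ^+ k.+1) * w x.
pose F (x : R) := x ^+ k * w x ^+ 3.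
have cX j : continuous (fun x : R => x ^+ j) by exact: exprn_continuous.
have cf : continuous f.
  move=> x; apply: cvgM; last exact: continuous_w.
  by apply: cvgB; apply: cvgMl_tmp; exact: cX.
have cF : continuous F.
  move=> x; apply: cvgM; first exact: cX.
  by apply: (@continuous_comp _ _ _ w (fun x => x ^+ 3)); [exact: continuous_w|exact: cX].
have dF (x : R) : -2 < x < 2 -> is_derive x 1 F (f x).
  move=> x2; have dw := is_derive_w x2; have w0 := w_gt0 x2.
  have w2 : w x ^+ 2 = 4 - x ^+ 2 by rewrite sqr_sqrtr//; nra.
  have := is_deriveM (is_deriveX k (is_derive_id x 1)) (is_deriveX 3 dw).
  have -> : (id : R -> R) ^+ k * w ^+ 3 = F by apply/funext => y; rewrite /F !fctE.
  move/is_derive_eq; apply; rewrite /= -[LHS]/(_ * (_ * _) + _ * (_ * _)) !exprfctE /f.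
  have kE : k%:R * (x ^+ 2 * x ^+ k.-1) = k%:R * x ^+ k.+1 :> R.
    by case: (k) => [|m]; rewrite ?mul0r//= -exprD add2n.
  rewrite (exprS (w x) 2) !w2 (exprS x k) -[k.+3]addn3 natrD.
  rewrite (exprS x k) in kE.
  transitivity ((4 * k%:R * x ^+ k.-1 - k%:R * (x ^+ 2 * x ^+ k.-1) - 3 * (x * x ^+ k)) * w x).
    have w2' : (4 - x ^+ 2) / w x = w x by rewrite -w2 expr2 mulfK// gt_eqF.
    transitivity (- 3 * (x * x ^+ k) * ((4 - x ^+ 2) / w x) + w x * (4 - x ^+ 2) * (k%:R * x ^+ k.-1)).
      by ring.
    move: (w x) w2' => W ->; ring.
  by rewrite kE; ring.
have := @continuous_FTC2_everywhere f F (-2) 2 _ cf cF dF.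
have w0 : w 2 = 0 /\ w (-2) = 0.
  by rewrite /w sqrrN (_ : 4 - 2 ^+ 2 = 0) ?sqrtr0//; ring.
rewrite /F w0.1 w0.2 expr0n /= !mulr0 subrr => /(_ _) If.
have {}If : \int[mu]_(x in `[-2, 2]) f x = 0 by rewrite /Rintegral If//; lra.
have i1 := integrable_semicircle (@exprn_continuous R k.-1).
have i2 := integrable_semicircle (@exprn_continuous R k.+1).
have i3 : mu.-integrable `[-2, 2] (EFin \o f).
  apply: continuous_compact_integrable; first exact: segment_compact.
  exact: continuous_subspaceT.
have SE : 4 * k%:R * semicircle_mean (fun x => x ^+ k.-1) -
    k.+3%:R * semicircle_mean (fun x => x ^+ k.+1) = (2 * pi)^-1 * \int[mu]_(x in `[-2, 2]) f x.
  rewrite /semicircle_mean -RintegralZl// -RintegralZl// -RintegralB//.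
  - rewrite -RintegralZl//; apply: eq_Rintegral => x _.
    by rewrite /f /semicircle_pdf -/(w x); ring.
  - apply: continuous_compact_integrable; first exact: segment_compact.
    apply: continuous_subspaceT => x; apply: cvgMl_tmp; apply: cvgM; first exact: cX.
    exact: continuous_semicircle_pdf.
  - apply: continuous_compact_integrable; first exact: segment_compact.
    apply: continuous_subspaceT => x; apply: cvgMl_tmp; apply: cvgM; first exact: cX.
    exact: continuous_semicircle_pdf.
by apply/eqP; rewrite eq_sym -subr_eq0 SE If mulr0.
Qed.

(** The substitution [x = 2 sin t] turns the integral of [w] into that of [4 cos t ^ 2] over a half
    period, with primitive [H]. *)
Lemma semicircle_mean_one : semicircle_mean (fun=> 1) = 1.
Proof.
pose F (t : R) : R := 2 * sin t; pose a : R := - (pi / 2); pose b : R := pi / 2.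
have ab : a < b by rewrite /a /b; have := pi_gt0 R; lra.
have dF (t : R) : is_derive t 1 F (2 * cos t).
  rewrite /F; have := is_deriveZ 2 (is_derive_sin t).
  by [].
have dFE : F^`() = (fun t => 2 * cos t).
  by apply/funext => t; rewrite derive1E; have := dF t => ?; exact: derive_val.
have ccos : continuous (fun t : R => 2 * cos t).
  by move=> t; apply: cvgMl_tmp; exact: continuous_cos.
have cF : continuous F by move=> t; apply: cvgMl_tmp; exact: continuous_sin.
have Fa : F a = -2 by rewrite /F /a sinN sin_pihalf mulrN1.
have Fb : F b = 2 by rewrite /F /b sin_pihalf mulr1.
have sub := @integration_by_substitution_increasing R F w a b (ltW ab).
rewrite dFE Fa Fb in sub; have {sub}sub : (\int[mu]_(x in `[(-2)%R, 2%R]) (w x)%:E =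
    \int[mu]_(t in `[a, b]) (w (F t) * (2 * cos t))%R%:E)%E.
  etransitivity; first apply: sub.
  - by move=> x y xab yab xy; rewrite /F ltr_pM2l// ltr_sin.
  - by move=> t _; exact: ccos.
  - by apply/cvg_ex; exists (2 * cos a); apply: cvg_at_right_filter; exact: ccos.
  - by apply/cvg_ex; exists (2 * cos b); apply: cvg_at_left_filter; exact: ccos.
  - split=> [t _||].
    + by case: (dF t).
    + by apply: cvg_at_right_filter; exact: cF.
    + by apply: cvg_at_left_filter; exact: cF.
  - exact: continuous_subspaceT.
  - by [].
pose H (t : R) : R := 2 * t + 2 * (sin t * cos t).
have intE : (\int[mu]_(t in `[a, b]) (w (F t) * (2 * cos t))%R%:E = (H b - H a)%:E)%E.
  have -> : (\int[mu]_(t in `[a, b]) (w (F t) * (2 * cos t))%R%:E =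
     \int[mu]_(t in `[a, b]) (4 * cos t ^+ 2)%:E)%E.
    apply: eq_integral => t; rewrite inE /= in_itv /= => tab.
    rewrite /w /F; congr _%:E.
    have -> : 4 - (2 * sin t) ^+ 2 = (2 * cos t) ^+ 2.
      by have := cos2Dsin2 t; nra.
    have c0 : 0 <= cos t by exact: cos_ge0_pihalf.
    by rewrite sqrtr_sqr ger0_norm ?mulr_ge0//; ring.
  apply: continuous_FTC2_everywhere => //.
  - by move=> t; apply: cvgMl_tmp; apply: (@continuous_comp _ _ _ (@cos R) (fun x => x ^+ 2));
      [exact: continuous_cos|exact: exprn_continuous].
  - move=> t; apply: cvgD; first by apply: cvgMl_tmp; exact: cvg_id.
    by apply: cvgMl_tmp; apply: cvgM; [exact: continuous_sin|exact: continuous_cos].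
  - move=> t _.
    have h := is_deriveD (is_deriveZ 2 (is_derive_id t (1:R)))
      (is_deriveZ 2 (is_deriveM (is_derive_sin t) (is_derive_cos t))).
    have -> : H = (2 : R) \*: (id : R -> R) + (2 : R) \*: (sin * cos).
      by apply/funext => y.
    move: h => /is_derive_eq; apply.
    rewrite /= -[LHS]/(2 * 1 + 2 * (sin t * (- sin t) + cos t * cos t)).
    by have := cos2Dsin2 t; nra.
rewrite /semicircle_mean (@eq_Rintegral _ _ _ mu _ (fun x => (2 * pi)^-1 * w x)); last first.
  by move=> x _; rewrite mul1r /semicircle_pdf mulrC.
rewrite RintegralZl//; last first.
  apply: continuous_compact_integrable; first exact: segment_compact.
  exact: continuous_subspaceT.
rewrite [X in _ * X](_ : _ = 2 * pi); first by rewrite mulVf// mulf_neq0// gt_eqF// pi_gt0.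
rewrite /Rintegral sub intE /= /H /a /b sinN cosN sin_pihalf cos_pihalf; lra.
Qed.

End SemicircleMean.

(** Bridges the recursion obtained from integration by parts and the one obeyed by walks. With [S]
    the convolution and [T] the same sum weighted by [i], the symmetry of the summands gives
    [2 T n = n S n], and the hypothesis then gives [S] the recursion of [c]. *)
Lemma catalan_convolution (R : realType) (c : nat -> R) : c 0 = 1 ->
  (forall j, (j + 2)%:R * c j.+1 = (4 * j + 2)%:R * c j) ->
  forall n, c n.+1 = \sum_(i < n.+1) c i * c (n - i)%N.
Proof.
move=> c0 cS n; pose S n := \sum_(i < n.+1) c i * c (n - i)%N.
pose T n := \sum_(i < n.+1) i%:R * (c i * c (n - i)%N).
have TS m : 2 * T m = m%:R * S m.
  have -> : 2 * T m = T m + T m by ring.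
  rewrite {2}/T (reindex_inj rev_ord_inj) /= /T /S -big_split mulr_sumr.
  apply: eq_bigr => i _; rewrite /= !subSS subKn; last by rewrite -ltnS.
  transitivity ((i%:R + (m - i)%:R) * (c i * c (m - i)%N)); first by ring.
  by rewrite -natrD subnKC// -ltnS.
(* The left side is the sum of [(i + 1) c i * c (m + 1 - i)]: its term [i = 0] is [c m.+1], and the
   others are rewritten by [cS]. *)
have step m : T m.+1 + S m.+1 = c m.+1 + 4 * T m + 2 * S m.
  rewrite -big_split /= big_ord_recl /= subn0 c0 mul0r add0r mul1r -addrA; congr (_ + _).
  rewrite /T /S !mulr_sumr -big_split /=; apply: eq_bigr => i _.
  rewrite /bump /= add1n subSS.
  have := cS i; rewrite (natrD _ i) (natrD _ (4 * i)) natrM -natr1 => ci.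
  transitivity ((i%:R + 2) * c i.+1 * c (m - i)%N); first by ring.
  by rewrite ci; ring.
elim: n => [|n IH].
  have c1 : 2%:R * c 1%N = 2%:R * c 0 := cS 0%N.
  by rewrite big_ord1 c0 mulr1 -c0; apply: mulfI c1; rewrite pnatr_eq0.
rewrite -/(S n.+1); have h1 := TS n.+1; have h2 := TS n; have h3 := step n.
rewrite -/(S n) in IH; have h4 := cS n.+1.
have n0 : (n.+1 + 2)%:R != 0 :> R by rewrite pnatr_eq0.
apply: (mulfI n0); rewrite h4 IH.
have e1 : (n.+1 + 2)%:R = n%:R + 3 :> R by rewrite natrD -natr1; ring.
have e2 : (4 * n.+1 + 2)%:R = 4 * n%:R + 6 :> R by rewrite natrD natrM -natr1; ring.
rewrite e1 e2; rewrite -natr1 in h1.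
rewrite IH in h3.
transitivity (2 * (T n.+1 + S n.+1)); last by rewrite mulrDr h1; ring.
have -> : 2 * (T n.+1 + S n.+1) = 2 * S n + 4 * (2 * T n) + 4 * S n by rewrite h3; ring.
by rewrite h2; ring.
Qed.

Section SemicircleMoments.
Variable R : realType.
Local Notation mu := (@lebesgue_measure R).
Local Notation pdf := (@semicircle_pdf R).
Local Notation sm := (@semicircle_mean R).

Lemma semicircle_mean_is_mean : is_mean sm.
Proof.
split=> [|a f g cf cg|f e cf fe].
- exact: semicircle_mean_one.
- have caf : continuous (fun x => a * f x) by move=> x; apply: cvgMl_tmp; exact: cf.
  rewrite /semicircle_mean -RintegralZl//; last exact: integrable_semicircle.
  rewrite -RintegralD//; last 2 first.
  + have := integrable_semicircle caf.
    by under [EFin \o _]funext do rewrite /= -mulrA.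
  + exact: integrable_semicircle.
  by apply: eq_Rintegral => x _; ring.
- have i1 := integrable_semicircle cf.
  apply: (le_trans (le_normr_Rintegral _ i1)) => //.
  have -> : e = \int[mu]_(x in `[-2, 2]) (e * (1 * pdf x)).
    rewrite RintegralZl//; last by apply: (@integrable_semicircle R (fun=> 1)); exact: cst_continuous.
    by rewrite [X in _ * X](semicircle_mean_one R) mulr1.
  apply: le_Rintegral => //.
  + apply: continuous_compact_integrable; first exact: segment_compact.
    apply: continuous_subspaceT => x; apply: cvg_norm; apply: cvgM; first exact: cf.
    exact: continuous_semicircle_pdf.
  + apply: continuous_compact_integrable; first exact: segment_compact.
    apply: continuous_subspaceT => x; apply: cvgMl_tmp; apply: cvgMl_tmp.
    exact: continuous_semicircle_pdf.
  + move=> x /=; rewrite in_itv /= => x2; rewrite normrM mul1r [`|pdf x|]ger0_norm ?semicircle_pdf_ge0//.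
    by rewrite ler_wpM2r ?semicircle_pdf_ge0// fe.
Qed.

Lemma mean_scale (A : (R -> R) -> R) (a : R) (f : R -> R) : is_mean A -> continuous f ->
  A (fun x => a * f x) = a * A f.
Proof.
move=> mA cf; have := mean_linear mA a cf (@cst_continuous R R 0).
rewrite (mean_cst mA) addr0 => <-; congr A.
by apply/funext => x; rewrite addr0.
Qed.

Lemma semicircle_moment_odd j : sm (fun x => x ^+ j.*2.+1) = 0.
Proof.
elim: j => [|j IH].
  have := semicircle_mean_ibp R 0; rewrite mulr0 mul0r => /eqP.
  by rewrite mulf_eq0 pnatr_eq0 => /eqP.
have := semicircle_mean_ibp R j.+1.*2; rewrite doubleS /= IH mulr0 => /eqP.
by rewrite mulf_eq0 pnatr_eq0 => /eqP.
Qed.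

Lemma semicircle_moment_rec j :
  (j + 2)%:R * sm (fun x => x ^+ j.+1.*2) = (4 * j + 2)%:R * sm (fun x => x ^+ j.*2).
Proof.
have := semicircle_mean_ibp R j.*2.+1; rewrite /= -doubleS => h.
have two0 : (2 : R) != 0 by rewrite pnatr_eq0.
apply: (mulfI two0); rewrite mulrA.
have -> : 2 * (j + 2)%:R = j.*2.+4%:R :> R.
  by rewrite -!natrM; congr _%:R; rewrite mulnDr mul2n addn4.
rewrite h !mulrA; congr (_ * _).
by rewrite -(natr1 j.*2) -mul2n (natrD _ (4 * j)) !natrM; ring.
Qed.

Lemma semicircle_moment_convolution j : sm (fun x => x ^+ j.+1.*2) =
  \sum_(i < j.+1) sm (fun x => x ^+ i.*2) * sm (fun x => x ^+ (j - i).*2).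
Proof.
apply: (@catalan_convolution R (fun j => sm (fun x => x ^+ j.*2))).
  exact: semicircle_mean_one.
exact: semicircle_moment_rec.
Qed.

Lemma scaled_semicircle_is_mean (b : R) : 0 <= b <= 1 -> is_mean (fun f => sm (fun x => f (b * x))).
Proof.
move=> /andP[b0 b1]; split=> [|a f g cf cg|f e cf fe].
- exact: semicircle_mean_one.
- by apply: (mean_linear semicircle_mean_is_mean); exact: continuous_scale.
- apply: (mean_norm_le semicircle_mean_is_mean); first exact: continuous_scale.
  by move=> x /andP[x1 x2]; apply: fe; nra.
Qed.

Section RegularSequence.
Variables (G : nat -> sgraph) (d : nat -> R) (alpha : R).
Hypothesis adm : forall n, admissible (G n) (d n).
Hypothesis d_oo : d n @[n --> \oo] --> +oo.
Hypothesis alpha01 : 0 <= alpha <= 1.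
Hypothesis reg : alpha_regular alpha G d.

Lemma regular_matching_mean_cvg (f : R -> R) : continuous f ->
  matching_mean (G n) (d n) f @[n --> \oo] --> sm (fun x => f (Num.sqrt alpha * x)).
Proof.
move=> cf; have [a0 a1] := andP alpha01.
have b01 : 0 <= Num.sqrt alpha <= 1 by rewrite sqrtr_ge0/= -sqrtr1 ler_sqrt.
apply: (mean_moment_lim (fun n => matching_mean_is_mean (adm n)) (scaled_semicircle_is_mean b01)) => // k.
have -> : sm (fun x => (Num.sqrt alpha * x) ^+ k) = Num.sqrt alpha ^+ k * sm (fun x => x ^+ k).
  rewrite -(mean_scale _ semicircle_mean_is_mean); last exact: exprn_continuous.
  by congr sm; apply/funext => x; rewrite exprMn.
rewrite -(odd_double_half k); case: (odd k) => /=.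
  rewrite add1n semicircle_moment_odd mulr0.
  by under eq_fun do rewrite matching_mean_odd; exact: cvg_cst.
rewrite add0n -mul2n exprM sqr_sqrtr// mul2n; set j := k./2.
apply: matching_mean_moment => //.
apply: (@plane_walks_regular R G d alpha adm alpha01 reg (fun j => sm (fun x => x ^+ j.*2))) => //.
- exact: semicircle_mean_one.
- exact: semicircle_moment_convolution.
Qed.

Lemma regular_matching_measures_cvg :
  weak_cvg (fun n => matching_measure (G n) (d n)) (semicircle (Num.sqrt alpha)).
Proof.
move=> f cf _; rewrite integral_semicircle//.
under eq_fun do rewrite (integral_matching_measure _ _ (continuous_measurable_fun cf)).
by apply: cvg_EFin_seq; exact: regular_matching_mean_cvg.
Qed.

End RegularSequence.
End SemicircleMoments.

(** * Complete graphs and the constant [1 / e] *)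

Definition complete_adj m : rel 'I_m.+1 := fun i j => i != j.

Lemma complete_adj_sym m : symmetric (@complete_adj m).
Proof. by move=> i j; rewrite /complete_adj eq_sym. Qed.

Lemma complete_adj_irr m : irreflexive (@complete_adj m).
Proof. by move=> i; rewrite /complete_adj eqxx. Qed.

Definition complete_graph m : sgraph := SGraph (@complete_adj_sym m) (@complete_adj_irr m).

Lemma nvert_complete m : nvert (complete_graph m) = m.+1.
Proof. exact: card_ord. Qed.

Lemma degree_complete m (i : complete_graph m) : degree i = m.
Proof.
have := cardC (pred1 i); rewrite card1 card_ord add1n => -[{2}<-].
by apply: eq_card => j; rewrite !inE eq_sym.
Qed.

Section CompleteGraph.
Variable R : realType.
Local Notation sm := (@semicircle_mean R).

(** The bound [m + 1], one above the degree, equals the number of vertices and stays at least 1 for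
    [m = 0]. *)
Lemma complete_admissible m : admissible (complete_graph m) (m.+1%:R : R).
Proof.
split; [by rewrite nvert_complete|by rewrite ler1n|move=> i].
by rewrite degree_complete ler_nat.
Qed.

Lemma complete_regular : alpha_regular (1 : R) complete_graph (fun m => m.+1%:R).
Proof.
move=> e e0; apply: (cvg_near_cst).
have [N _ Ne] : \forall m \near \oo, (m.+1%:R^-1 : R) < e by exact: near_infty_natSinv_lt (PosNum e0).
exists N => // m /Ne me.
rewrite eq_card0 ?mul0r// => i; rewrite !inE degree_complete; apply/negbTE; rewrite -leNgt.
have m0 : m.+1%:R != 0 :> R by rewrite pnatr_eq0.
have -> : m%:R / m.+1%:R - 1 = - m.+1%:R^-1 :> R.
  by apply: (mulIf m0); rewrite mulrBl divfK// mulNr mulVf// -natr1; ring.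
by rewrite normrN ger0_norm ?invr_ge0// ltW.
Qed.

Section MatchingBound.
Variable y : R.
Hypothesis y0 : 0 <= y.

(** A supersolution of [Z n.+1 = y * Z n + n * Z n.-1], the recursion for [mgen] on the
    subsets of a complete graph. *)
Let a n := Num.sqrt n`!%:R * expR (2 * y * Num.sqrt n%:R).

Let a_step n : y * a n + n%:R * a n.-1 <= a n.+1.
Proof.
rewrite /a; set s := Num.sqrt n%:R; set t := Num.sqrt n.+1%:R.
have t0 : 0 < t by rewrite sqrtr_gt0 ltr0n.
have s0 : 0 <= s by exact: sqrtr_ge0.
have st : s <= t by rewrite ler_sqrt ?ler_nat.
have ts : t ^+ 2 - s ^+ 2 = 1 by rewrite !sqr_sqrtr// -natr1; ring.
have f1 : Num.sqrt n.+1`!%:R = t * Num.sqrt n`!%:R :> R.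
  by rewrite factS natrM sqrtrM.
have f2 : n%:R * Num.sqrt n.-1`!%:R = s * Num.sqrt n`!%:R :> R.
  case: n @s @t {t0 s0 st ts f1} => [|n] s t; first by rewrite /s mul0r sqrtr0 mul0r.
  by rewrite factS natrM sqrtrM// mulrA -expr2 sqr_sqrtr.
rewrite [n%:R * _]mulrA f2 f1.
set q := Num.sqrt n`!%:R; have q0 : 0 <= q by exact: sqrtr_ge0.
have e1 : expR (2 * y * Num.sqrt n.-1%:R) <= expR (2 * y * s).
  by rewrite ler_expR ler_wpM2l ?mulr_ge0// ler_sqrt ?ler_nat ?leq_pred.
(* Explains the factor 2 in [a]: from [t ^ 2 - s ^ 2 = 1] and [s <= t], [2 (t - s) >= 1 / t], so [1
   + y / t <= exp (y / t) <= exp (2 y (t - s))]. *)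
have e2 : expR (2 * y * s) * (1 + y / t) <= expR (2 * y * t).
  have -> : 2 * y * t = 2 * y * s + 2 * y * (t - s) by ring.
  rewrite expRD ler_wpM2l ?expR_ge0// (le_trans (expR_ge1Dx _))// ler_expR.
  rewrite ler_pdivrMr// [2 * y]mulrC -!mulrA ler_peMr//.
  nra.
have E0 : 0 <= expR (2 * y * s) by exact: expR_ge0.
apply: (@le_trans _ _ (t * q * (expR (2 * y * s) * (1 + y / t)))); last first.
  by rewrite ler_wpM2l ?mulr_ge0// ltW.
have -> : t * q * (expR (2 * y * s) * (1 + y / t)) =
    y * (q * expR (2 * y * s)) + t * q * expR (2 * y * s).
  by field; rewrite gt_eqF.
rewrite lerD2l; apply: ler_pM => //.
  by rewrite mulr_ge0.
by rewrite ler_wpM2r.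
Qed.

Lemma mgen_complete_le m (S : {set complete_graph m}) : mgen y 1 S <= a #|S|.
Proof.
have [k] := ubnP #|S|; elim: k S => // k IH S; rewrite ltnS => Sk.
have [->|/set0Pn[v vS]] := eqVneq S finset.set0.
  by rewrite mgen0 cards0 /a sqrtr0 mulr0 expR0 mulr1 sqrtr1.
have cS : #|S| = #|S :\ v|.+1 by rewrite (cardsD1 v S) vS.
rewrite (mgen_rec _ _ vS) mul1r cS; apply: le_trans (a_step _).
apply: lerD; first by rewrite ler_wpM2l// IH// -cS.
rewrite mulr_natl -sumr_const; apply: (@le_trans _ _ (\sum_(u in S :\ v) mgen y 1 (S :\ v :\ u))).
  by rewrite le_eqVlt; apply/orP; left; apply/eqP; apply: eq_bigl => u; rewrite !inE andbC eq_sym.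
apply: ler_sum => u uS; have cu : #|S :\ v| = #|S :\ v :\ u|.+1 by rewrite (cardsD1 u (S :\ v)) uS.
rewrite cu /=; apply: IH; by rewrite -ltnS -cu -cS (leq_trans Sk).
Qed.

End MatchingBound.

(** A weak Stirling bound, [N! <= N ^ (N + 1) e ^ (1 - N)] with [N = n + 1]. The loss of a factor of
    order [N] vanishes after taking [N]-th roots. *)
Lemma ln_fact_le n : ln n.+1`!%:R <= n.+2%:R * ln n.+1%:R - n%:R :> R.
Proof.
elim: n => [|n IH]; first by rewrite ln1 mulr0 subr0.
rewrite factS natrM lnM ?posrE ?ltr0n ?fact_gt0//.
have n0 : 0 < n.+2%:R :> R by rewrite ltr0n.
have : ln n.+1%:R - ln n.+2%:R <= - n.+2%:R^-1 :> R.
  rewrite -ln_div ?posrE ?ltr0n//.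
  have -> : n.+1%:R / n.+2%:R = 1 + - n.+2%:R^-1 :> R.
    have := lt0r_neq0 n0; rewrite -[n.+2%:R]natr1; set p : R := n.+1%:R; move=> p0.
    by field.
  by apply: le_ln1Dx; rewrite ltrN2 invf_lt1// ltr1n.
rewrite -(ler_pM2l n0) mulrN divff ?gt_eqF// => h.
have n3 : n.+3%:R = n.+2%:R + 1 :> R by rewrite -natr1.
have n1 : n%:R = n.+1%:R - 1 :> R by rewrite -natr1 addrK.
rewrite n1 in IH; rewrite n3; move: IH h; set p := ln n.+1%:R; set q := ln n.+2%:R; lra.
Qed.

(** The semicircle law is the limit of the matching measures of complete graphs. *)
Lemma semicircle_mean_ln_le (e : R) : 0 < e ->
  sm (fun x => ln (e + x ^+ 2)) <= -1 + 4 * Num.sqrt e.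
Proof.
move=> e0; have ce := continuous_ln_sqr e0.
have d_oo : (n.+1%:R : R) @[n --> \oo] --> +oo.
  by rewrite (cvg_shiftS (fun n => n%:R : R)); exact: cvgr_idn.
have := regular_matching_mean_cvg complete_admissible d_oo _ complete_regular ce.
rewrite lexx ler01 => /(_ isT); rewrite sqrtr1; under [X in semicircle_mean X]funext do rewrite mul1r.
move=> cv; apply/ler_addgt0Pr => r r0.
apply: (cvgr_to_le cv).
near=> m.
rewrite (matching_mean_ln (complete_admissible m) e0) nvert_complete.
set N : R := m.+1%:R; have N0 : 0 < N by rewrite ltr0n.
have y0 : 0 <= Num.sqrt (e * N) by exact: sqrtr_ge0.
have h := mgen_complete_le y0 [set: complete_graph m]%SET.
have cT : #|[set: complete_graph m]%SET| = m.+1 by rewrite cardsT card_ord.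
rewrite cT in h.
have h1 : ln (mgen (Num.sqrt (e * N)) 1 [set: complete_graph m]%SET) <= ln m.+1`!%:R / 2 + 2 * Num.sqrt e * N.
  apply: (@le_trans _ _ (ln (Num.sqrt m.+1`!%:R * expR (2 * Num.sqrt (e * N) * Num.sqrt N)))).
    rewrite ler_ln ?posrE ?mgen_gt0 ?sqrtr_gt0 ?mulr_gt0 ?expR_gt0 ?sqrtr_gt0 ?ltr0n ?fact_gt0//.
  rewrite lnM ?posrE ?expR_gt0 ?sqrtr_gt0 ?ltr0n ?fact_gt0// expRK.
  have f0 : 0 < m.+1`!%:R :> R by rewrite ltr0n fact_gt0.
  rewrite -[X in _ <= ln X / _ + _](sqr_sqrtr (ltW f0)) lnXn ?sqrtr_gt0//.
  rewrite -[ln _ *+ 2](mulr_natr (ln _)) mulfK ?pnatr_eq0//.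
  by rewrite lerD2l sqrtrM ?(ltW e0)// -!mulrA -expr2 sqr_sqrtr// ltW.
have h2 := ln_fact_le m.
have h3 : ln N <= 2 * Num.sqrt N.
  rewrite -{1}[N](sqr_sqrtr (ltW N0)) lnXn ?sqrtr_gt0// -[_ *+ 2](mulr_natl (ln _)).
  rewrite ler_pM2l// ltW//.
  by rewrite ln_sublinear// sqrtr_gt0.
have N2 : m.+2%:R = N + 1 :> R by rewrite -natr1.
have N1 : m%:R = N - 1 :> R by rewrite /N -natr1 addrK.
rewrite N2 N1 -/N in h2.
have q1 : 1 <= Num.sqrt N by rewrite -sqrtr1 ler_sqrt// ler1n.
(* The remaining error is [ln N + 1], at most [2 sqrt N + 1 <= 3 sqrt N], to be absorbed in
   [r N]. *)
have rq : 3 <= r * Num.sqrt N.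
  rewrite mulrC -ler_pdivrMr// -[3 / r]ger0_norm ?divr_ge0 ?(ltW r0)// -sqrtr_sqr ler_sqrt//.
  apply: (@le_trans _ _ m%:R); last by rewrite ler_nat.
  by near: m; exact: nbhs_infty_ger.
have qN : Num.sqrt N ^+ 2 = N by rewrite sqr_sqrtr// ltW.
rewrite -(ler_pM2l N0); move: h1; set L := ln (mgen _ _ _) => h1.
have -> : N * (2 / N * L - ln N) = 2 * L - N * ln N by field; rewrite gt_eqF.
nra.
Unshelve. all: end_near. Qed.

Lemma scaled_semicircle_mean_ln_lt (alpha c : R) : 0 <= alpha -> alpha / expR 1 < c ->
  exists2 e, 0 < e & sm (fun x => ln (e + (Num.sqrt alpha * x) ^+ 2)) < ln c.
Proof.
move=> a0 ac; have c0 : 0 < c by rewrite (le_lt_trans _ ac)// divr_ge0 ?expR_ge0.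
have [a00|an0] := eqVneq alpha 0.
  (* For [alpha = 0] the law is the Dirac mass at 0 and the integrand is constant, so any value
     below [c] would do. *)
  exists (c / 2); first by rewrite divr_gt0.
  rewrite (_ : (fun x => _) = fun=> ln (c / 2)); last first.
    by apply/funext => x; rewrite a00 sqrtr0 mul0r expr0n addr0.
  by rewrite (mean_cst (semicircle_mean_is_mean R)) ltr_ln ?posrE ?divr_gt0//; lra.
have a1 : 0 < alpha by rewrite lt_neqAle eq_sym an0.
(* With [e = alpha s ^ 2] the factor [alpha] comes out of the logarithm and the mean is at most
   [ln alpha - 1 + 4 s], which uses half of the gap. *)
pose s := (ln c - (ln alpha - 1)) / 8.
have s0 : 0 < s.
  rewrite divr_gt0// subr_gt0 -[1]expRK -ln_div ?posrE ?expR_gt0//.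
  by rewrite ltr_ln ?posrE ?divr_gt0 ?expR_gt0.
have s2 : 0 < s ^+ 2 by rewrite exprn_gt0.
exists (alpha * s ^+ 2); first by rewrite mulr_gt0.
have -> : sm (fun x => ln (alpha * s ^+ 2 + (Num.sqrt alpha * x) ^+ 2)) =
    ln alpha + sm (fun x => ln (s ^+ 2 + x ^+ 2)).
  have := mean_linear (semicircle_mean_is_mean R) (ln alpha) (@cst_continuous R R 1)
    (continuous_ln_sqr s2).
  rewrite (mean_one (semicircle_mean_is_mean R)) mulr1 => <-; congr sm.
  apply/funext => x; rewrite [(_ * x) ^+ 2]exprMn sqr_sqrtr// -mulrDr lnM// posrE.
  by rewrite ltr_pwDl ?sqr_ge0.
have := semicircle_mean_ln_le s2; rewrite sqrtr_sqr (ger0_norm (ltW s0)) => h.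
apply: (@le_lt_trans _ _ (ln alpha + (-1 + 4 * s))); first by rewrite lerD2l.
have : ln c = ln alpha - 1 + 8 * s by rewrite /s; field.
lra.
Qed.

End CompleteGraph.

(** The comparison is with [ln c] for [c] above [alpha / e], not with the logarithm of [alpha / e]
    itself, so [alpha = 0] is covered. *)
Lemma regular_total_matchings_limsup (R : realType) (G : nat -> sgraph) (d : nat -> R) (alpha : R) :
  (forall n, admissible (G n) (d n)) -> d n @[n --> \oo] --> +oo ->
  0 <= alpha <= 1 -> alpha_regular alpha G d ->
  (limn_esup (fun n => ((total_matchings (G n))%:R `^ (2 / (nvert (G n))%:R) / d n)%:E)
   <= (alpha / expR 1)%:E)%E.
Proof.
move=> adm d_oo alpha01 reg; have [a0 a1] := andP alpha01.
apply: limn_esup_le => e e0; set c := _ + e.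
have ac : alpha / expR 1 < c by rewrite ltrDl.
have c0 : 0 < c by rewrite (le_lt_trans _ ac)// divr_ge0 ?expR_ge0.
have [r r0 rc] := scaled_semicircle_mean_ln_lt a0 ac.
have lc := regular_matching_mean_cvg adm d_oo alpha01 reg (continuous_ln_sqr r0).
set l := semicircle_mean _ in lc.
have lc0 : 0 < ln c - l by rewrite subr_gt0.
have := ln_total_matchings_limsup adm d_oo r0 lc0 lc.
apply: filterS => n; rewrite addrC subrK ler_ln ?posrE// divr_gt0 ?(adm_gt0 (adm n))//.
by rewrite powR_gt0// (total_matchings_mgen R) mgen_gt0.
Qed.

Local Open Scope classical_set_scope.
Local Open Scope ring_scope.

Theorem theorem3p6 (R : realType) (G : nat -> sgraph) (d : nat -> R)
    (adm : forall n, admissible (G n) (d n))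
    (d_oo : d n @[n --> \oo] --> +oo) :
  ((forall F : sgraph, is_tree F -> cvgn (fun n => density F (G n) (d n))) ->
    exists rho : probability R R,
      [/\ rho `[-2, 2]%classic = 1%E,
          weak_cvg (fun n => matching_measure (G n) (d n)) rho
        & (limn_esup (fun n => (ln (
             (total_matchings (G n))%:R `^ (2 / (nvert (G n))%:R) / d n)%R)%:E)
           <= 2%:E * \int[rho]_(x in `[(-2)%R, 2%R]) lne `|x|%:E)%E])
  /\
  (forall alpha : R, 0 <= alpha <= 1 -> alpha_regular alpha G d ->
    weak_cvg (fun n => matching_measure (G n) (d n))
             (semicircle (Num.sqrt alpha))
    /\ (limn_esup (fun n =>
          ((total_matchings (G n))%:R `^ (2 / (nvert (G n))%:R) / d n)%:E)
        <= (alpha / expR 1)%:E)%E).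
Proof.
split; first exact: tree_convergent_matching_measures.
move=> alpha alpha01 reg; split; first exact: regular_matching_measures_cvg.
exact: regular_total_matchings_limsup.
Qed.
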